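(* Let $R$ be a commutative Noetherian ring with non-zero identity, $\mathfrak a$ an ideal of $R$, and $M$ a finitely generated $R$-module with $\mathfrak b:=\mathfrak a+\operatorname{Ann}_RM=(x_1,\dots,x_r)$. Let $\mathcal M$ be a Melkersson subcategory with respect to the ideal $\mathfrak b$, and let $X$ be a finitely generated $R$-module with $X/\mathfrak bX\notin\mathcal M$. Then: (a) $\mathcal M\text{-}\operatorname{depth}_{\mathfrak b}(X)=\inf\{i: H^i_{\mathfrak a}(M,X)\notin\mathcal M\}$. (b) $\mathcal M\text{-}\operatorname{depth}_{\mathfrak b}(X)=\inf\{i:\operatorname{Ext}^i_R(M/\mathfrak aM,X)\notin\mathcal M\}$. (c) $\mathcal M\text{-}\operatorname{depth}_{\mathfrak b}(X)=\inf\{i:H^i(x_1,\dots,x_r;X)\notin\mathcal M\}$, where $H^i(x_1,\dots,x_r;X)$ denotes Koszul cohomology.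
   Context: $H^i_{\mathfrak a}(M,X)=\varinjlim_{k}\operatorname{Ext}^i_R(M/\mathfrak a^kM,X)$ is the $i$-th generalized local cohomology module. A Serre subcategory of the category of $R$-modules is a (nonempty) class of $R$-modules such that for every short exact sequence $0\to X'\to X\to X''\to 0$, $X$ is in the class if and only if $X'$ and $X''$ are. A Serre subcategory $\mathcal M$ is a Melkersson subcategory with respect to an ideal $\mathfrak b$ if for every $\mathfrak b$-torsion $R$-module $Y$ (every element of $Y$ is killed by a power of $\mathfrak b$), $0:_Y\mathfrak b\in\mathcal M$ implies $Y\in\mathcal M$. A sequence $y_1,\dots,y_t$ of elements of $R$ is $\mathcal M$-regular on $X$ if for each $j=1,\dots,t$ the module $0:_{X/(y_1,\dots,y_{j-1})X}y_j$ belongs to $\mathcal M$. If $X$ is finitely generated and $X/\mathfrak bX\notin\mathcal M$, it is known (Aghapournahr–Melkersson) that every sequence in $\mathfrak b$ that is $\mathcal M$-regular on $X$ extends to a maximal one and that all maximal ones in $\mathfrak b$ have the same length; this common length is denoted $\mathcal M\text{-}\operatorname{depth}_{\mathfrak b}(X)$. *)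

(* Defs.v *)
(* Submodules of an R-module V are the library's [submodClosed V] (boolean
   predicates).  Ideals of R are the submodules of the regular module [R^o], so
   that, unlike in ring_quotient.v, the unit ideal is allowed. *)
From HB Require Import structures.
From mathcomp Require Import all_boot all_algebra.
From mathcomp Require Import boolp classical_sets functions.
From mathcomp Require Import freeg.

Set Implicit Arguments.
Unset Strict Implicit.
Unset Printing Implicit Defensive.

Import GRing.Theory.
Local Open Scope quotient_scope.
Local Open Scope ring_scope.

Section Submodules.
Variables (R : comNzRingType) (V : lmodType R).

Definition submod_prop (A : set V) : Prop :=
  A 0 /\ forall a u v, A u -> A v -> A (a *: u + v).

Definition submod_pred (A : set V) : V -> bool := fun v => `[< A v >].

Lemma submod_pred_closed (A : set V) :
  submod_prop A -> GRing.subsemimod_closed (submod_pred A).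
Proof.
move=> [A0 AL]; apply: GRing.submod_closed_semi; split; first exact/asboolP.
by move=> a u v /asboolP Au /asboolP Av; apply/asboolP; exact: AL.
Qed.

Definition mksubmod (A : set V) (hA : submod_prop A) : submodClosed V :=
  HB.pack (submod_pred A)
    (GRing.isSubmodClosed.Build R V (submod_pred A) (submod_pred_closed hA)).

Lemma mksubmodP (A : set V) (hA : submod_prop A) v :
  reflect (A v) (v \in mksubmod hA).
Proof. exact: asboolP. Qed.

Definition submod (N : submodClosed V) := {v : V | v \in N}.
HB.instance Definition _ N := SubChoice.copy (submod N) {v : V | v \in N}.
HB.instance Definition _ N := [SubChoice_isSubLmodule of submod N by <:].

(* [submodClosed] does not record closure under opposite. *)
Fact submod_zmod_closed (N : submodClosed V) : GRing.zmod_closed N.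
Proof. exact: GRing.submod_closedB (submodClosedP N). Qed.
Definition zmod_of (N : submodClosed V) : zmodClosed V :=
  HB.pack (fun v : V => v \in N)
    (GRing.isZmodClosed.Build V (fun v : V => v \in N) (submod_zmod_closed N)).

Definition quomod (N : submodClosed V) : Type := Quotient.quot (zmod_of N).

Section Quotient.
Variable N : submodClosed V.
HB.instance Definition _ := GRing.Zmodule.on (quomod N).

Definition proj (v : V) : quomod N := \pi_(Quotient.quot (zmod_of N)) v.

Lemma proj_eq u v : (proj u = proj v) <-> (u - v \in N).
Proof.
rewrite -[u - v \in N]/(u - v \in zmod_of N) Quotient.idealrBE.
by split=> [/eqP|/eqP].
Qed.

Lemma projD : {morph proj : u v / u + v}.
Proof. exact: (@Quotient.pi_add _ (zmod_of N)). Qed.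

Definition quolift (x : quomod N) : V := repr (x : Quotient.quot (zmod_of N)).

Definition quoscale (a : R) (x : quomod N) : quomod N :=
  proj (a *: quolift x).

Lemma quoliftK (x : quomod N) : proj (quolift x) = x.
Proof. exact: (@reprK _ (Quotient.quot (zmod_of N))). Qed.

Lemma quoscaleE a v : quoscale a (proj v) = proj (a *: v).
Proof.
by apply/proj_eq; rewrite -scalerBr rpredZ //; apply/proj_eq/quoliftK.
Qed.

Lemma projW (P : quomod N -> Prop) : (forall v, P (proj v)) -> forall x, P x.
Proof. by move=> h x; rewrite -[x]quoliftK. Qed.

Fact quoscaleA a b x : quoscale a (quoscale b x) = quoscale (a * b) x.
Proof. by elim/projW: x => v; rewrite !quoscaleE scalerA. Qed.
Fact quoscale1 x : quoscale 1 x = x.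
Proof. by elim/projW: x => v; rewrite !quoscaleE scale1r. Qed.
Fact quoscaleDr a x y : quoscale a (x + y) = quoscale a x + quoscale a y.
Proof.
elim/projW: x => u; elim/projW: y => v.
by rewrite -projD !quoscaleE scalerDr projD.
Qed.
Fact quoscaleDl x a b : quoscale (a + b) x = quoscale a x + quoscale b x.
Proof. by elim/projW: x => v; rewrite !quoscaleE scalerDl projD. Qed.

HB.instance Definition _ := GRing.Zmodule_isLmodule.Build R (quomod N)
  quoscaleA quoscale1 quoscaleDr quoscaleDl.

Fact proj_linear : linear proj.
Proof. by move=> a u v; rewrite projD -quoscaleE. Qed.
HB.instance Definition _ := GRing.isLinear.Build R V (quomod N) _ proj proj_linear.
End Quotient.

End Submodules.

Section LinearMaps.
Variable R : comNzRingType.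
Implicit Types U V W X : lmodType R.

Definition mklinear U V (f : U -> V) (hf : linear f) : {linear U -> V} :=
  HB.pack f (GRing.isLinear.Build R U V _ f hf).

Fact ker_prop U V (f : {linear U -> V}) : submod_prop [set u | f u = 0].
Proof.
split=> [|a u v /= fu fv]; first exact: linear0.
by rewrite linearP fu fv scaler0 addr0.
Qed.
Definition ker U V (f : {linear U -> V}) : submodClosed U :=
  mksubmod (ker_prop f).

Fact im_prop U V (f : {linear U -> V}) : submod_prop [set v | exists u, f u = v].
Proof.
split=> [|a _ _ [u <-] [v <-]]; first by exists 0; rewrite linear0.
by exists (a *: u + v); rewrite linearP.
Qed.
Definition im U V (f : {linear U -> V}) : submodClosed V :=
  mksubmod (im_prop f).

Section Induced.
Variables (U V : lmodType R) (f : {linear U -> V}).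
Variables (M : submodClosed U) (N : submodClosed V).
Hypothesis fMN : forall u, u \in M -> f u \in N.

Definition submod_fun (u : submod M) : submod N :=
  exist _ (f (val u)) (fMN (valP u)).
Fact submod_fun_linear : linear submod_fun.
Proof. by move=> a u v; apply: val_inj; rewrite /= linearP. Qed.
Definition submod_map : {linear submod M -> submod N} :=
  mklinear submod_fun_linear.

Definition quomod_fun (x : quomod M) : quomod N := proj N (f (quolift x)).
Lemma quomod_funE u : quomod_fun (proj M u) = proj N (f u).
Proof. by apply/proj_eq; rewrite -linearB fMN //; apply/proj_eq/quoliftK. Qed.
Fact quomod_fun_linear : linear quomod_fun.
Proof.
move=> a x y; elim/projW: x => u; elim/projW: y => v.
by rewrite -linearP !quomod_funE -linearP -linearP.
Qed.
Definition quomod_map : {linear quomod M -> quomod N} :=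
  mklinear quomod_fun_linear.
End Induced.

Definition lspan_set V (A : set V) : set V :=
  [set v | exists2 s : seq (R * V), (forall p, p \in s -> A p.2)
                                  & v = \sum_(p <- s) p.1 *: p.2].
Fact lspan_prop V (A : set V) : submod_prop (lspan_set A).
Proof.
split=> [|a u v [s As ->] [t At ->]]; first by exists [::]; rewrite ?big_nil.
exists ([seq (a * p.1, p.2) | p <- s] ++ t) => [p|].
  by rewrite mem_cat => /orP[/mapP[q /As Aq ->]//|/At].
rewrite big_cat big_map /= scaler_sumr; congr (_ + _).
by apply: eq_bigr => p _; rewrite scalerA.
Qed.
Definition lspan V (A : set V) : submodClosed V := mksubmod (lspan_prop A).

Definition finitely_generated V : Prop :=
  exists s : seq V, forall v, v \in lspan [set` s].

(* Products: [smul I A] is generated by the c *: v with c in I and v in A;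
   [smulmod I V] is the submodule I V. *)
Definition smul V (I : {pred R^o}) (A : {pred V}) : submodClosed V :=
  lspan [set w | exists c v, [/\ c \in I, v \in A & w = c *: v]].
Definition smulmod (I : {pred R^o}) V : submodClosed V := smul I (@predT V).

(* 0 :_V A *)
Fact colon_prop (A : {pred R^o}) V :
  submod_prop [set v : V | forall c, c \in A -> c *: v = 0].
Proof.
split=> [c _|a u v /= hu hv c cA]; first exact: scaler0.
by rewrite scalerDr scalerA mulrC -scalerA hu // hv // scaler0 addr0.
Qed.
Definition colon (A : {pred R^o}) V : submodClosed V :=
  mksubmod (@colon_prop A V).

Definition noetherian : Prop :=
  forall I : submodClosed R^o, exists s : seq R, I =i lspan [set` (s : seq R^o)].

Fixpoint ideal_pow (I : submodClosed R^o) (k : nat) : submodClosed R^o :=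
  if k is k'.+1 then smul I (ideal_pow I k') else smulmod predT R^o.

Fact ideal_add_prop (I J : submodClosed R^o) :
  submod_prop [set c : R^o | exists u v, [/\ u \in I, v \in J & c = u + v]].
Proof.
split=> [|a _ _ [u [v [uI vJ ->]]] [u' [v' [u'I v'J ->]]]].
  by exists 0, 0; split; rewrite ?rpred0 ?addr0.
exists (a *: u + u'), (a *: v + v').
by split; rewrite ?rpredD ?rpredZ // scalerDr addrACA.
Qed.
Definition ideal_add I J : submodClosed R^o := mksubmod (ideal_add_prop I J).

Fact annihilator_prop V : submod_prop [set c : R^o | forall v : V, c *: v = 0].
Proof.
split=> [v|a c d /= hc hd v]; first exact: scale0r.
by rewrite scalerDl -scalerA hc hd scaler0 addr0.
Qed.
Definition annihilator V : submodClosed R^o := mksubmod (@annihilator_prop V).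

Fact hom_prop U V : submod_prop [set f : U -> V | linear f].
Proof.
split=> [a u v|a f g /= hf hg b u v]; first by rewrite /= scaler0 addr0.
by rewrite !fctE hf hg !scalerDr !scalerA mulrC addrACA.
Qed.
Definition hom U V : lmodType R := submod (mksubmod (@hom_prop U V)).

Fact precomp_fun_linear U V (d : {linear U -> V}) X :
  linear (fun f : V -> X => f \o d : U -> X).
Proof. by []. Qed.
Fact precomp_hom U V (d : {linear U -> V}) X (f : V -> X) :
  f \in mksubmod (@hom_prop V X) ->
  mklinear (@precomp_fun_linear U V d X) f \in mksubmod (@hom_prop U X).
Proof. by move=> /mksubmodP hf; apply/mksubmodP => a u v /=; rewrite linearP hf. Qed.
Definition precomp U V (d : {linear U -> V}) X : {linear hom V X -> hom U X} :=
  submod_map (@precomp_hom U V d X).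

Lemma precompE U V (d : {linear U -> V}) X (f : hom V X) u :
  val (precomp d X f) u = val f (d u).
Proof. by []. Qed.

Lemma hom_linear U V (f : hom U V) : linear (val f).
Proof. by have /mksubmodP := valP f. Qed.

Lemma hom0 U V (f : hom U V) : val f 0 = 0.
Proof. exact: (linear0 (mklinear (hom_linear f))). Qed.

End LinearMaps.

Section Complexes.
Variable R : comNzRingType.

Record cochain_complex := CochainComplex {
  cobj :> nat -> lmodType R;
  cdiff : forall n, {linear cobj n -> cobj n.+1};
  cdiffK : forall n x, cdiff n.+1 (cdiff n x) = 0 }.

Definition cochain_map (C D : cochain_complex) (f : forall n, {linear C n -> D n}) :=
  forall n x, f n.+1 (cdiff C n x) = cdiff D n (f n x).

Definition cobound_set (C : cochain_complex) n : set (C n) :=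
  match n with
  | 0 => [set x | x = 0]
  | m.+1 => [set x | exists y, cdiff C m y = x]
  end.

Fact cobound_prop (C : cochain_complex) n :
  submod_prop [set z : submod (ker (cdiff C n)) | cobound_set (val z)].
Proof.
case: n => [|n]; split=> //=.
- by move=> a u v -> ->; rewrite scaler0 addr0.
- by exists 0; rewrite linear0.
- by move=> a u v [x hx] [y hy]; exists (a *: x + y); rewrite linearP hx hy.
Qed.
Definition cobound (C : cochain_complex) n := mksubmod (@cobound_prop C n).

Definition cohomology (C : cochain_complex) n : lmodType R :=
  quomod (cobound C n).

Section CohomologyMap.
Variables (C D : cochain_complex) (f : forall n, {linear C n -> D n}).
Hypothesis fP : cochain_map f.

Fact cocycle_map_subproof n u :
  u \in ker (cdiff C n) -> f n u \in ker (cdiff D n).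
Proof.
move=> /mksubmodP du; apply/mksubmodP; rewrite /mkset in du *.
by rewrite -fP du linear0.
Qed.
Definition cocycle_map n := submod_map (@cocycle_map_subproof n).

Fact cobound_map_subproof n z :
  z \in cobound C n -> cocycle_map n z \in cobound D n.
Proof.
move=> /mksubmodP hz; apply/mksubmodP => /=.
case: n z hz => [|n] z /=; first by move=> ->; rewrite linear0.
by case=> y <-; exists (f n y); rewrite fP.
Qed.
Definition cohomology_map n : {linear cohomology C n -> cohomology D n} :=
  quomod_map (@cobound_map_subproof n).
End CohomologyMap.
End Complexes.

Section Ext.
Variable R : comNzRingType.
Implicit Types N X : lmodType R.

(* The free module on the underlying set of N. *)
Definition free N : lmodType R := {freeg N / R}.

Fact fglift_linear N X (g : N -> X) : linear (fglift g : free N -> X).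
Proof.
pose G : {additive free N -> X} := HB.pack (fglift g : free N -> X)
  (GRing.isZmodMorphism.Build (free N) X (fglift g) (lift_is_additive g)).
move=> a u v; rewrite -[fglift g]/(G : _ -> _) raddfD; congr (_ + _).
transitivity (\sum_(x <- dom u) (a * coeff x u) *: g x).
  by rewrite [LHS]raddf_sum; apply: eq_bigr => x _; rewrite /= liftU.
rewrite -[u in RHS]freeg_sumE [in RHS]raddf_sum scaler_sumr.
by apply: eq_bigr => x _; rewrite /= liftU scalerA.
Qed.
Definition free_lift N X (g : N -> X) : {linear free N -> X} :=
  mklinear (fglift_linear g).

Lemma free_liftE N X (g : N -> X) v : free_lift g << v >> = g v.
Proof. by rewrite [LHS]liftU scale1r. Qed.

Lemma free_ext N X (g h : {linear free N -> X}) :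
  (forall v, g << v >> = h << v >>) -> g =1 h.
Proof.
move=> gh u; rewrite -[u]freeg_sumE !raddf_sum; apply: eq_bigr => x _.
have -> : << coeff x u *g x >> = coeff x u *: << x >> :> free N.
  by apply/eqP/freeg_eqP => y; rewrite coeffZ !coeffU mul1r.
by rewrite [LHS](linearZ_LR g) [RHS](linearZ_LR h) gh.
Qed.

Definition aug N : {linear free N -> N} := free_lift id.
Definition free_map N N' (f : N -> N') : {linear free N -> free N'} :=
  free_lift (fun v => << f v >>).

(* The functorial free resolution
   ... -> free (syz N 2) -> free (syz N 1) -> free N -> N -> 0
   where syz N n.+1 is the kernel of the canonical map free (syz N n) -> syz N n;
   [res_exact] is its exactness.  Ext is computed from it, and being functorial
   it makes Ext a functor of its first argument without choosing chain maps. *)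
Fixpoint syz N n : lmodType R :=
  if n is m.+1 then submod (ker (aug (syz N m))) else N.
Definition res N n : lmodType R := free (syz N n).

Fact submod_val_linear N (K : submodClosed N) : linear (val : submod K -> N).
Proof. by []. Qed.
Definition res_diff N n : {linear res N n.+1 -> res N n} :=
  mklinear (submod_val_linear (K := ker (aug (syz N n)))) \o aug (syz N n.+1).

Lemma res_exact N n y :
  aug (syz N n) y = 0 <-> exists x, res_diff N n x = y.
Proof.
split=> [y0|[x <-]]; last first.
  by have /mksubmodP := valP (aug (syz N n.+1) x : submod (ker (aug (syz N n)))).
have yK : y \in ker (aug (syz N n)) by apply/mksubmodP.
exists << (exist _ y yK : syz N n.+1) >>.
exact: (congr1 val (free_liftE (@id (syz N n.+1)) _)).
Qed.

Fact aug_free_map N N' (f : {linear N -> N'}) u :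
  aug N' (free_map f u) = f (aug N u).
Proof.
apply: (@free_ext _ _ (aug N' \o free_map f) (f \o aug N)) => v.
rewrite -[LHS]/(aug N' (free_map f << v >>)) -[RHS]/(f (aug N << v >>)).
by rewrite [free_map f _]free_liftE [aug N _]free_liftE [LHS]free_liftE.
Qed.

Fact syz_map_subproof N N' (f : {linear N -> N'}) u :
  u \in ker (aug N) -> free_map f u \in ker (aug N').
Proof.
move=> /mksubmodP hu; apply/mksubmodP; rewrite /mkset in hu *.
by rewrite aug_free_map hu linear0.
Qed.
Fixpoint syz_map N N' (f : {linear N -> N'}) n : {linear syz N n -> syz N' n} :=
  match n with
  | 0 => f
  | m.+1 => submod_map (@syz_map_subproof _ _ (syz_map f m))
  end.
Definition res_map N N' (f : {linear N -> N'}) n : {linear res N n -> res N' n} :=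
  free_map (syz_map f n).

Fact res_map_diff N N' (f : {linear N -> N'}) n u :
  res_diff N' n (res_map f n.+1 u) = res_map f n (res_diff N n u).
Proof. exact: (congr1 val (aug_free_map (syz_map f n.+1) u)). Qed.

Fact ext_complexK N X n (g : hom (res N n) X) :
  precomp (res_diff N n.+1) X (precomp (res_diff N n) X g) = 0.
Proof.
apply: val_inj; apply/funext => u; rewrite !precompE.
have du : aug (syz N n.+1) (res_diff N n.+1 u) = 0 by apply/res_exact; exists u.
have -> : res_diff N n (res_diff N n.+1 u) = 0 by exact: (congr1 val du).
exact: hom0.
Qed.
Definition ext_complex N X : cochain_complex R :=
  CochainComplex (@ext_complexK N X).

Definition Ext n N X : lmodType R := cohomology (ext_complex N X) n.

Fact Ext_map_subproof N N' (f : {linear N -> N'}) X :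
  @cochain_map R (ext_complex N' X) (ext_complex N X)
    (fun n => precomp (res_map f n) X).
Proof.
move=> n g; apply: val_inj; apply/funext => u.
by rewrite !precompE res_map_diff.
Qed.
Definition Ext_map n N N' (f : {linear N -> N'}) X : {linear Ext n N' X -> Ext n N X} :=
  cohomology_map (@Ext_map_subproof N N' f X) n.

End Ext.

Section DirectLimit.
Variables (R : comNzRingType) (E : nat -> lmodType R).

Definition dprod : Type := forall k, E k.
HB.instance Definition _ := Choice.copy dprod (forall k, E k).

Definition dprod_add (e e' : dprod) : dprod := fun k => e k + e' k.
Definition dprod_opp (e : dprod) : dprod := fun k => - e k.
Definition dprod_scale (a : R) (e : dprod) : dprod := fun k => a *: e k.
Fact dprod_addA : associative dprod_add.
Proof. by move=> e f g; apply: functional_extensionality_dep => k; apply: addrA. Qed.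
Fact dprod_addC : commutative dprod_add.
Proof. by move=> e f; apply: functional_extensionality_dep => k; apply: addrC. Qed.
Fact dprod_add0 : left_id ((fun k => 0) : dprod) dprod_add.
Proof. by move=> e; apply: functional_extensionality_dep => k; apply: add0r. Qed.
Fact dprod_addN : left_inverse ((fun k => 0) : dprod) dprod_opp dprod_add.
Proof. by move=> e; apply: functional_extensionality_dep => k; apply: addNr. Qed.
HB.instance Definition _ := GRing.isZmodule.Build dprod
  dprod_addA dprod_addC dprod_add0 dprod_addN.

Fact dprod_scaleA a b e : dprod_scale a (dprod_scale b e) = dprod_scale (a * b) e.
Proof. by apply: functional_extensionality_dep => k; apply: scalerA. Qed.
Fact dprod_scale1 e : dprod_scale 1 e = e.
Proof. by apply: functional_extensionality_dep => k; apply: scale1r. Qed.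
Fact dprod_scaleDr a (e f : dprod) :
  dprod_scale a (e + f) = dprod_scale a e + dprod_scale a f.
Proof. by apply: functional_extensionality_dep => k; apply: scalerDr. Qed.
Fact dprod_scaleDl (e : dprod) a b :
  dprod_scale (a + b) e = dprod_scale a e + dprod_scale b e.
Proof. by apply: functional_extensionality_dep => k; apply: scalerDl. Qed.
HB.instance Definition _ := GRing.Zmodule_isLmodule.Build R dprod
  dprod_scaleA dprod_scale1 dprod_scaleDr dprod_scaleDl.

Fact dsum_prop :
  submod_prop [set e : dprod | exists n, forall k, (n <= k)%N -> e k = 0].
Proof.
split=> [|a e f [n en] [m fm]]; first by exists 0%N.
exists (maxn n m) => k; rewrite geq_max => /andP[nk mk].
by rewrite -[LHS]/(a *: e k + f k) en // fm // scaler0 addr0.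
Qed.
Definition dsum : submodClosed dprod := mksubmod dsum_prop.

(* The direct limit of E 0 -> E 1 -> ... is the direct sum of the E k modulo
   the submodule generated by the elements e - phi k e, for e in E k; this
   submodule is the image of (e_k)_k |-> (e_k - phi (k-1) e_(k-1))_k. *)
Variable phi : forall k, {linear E k -> E k.+1}.

Definition dlim_rel_fun (e : dprod) : dprod := fun k =>
  match k with
  | 0 => e 0%N
  | m.+1 => e m.+1 - phi m (e m)
  end.
Fact dlim_rel_linear : linear dlim_rel_fun.
Proof.
move=> a e f; apply: functional_extensionality_dep => -[|k] //.
rewrite -[LHS]/(a *: e k.+1 + f k.+1 - phi k (a *: e k + f k)).
rewrite -[RHS]/(a *: (e k.+1 - phi k (e k)) + (f k.+1 - phi k (f k))).
by rewrite linearP scalerBr opprD addrACA.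
Qed.
Fact dlim_rel_dsum e : e \in dsum -> mklinear dlim_rel_linear e \in dsum.
Proof.
move=> /mksubmodP[n en]; apply/mksubmodP; exists n.+1 => -[|k] // nk.
have [ek ekS] : e k = 0 /\ e k.+1 = 0 by split; apply: en; rewrite // ltnW.
by rewrite -[LHS]/(e k.+1 - phi k (e k)) ek ekS linear0 subr0.
Qed.
Definition dlim : lmodType R := quomod (im (submod_map dlim_rel_dsum)).

End DirectLimit.

Section LocalCohomology.
Variable R : comNzRingType.
Implicit Types (a : submodClosed R^o) (M X : lmodType R).

Definition pow_quo a M k : lmodType R := quomod (smulmod (ideal_pow a k) M).

Fact ideal_powS a k c : c \in ideal_pow a k.+1 -> c \in ideal_pow a k.
Proof.
move=> /mksubmodP[s sP ->]; rewrite big_seq; apply: rpred_sum => p ps.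
by have [d [v [_ vk ->]]] := sP p ps; rewrite !rpredZ.
Qed.

Fact pow_quo_subproof a M k v :
  v \in smulmod (ideal_pow a k.+1) M ->
  (idfun : {linear M -> M}) v \in smulmod (ideal_pow a k) M.
Proof.
move=> /mksubmodP[s sP ->]; apply/mksubmodP; exists s => // p ps.
have [c [w [cI wM ->]]] := sP p ps.
by exists c, w; split; rewrite // ideal_powS.
Qed.
Definition pow_quo_map a M k : {linear pow_quo a M k.+1 -> pow_quo a M k} :=
  quomod_map (@pow_quo_subproof a M k).

Definition gen_local_cohomology a i M X : lmodType R :=
  dlim (fun k => Ext_map i (pow_quo_map a M k) X).
End LocalCohomology.

Section Koszul.
Variables (R : comNzRingType) (r : nat) (x : r.-tuple R) (X : lmodType R).

(* Hom(K_n(x), X), where K_n(x) has the basis e_S, S ranging over the n-element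
   subsets of 'I_r, and e_{j_0 < ... < j_(n-1)} is mapped to the alternating sum
   of the (-1)^p x_(j_p) e_{S \ j_p}; such a homomorphism is a family of elements
   of X indexed by the subsets of 'I_r that vanishes off the n-element ones. *)
Local Notation koszul_cochain := {ffun {set 'I_r} -> X}.

Fact koszul_prop (n : nat) :
  submod_prop [set f : koszul_cochain |
    forall S : {set 'I_r}, #|S| != n -> f S = 0].
Proof.
split=> [S _|a f g hf hg S Sn]; first by rewrite ffunE.
by rewrite !ffunE hf // hg // scaler0 addr0.
Qed.

Definition koszul_coef (S : {set 'I_r}) (j : 'I_r) : R :=
  (-1) ^+ #|[set k in S | (k < j)%N]| * tnth x j.

Definition koszul_diff_fun (f : koszul_cochain) : koszul_cochain :=
  [ffun S : {set 'I_r} => \sum_(j in S) koszul_coef S j *: f (S :\ j)].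
Fact koszul_diff_linear : linear koszul_diff_fun.
Proof.
move=> a f g; apply/ffunP => S; rewrite !ffunE scaler_sumr -big_split /=.
apply: eq_bigr => j _; rewrite !ffunE scalerDr !scalerA.
by rewrite [a * _]mulrC.
Qed.
Fact koszul_diff_subproof n f :
  f \in mksubmod (koszul_prop n) ->
  mklinear koszul_diff_linear f \in mksubmod (koszul_prop n.+1).
Proof.
move=> /mksubmodP hf; apply/mksubmodP => S Sn; rewrite ffunE big1 // => j jS.
by rewrite hf ?scaler0 // -eqSS -add1n -[1%N]/(true : nat) -jS -cardsD1.
Qed.

Fact koszul_coef_swap (S : {set 'I_r}) (j k : 'I_r) : j \in S -> (j < k)%N ->
  koszul_coef S j * koszul_coef (S :\ j) k
    = - (koszul_coef S k * koszul_coef (S :\ k) j).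
Proof.
move=> jS jk; rewrite /koszul_coef.
have -> : [set l in S :\ k | (l < j)%N] = [set l in S | (l < j)%N].
  apply/setP => l; rewrite !inE; case: eqP => // ->.
  have /negbTE -> : ~~ (k < j)%N by rewrite -leqNgt ltnW.
  by rewrite !andbF.
have -> : #|[set l in S | (l < k)%N]| = #|[set l in S :\ j | (l < k)%N]|.+1.
  rewrite (cardsD1 j) inE jS jk add1n; congr (#|pred_of_set _|.+1).
  by apply/setP => l; rewrite !inE andbA.
by rewrite exprS mulN1r !mulNr opprK mulrACA [in RHS]mulrACA
   [(-1) ^+ _ * (-1) ^+ _]mulrC [tnth x j * _]mulrC.
Qed.

Fact koszul_diffK n (f : submod (mksubmod (koszul_prop n))) :
  submod_map (@koszul_diff_subproof n.+1) (submod_map (@koszul_diff_subproof n) f)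
    = 0.
Proof.
apply: val_inj; apply/ffunP => S /=; rewrite !ffunE.
pose F (p : 'I_r * 'I_r) :=
  (koszul_coef S p.1 * koszul_coef (S :\ p.1) p.2) *: val f (S :\ p.1 :\ p.2).
transitivity (\sum_(j in S) \sum_(k in S :\ j) F (j, k)).
  apply: eq_bigr => j jS; rewrite ffunE scaler_sumr.
  by apply: eq_bigr => k kS; rewrite scalerA.
rewrite pair_big_dep (bigID (fun p : 'I_r * 'I_r => (p.1 < p.2)%N)) /=.
rewrite [X in _ + X](reindex_inj (can_inj (@swap_pairK _ _))) /=.
pose P (p : 'I_r * 'I_r) := [&& p.1 \in S, p.2 \in S & (p.1 < p.2)%N].
rewrite (eq_bigl P) => [|[j k]]; last first.
  rewrite /P !inE /= -andbA; congr (_ && _).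
  by case: ltnP; rewrite ?andbF // !andbT => /ltn_eqF/negbT; rewrite eq_sym => ->.
rewrite [X in _ + X](eq_bigl P) => [|[j k]]; last first.
  rewrite /P !inE /= -leqNgt leq_eqVlt -val_eqE /= -andbA andbCA.
  case: (k \in S); rewrite /= ?andbF // ?andbT; case: (j \in S); rewrite /= ?andbF //.
  by case: ltngtP.
rewrite -big_split big1 //= => -[j k] /and3P[/= jS kS jk].
rewrite /F /= koszul_coef_swap // finset.setDDl finset.setUC -finset.setDDl.
by rewrite -scalerDl addNr scale0r.
Qed.

Definition koszul_complex : cochain_complex R := CochainComplex koszul_diffK.

Definition koszul_cohomology n : lmodType R := cohomology koszul_complex n.
End Koszul.

Section Depth.
Variable R : comNzRingType.
Implicit Types (MM : lmodType R -> Prop) (b : submodClosed R^o) (X Y : lmodType R).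

Definition short_exact (X' X X'' : lmodType R) (f : {linear X' -> X}) (g : {linear X -> X''}) :=
  [/\ injective f, forall z, exists y, g y = z
    & forall y, g y = 0 <-> exists x, f x = y].

(* Invariance of the class under isomorphism follows from the second clause. *)
Definition serre MM : Prop :=
  (exists X, MM X) /\
  forall (X' X X'' : lmodType R) (f : {linear X' -> X}) (g : {linear X -> X''}),
    short_exact f g -> (MM X <-> MM X' /\ MM X'').

Definition torsion b Y : Prop :=
  forall y : Y, exists n, forall c, c \in ideal_pow b n -> c *: y = 0.

Definition melkersson b MM : Prop :=
  serre MM /\ forall Y, torsion b Y -> MM (submod (colon b Y)) -> MM Y.

Definition regular_seq MM X (ys : seq R) : Prop :=
  forall j, (j < size ys)%N ->
    MM (submod (colon (pred1 ys`_j)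
          (quomod (smulmod (lspan [set` (take j ys : seq R^o)]) X)))).

Definition max_regular_seq MM b X (ys : seq R) : Prop :=
  [/\ {subset ys <= b}, regular_seq MM X ys
    & forall y, y \in b -> ~ regular_seq MM X (rcons ys y)].

(* The common length of the maximal MM-regular sequences on X in b; the default
   value 0 is irrelevant when such a common length exists. *)
Definition depth_in MM b X : nat :=
  xget 0%N [set n | (exists2 ys, max_regular_seq MM b X ys & size ys = n) /\
                    forall ys, max_regular_seq MM b X ys -> size ys = n].

End Depth.

(* Infimum in nat extended by +oo, which is [None]. *)
Definition nat_inf (A : set nat) : option nat :=
  if `[< exists n, A n >] then
    Some (xget 0%N [set n | A n /\ forall m, A m -> (n <= m)%N])
  else None.

(* Main.v *)
Require Import Defs.
From mathcomp Require Import all_boot all_algebra.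
From mathcomp Require Import boolp classical_sets functions freeg.

Set Implicit Arguments.
Unset Strict Implicit.
Unset Printing Implicit Defensive.

Import GRing.Theory.
Local Open Scope classical_set_scope.
Local Open Scope ring_scope.

Local Notation hom := Defs.hom.
Local Notation free := Defs.free.

(** Put [b = a + Ann M]. Generalized local cohomology, [Ext i (M/aM) X] and Koszul
    cohomology are all cohomological functors [T] of [X] (they have long exact
    sequences, on which the ring acts through [X]) with three properties:
    - [T i X] is [b]-torsion;
    - [T i K] is in the class as soon as [K] is finitely generated, killed by a power
      of [b] and in the class;
    - if [X] contains an element whose annihilator is prime and contains [b], then
      some linear map [T 0 X -> X] is nonzero.

    For such a [T] the depth is the first degree in which [T i X] leaves the class.
    The point is that a [b]-torsion module lies in the class when the kernel on it of
    a single [y] in [b] does, by Melkersson's condition. This gives first that [T i K]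
    is in the class for every finitely generated [K] in the class ([T_MM]). Then, if
    [0 :_X y] is in the class, [T i X] is in the class for all [i <= n] if and only if
    [T i (X/yX)] is for all [i < n] ([T_below_step]): up to the class, [X -> yX] is an
    isomorphism, so that the long exact sequence of [yX -> X -> X/yX] controls the
    kernel of [y] on [T i X]. So the question is reduced to degree [0], where [T 0 X]
    can only be in the class if some [y] in [b] is regular up to the class
    ([regular_of_MM_T0]): otherwise, modulo its largest submodule in the class, [X]
    has an element as in the third property, hence a nonzero submodule in the class.
    Therefore the first degree where [T i X] is outside the class is the length of
    every maximal regular sequence ([T_regular_below], [T_max_regular]). Maximal
    regular sequences exist because the top Koszul cohomology maps onto [X/bX].

    It remains to verify the properties. Koszul cohomology is killed by [b] because
    multiplication by each [x_j] is homotopic to zero ([khomotopyE]). For Ext, [b]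
    kills [M/aM], the second property is dimension shifting ([Ext_MM]), and a nonzero
    map from [M/aM] to the submodule spanned by the given element exists because
    [Ann M] annihilates that element ([hom_to_prime]). The second property of local
    cohomology is the delicate one: for [K] killed by a power of [a], the map from
    the limit of the [Ext i (M/a^k M) K] to [Ext i M K] is injective
    ([Ext_pow_quo_vanish]), so that [Ext_MM] applies. This comes from the Artin-Rees
    lemma and dimension shifting in the first variable, along arbitrary finitely
    generated free covers; comparing these with the functorial resolution that
    defines Ext takes the section on Ext in its first variable. *)

(** * Linear maps and submodules *)

Arguments mksubmod : simpl never.
Arguments lspan : simpl never.
Arguments smul : simpl never.
Arguments smulmod : simpl never.
Arguments ideal_pow : simpl never.
Arguments ker : simpl never.
Arguments im : simpl never.
Arguments colon : simpl never.

Lemma choice_ex X Y (P : X -> Y -> Prop) :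
  (forall x, exists y, P x y) -> exists f : X -> Y, forall x, P x (f x).
Proof. by move/choice => [f fP]; exists f. Qed.

Section Basics.
Variable R : comNzRingType.
Implicit Types U V W : lmodType R.

(** Used for maps whose values are only defined through a choice, such as
    connecting homomorphisms and maps out of direct limits: it is enough that the
    graph be a submodule, total, and single-valued at [0]. *)
Lemma linear_of_graph U V (rho : U -> V -> Prop) :
    (forall a u v u' v', rho u v -> rho u' v' -> rho (a *: u + u') (a *: v + v')) ->
    (forall u, exists v, rho u v) ->
    (forall v, rho 0 v -> v = 0) ->
  exists h : {linear U -> V}, forall u v, rho u v <-> h u = v.
Proof.
move=> lin tot sv; have [h hP] := choice tot.
have uniq u v v' : rho u v -> rho u v' -> v = v'.
  move=> uv uv'; have := lin (-1) _ _ _ _ uv uv'.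
  rewrite !scaleN1r addNr => /sv /eqP.
  by rewrite addrC subr_eq0 => /eqP.
have hlin : linear h by move=> a u v; apply: uniq (hP _) _; apply: lin.
exists (mklinear hlin) => u v; split; first exact: uniq.
by move=> <-; exact: hP.
Qed.

Definition submod_incl V (N : submodClosed V) : {linear submod N -> V} :=
  mklinear (submod_val_linear (K := N)).

Lemma submod_inclP V (N : submodClosed V) (u : submod N) : submod_incl N u \in N.
Proof. exact: valP. Qed.

Lemma submod_incl_inj V (N : submodClosed V) : injective (submod_incl N).
Proof. exact: val_inj. Qed.

Lemma submod_incl_sur V (N : submodClosed V) v : v \in N -> exists u, submod_incl N u = v.
Proof. by move=> vN; exists (exist _ v vN). Qed.

Definition qproj V (N : submodClosed V) : {linear V -> quomod N} :=
  mklinear (@proj_linear R V N).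

Lemma qproj0 V (N : submodClosed V) v : qproj N v = 0 <-> v \in N.
Proof. by rewrite -[0](linear0 (qproj N)) -[v in v \in N]subr0; exact: proj_eq. Qed.

Lemma qproj_sur V (N : submodClosed V) x : exists v, qproj N v = x.
Proof. by exists (quolift x); exact: quoliftK. Qed.

Lemma linear_inj U V (f : {linear U -> V}) :
  (forall u, f u = 0 -> u = 0) -> injective f.
Proof.
move=> f0 u v /eqP; rewrite -subr_eq0 -linearB => /eqP/f0/eqP.
by rewrite subr_eq0 => /eqP.
Qed.

Lemma submod_rpredB V (N : submodClosed V) u v : u \in N -> v \in N -> u - v \in N.
Proof. by move=> uN vN; rewrite rpredD // -scaleN1r rpredZ. Qed.

Lemma mem_lin V (N : submodClosed V) a u v : u \in N -> v \in N -> a *: u + v \in N.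
Proof. by move=> uN vN; rewrite rpredD // rpredZ. Qed.

Lemma mem0 V (N : submodClosed V) : (0 : V) \in N.
Proof. exact: rpred0. Qed.

Lemma corestrict U V (f : {linear U -> V}) (N : submodClosed V) :
  (forall u, f u \in N) ->
  exists g : {linear U -> submod N}, forall u, submod_incl N (g u) = f u.
Proof.
move=> fN; have glin : linear (fun u => exist _ (f u) (fN u) : submod N).
  by move=> a u v; apply: val_inj; rewrite /= linearP.
by exists (mklinear glin).
Qed.

Lemma factor_sur U V W (p : {linear U -> V}) (f : {linear U -> W}) :
    (forall v, exists u, p u = v) -> (forall u, p u = 0 -> f u = 0) ->
  exists g : {linear V -> W}, forall u, g (p u) = f u.
Proof.
move=> psur pf.
have [| | |g gP] := @linear_of_graph V W (fun v w => exists2 u, p u = v & f u = w).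
- by move=> a _ _ _ _ [u <- <-] [u' <- <-]; exists (a *: u + u'); rewrite linearP.
- by move=> v; have [u pu] := psur v; exists (f u), u.
- by move=> _ [u /pf fu0 <-].
by exists g => u; apply/gP; exists u.
Qed.

Lemma factor_inj U V W (i : {linear V -> W}) (f : {linear U -> W}) :
    injective i -> (forall u, exists v, i v = f u) ->
  exists g : {linear U -> V}, forall u, i (g u) = f u.
Proof.
move=> iinj fi.
have [| | |g gP] := @linear_of_graph U V (fun u v => i v = f u).
- by move=> a u v u' v' iv iv'; rewrite !linearP iv iv'.
- by [].
- by move=> v; rewrite linear0 => i0; apply: iinj; rewrite i0 linear0.
by exists g => u; apply/gP.
Qed.

Fact scaling_linear (c : R) V : linear (fun v : V => c *: v).
Proof. by move=> a u v; rewrite scalerDr !scalerA mulrC. Qed.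
Definition scaling (c : R) V : {linear V -> V} := mklinear (@scaling_linear c V).

Lemma lspan_ind V (A : set V) (P : set V) :
  submod_prop P -> A `<=` P -> forall v, v \in lspan A -> P v.
Proof.
move=> [P0 PL] AP v /mksubmodP[s sA ->]; rewrite big_seq.
elim/big_ind: _ => //.
- by move=> u w Pu Pw; rewrite -[u]scale1r; apply: PL.
- by move=> p ps; rewrite -[_ *: _]addr0; apply: PL => //; apply/AP/sA.
Qed.

Lemma lspan_seq_ind V (s : seq V) (P : set V) : submod_prop P ->
  (forall v, v \in s -> P v) -> forall v, v \in lspan [set` s] -> P v.
Proof. by move=> Ps sP; apply: lspan_ind. Qed.

Lemma lspan_gen V (A : set V) v : A v -> v \in lspan A.
Proof.
move=> Av; apply/mksubmodP; exists [:: (1, v)] => [p|].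
  by rewrite inE => /eqP ->.
by rewrite big_seq1 scale1r.
Qed.

Lemma lspan_min V (A : set V) (N : submodClosed V) :
  (forall v, A v -> v \in N) -> forall v, v \in lspan A -> v \in N.
Proof.
move=> AN; apply: (@lspan_ind V A [set v | v \in N]) => //.
by split=> [|a u v /= uN vN]; rewrite /= ?rpred0 // rpredD // rpredZ.
Qed.

Lemma smulmod_gen V (I : {pred R^o}) c (v : V) : c \in I -> c *: v \in smulmod I V.
Proof. by move=> cI; apply: lspan_gen; exists c, v. Qed.

Lemma smulmod_ind V (I : {pred R^o}) (P : set V) : submod_prop P ->
  (forall c v, c \in I -> P (c *: v)) -> forall v, v \in smulmod I V -> P v.
Proof. by move=> Psub PI; apply: lspan_ind => // _ [c [v [cI _ ->]]]; apply: PI. Qed.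

Lemma submod_prop_preim U V (f : {linear U -> V}) (P : set V) :
  submod_prop P -> submod_prop [set u | P (f u)].
Proof.
move=> [P0 PL]; split=> [|a u v /= Pu Pv]; first by rewrite /= linear0.
by rewrite linearP; apply: PL.
Qed.

Lemma submod_prop_mem V (N : submodClosed V) : submod_prop [set v | v \in N].
Proof. by split=> [|a u u2 /= uN uN2]; rewrite /= ?rpred0 // rpredD // rpredZ. Qed.

Lemma submod_prop_ker U V (f : {linear U -> V}) : submod_prop [set u | f u = 0].
Proof. exact: ker_prop. Qed.

Lemma submod_prop_im U V (f : {linear U -> V}) (P : set U) :
  submod_prop P -> submod_prop [set v | exists2 u, P u & f u = v].
Proof.
move=> [P0 PL]; split=> [|a _ _ [u Pu <-] [v Pv <-]].
  by exists 0; rewrite ?linear0.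
by exists (a *: u + v); [exact: PL | rewrite linearP].
Qed.

Lemma smulmod_map_sur U V (f : {linear U -> V}) (I : {pred R^o}) :
  (forall v, exists u, f u = v) ->
  forall v, v \in smulmod I V -> exists2 u : U, u \in smulmod I U & f u = v.
Proof.
move=> fsur; apply: smulmod_ind => [|c v cI].
  exact: submod_prop_im (submod_prop_mem _).
by have [u <-] := fsur v; exists (c *: u); rewrite ?linearZ ?smulmod_gen.
Qed.

Lemma smulmodS V (I J : {pred R^o}) :
  {subset I <= J} -> {subset smulmod I V <= smulmod J V}.
Proof.
move=> IJ; apply: smulmod_ind => [|c v cI]; first exact: submod_prop_mem.
by apply: smulmod_gen; apply: IJ.
Qed.

Lemma ideal_powE (I : submodClosed R^o) k c d :
  c \in I -> d \in ideal_pow I k -> c * d \in ideal_pow I k.+1.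
Proof. by move=> cI dk; apply: lspan_gen; exists c, d. Qed.

Lemma ideal_powS_ind (I : submodClosed R^o) k (P : set R^o) : submod_prop P ->
  (forall c d, c \in I -> d \in ideal_pow I k -> P (c * d)) ->
  forall c, c \in ideal_pow I k.+1 -> P c.
Proof. by move=> Ps PI; apply: lspan_ind => // _ [c [d [cI dk ->]]]; apply: PI. Qed.

Lemma ideal_pow0 (I : submodClosed R^o) c : c \in ideal_pow I 0.
Proof.
by rewrite -[c : R^o]mulr1; exact: (@smulmod_gen R^o predT c 1).
Qed.

Lemma ideal_mull (I : submodClosed R^o) (c d : R) : d \in I -> c * d \in I.
Proof. by move=> dI; exact: (rpredZ c dI). Qed.

Lemma ideal_lin (I : submodClosed R^o) (c d e : R) : d \in I -> e \in I -> c * d + e \in I.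
Proof. exact: (@mem_lin R^o I c d e). Qed.

Lemma ideal0 (I : submodClosed R^o) : (0 : R) \in I.
Proof. exact: (mem0 I). Qed.

Lemma ideal_pow1 (I : submodClosed R^o) c : c \in ideal_pow I 1 <-> c \in I.
Proof.
split=> [|cI]; last by rewrite -[c]mulr1 ideal_powE // ideal_pow0.
move: c; apply: ideal_powS_ind => [|c d cI _]; first exact: submod_prop_mem.
by rewrite /= mulrC ideal_mull.
Qed.

Lemma ideal_powW (I : submodClosed R^o) k l c :
  (k <= l)%N -> c \in ideal_pow I l -> c \in ideal_pow I k.
Proof.
by move=> /subnK <-; elim: (l - k)%N => // n IH /ideal_powS; apply: IH.
Qed.

Lemma ideal_powX (I : submodClosed R^o) c k : c \in I -> c ^+ k \in ideal_pow I k.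
Proof.
move=> cI; elim: k => [|k IH]; first exact: ideal_pow0.
by rewrite exprS ideal_powE.
Qed.

Lemma ideal_pow_subset (I J : submodClosed R^o) k :
  {subset I <= J} -> {subset ideal_pow I k <= ideal_pow J k}.
Proof.
move=> IJ; elim: k => [|k IH] c; first by rewrite !ideal_pow0.
move: c; apply: ideal_powS_ind => [|c d cI dk]; first exact: submod_prop_mem.
by apply: ideal_powE; [exact: IJ | exact: IH].
Qed.

Lemma smulmod_pow_add V (I : submodClosed R^o) k l (v : V) :
  v \in smulmod (ideal_pow I (k + l)) V ->
  exists2 u, u \in smulmod (ideal_pow I l) (submod (smulmod (ideal_pow I k) V))
           & submod_incl _ u = v.
Proof.
set N := smulmod (ideal_pow I k) V.
suff H (w : V) (c : R) : c \in ideal_pow I (k + l) ->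
    exists2 u, u \in smulmod (ideal_pow I l) (submod N) & submod_incl N u = c *: w.
  move: v; apply: smulmod_ind => [|c w]; last exact: H.
  exact: submod_prop_im (submod_prop_mem _).
move: c; elim: l => [|l IH].
  rewrite addn0 => c ck; have [u cu] := submod_incl_sur (smulmod_gen w ck).
  exists u => //; rewrite -[u]scale1r; apply: smulmod_gen; exact: ideal_pow0.
rewrite addnS; apply: ideal_powS_ind => [|c d cI /IH[u ul uE]].
  split=> [|a c d [u uN uE] [u2 uN2 uE2]]; first by exists 0; rewrite ?rpred0 ?linear0 ?scale0r.
  exists (a *: u + u2); first by rewrite rpredD // rpredZ.
  by rewrite linearP uE uE2 scalerDl scalerA.
exists (c *: u); last by rewrite linearZ_LR uE scalerA.
move: u ul {uE}; apply: smulmod_ind => [|e u eI].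
  exact: (submod_prop_preim (scaling c _) (submod_prop_mem _)).
by rewrite scalerA; apply: smulmod_gen; apply: ideal_powE.
Qed.

End Basics.
Arguments submod_incl : simpl never.
Arguments qproj : simpl never.

(** * Noetherian modules *)

Section Noetherian.
Variable R : comNzRingType.
Implicit Types U V W : lmodType R.

Definition noeth V : Prop := forall P : set V, submod_prop P ->
  exists2 s : seq V, (forall v, v \in s -> P v) &
                     (forall v, P v -> v \in lspan [set` s]).

Lemma lspan_cons V (v : V) s w : w \in lspan [set` v :: s] ->
  exists (c : R) (u : V), u \in lspan [set` s] /\ w = c *: v + u.
Proof.
move: w; apply: lspan_seq_ind => [|w].
  split=> [|a _ _ [c [u [us ->]]] [d [w [ws ->]]]].
    by exists 0, (0 : V); split; [exact: mem0 | rewrite scale0r addr0].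
  exists (a * c + d), (a *: u + w); split; first exact: mem_lin.
  by rewrite scalerDr scalerDl !scalerA addrACA.
rewrite inE => /orP[/eqP->|ws].
  by exists 1, (0 : V); split; [exact: mem0 | rewrite scale1r addr0].
by exists 0, w; split; [exact: lspan_gen | rewrite scale0r add0r].
Qed.

Lemma lspan_sub V (A B : set V) : A `<=` B -> {subset lspan A <= lspan B}.
Proof. by move=> AB; apply: lspan_min => v /AB; apply: lspan_gen. Qed.

(** Induction on the number of generators: a submodule [P] of [Rv + W] is generated by
    its intersection with [W] and by lifts of generators of the ideal of the
    coefficients of [v] in elements of [P]. *)
Lemma fg_noeth (hR : noetherian R) V : finitely_generated V -> noeth V.
Proof.
case=> s sV; suff H (P : set V) : submod_prop P ->
    (forall v, P v -> v \in lspan [set` s]) -> exists2 s' : seq V,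
      (forall v, v \in s' -> P v) & (forall v, P v -> v \in lspan [set` s']).
  by move=> P Psub; apply: H.
elim: s P {sV} => [|v s IH] P Psub Ps; first by exists [::].
have [P0 PL] := Psub.
pose I : set R^o := [set c | exists2 u : V, u \in lspan [set` s] & P (c *: v + u)].
have Isub : submod_prop I.
  split=> [|a c d [u us Pu] [w ws Pw]].
    by exists (0 : V); [exact: mem0 | rewrite scale0r addr0].
  exists (a *: u + w); first exact: mem_lin.
  by rewrite scalerDl -scalerA addrACA -scalerDr; apply: PL.
have [t tI] := hR (mksubmod Isub).
have [f fP] : exists f : R -> V, forall c : R, c \in t ->
    f c \in lspan [set` s] /\ P (c *: v + f c).
  apply: (@choice_ex R V
    (fun c u => c \in t -> u \in lspan [set` s] /\ P (c *: v + u))) => c.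
  case: (boolP (c \in t)) => ct; last by exists 0.
  have : (c : R^o) \in mksubmod Isub by rewrite tI lspan_gen.
  by case/mksubmodP => u us Pu; exists u.
have [||t' t'P t'S] := IH (fun w => P w /\ w \in lspan [set` s]).
- split; first by split=> //; exact: mem0.
  by move=> a u w [Pu us] [Pw ws]; split; [exact: PL | exact: mem_lin].
- by move=> w [].
pose g c := c *: v + f c.
exists (map g t ++ t') => [w|w Pw].
  by rewrite mem_cat => /orP[/mapP[c /fP[_ Pc] ->]|/t'P[]].
have [c [u [us wE]]] := lspan_cons (Ps w Pw).
have cI : (c : R^o) \in lspan [set` (t : seq R^o)].
  by rewrite -tI; apply/mksubmodP; exists u; rewrite // -wE.
have H (d : R^o) : d \in lspan [set` (t : seq R^o)] -> exists z : V,
    [/\ z \in lspan [set` map g t], P z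
      & exists2 u : V, u \in lspan [set` s] & z = (d : R) *: v + u].
  move: d; apply: lspan_seq_ind => [|d dt].
    split=> [|a d e [z [zt Pz [z' z's zE]]] [y [yt Py [y' y's yE]]]].
      exists (0 : V); split=> //; first exact: mem0.
      by exists (0 : V); [exact: mem0 | rewrite scale0r addr0].
    exists (a *: z + y); split; [exact: mem_lin|exact: PL|].
    exists (a *: z' + y'); first exact: mem_lin.
    by rewrite zE yE scalerDl -scalerA addrACA -scalerDr.
  have [fs Pf] := fP d dt; exists (g d); split=> //; last by exists (f d).
  by apply: lspan_gen; exact: map_f.
have [z [zt Pz [u' u's zE]]] := H c cI.
rewrite -(subrK z w) rpredD //.
  apply: (@lspan_sub _ [set` t']) => [y /= yt'|]; first by rewrite mem_cat yt' orbT.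
  apply: t'S; split.
    by rewrite addrC -scaleN1r; apply: PL.
  by rewrite wE zE opprD addrACA subrr add0r submod_rpredB.
by apply: lspan_sub zt => y /= yt; rewrite mem_cat yt.
Qed.

Lemma fg_sur U V (f : {linear U -> V}) :
  (forall v, exists u, f u = v) -> finitely_generated U -> finitely_generated V.
Proof.
move=> fsur [s sU]; exists (map f s) => v; have [u <-] := fsur v.
move: u (sU u); apply: lspan_seq_ind.
  exact: (submod_prop_preim f (submod_prop_mem _)).
by move=> u us; apply: lspan_gen; exact: map_f.
Qed.

Lemma lspan_lift V (N : submodClosed V) (s : seq V) :
    (forall v, v \in s -> v \in N) -> (forall v, v \in N -> v \in lspan [set` s]) ->
  exists2 t : seq (submod N), map (submod_incl N) t = s & forall u, u \in lspan [set` t].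
Proof.
move=> sN sS.
have [t ts] : exists t : seq (submod N), map (submod_incl N) t = s.
  elim: s sN {sS} => [|v s IH] sN; first by exists [::].
  have [|t tE] := IH; first by move=> u us; apply: sN; rewrite inE us orbT.
  have [u uE] := submod_incl_sur (sN v (mem_head v s)).
  by exists (u :: t); rewrite map_cons uE tE.
exists t => // u; have : submod_incl N u \in lspan [set` s] by exact/sS/submod_inclP.
rewrite -ts; suff H v : v \in lspan [set` map (submod_incl N) t] ->
    exists2 u, u \in lspan [set` t] & submod_incl N u = v.
  by case/H => u' u't /submod_incl_inj <-.
move: v; apply: lspan_seq_ind => [|v /mapP[w wt ->]].
  exact: submod_prop_im (submod_prop_mem _).
by exists w => //; apply: lspan_gen.
Qed.

Lemma noeth_sub V (N : submodClosed V) : noeth V -> finitely_generated (submod N).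
Proof.
move=> nV; have [s sN sS] := nV _ (submod_prop_mem N).
by have [t _ tN] := lspan_lift sN sS; exists t.
Qed.

Lemma fg_quo V (N : submodClosed V) : finitely_generated V -> finitely_generated (quomod N).
Proof. exact/fg_sur/qproj_sur. Qed.

(** Otherwise there is a strictly increasing sequence of members of the family; its
    union is finitely generated, hence equal to one of its terms. *)
Lemma noeth_maximal V (F : set V -> Prop) : noeth V ->
    (exists2 P, submod_prop P & F P) ->
  exists P, [/\ submod_prop P, F P &
                forall Q, submod_prop Q -> F Q -> P `<=` Q -> Q `<=` P].
Proof.
move=> nV [P0 P0s FP0]; apply: contrapT => nmax.
pose good := {P : set V | submod_prop P /\ F P}.
have [next nextP] : exists next : good -> good, forall P,
    sval P `<=` sval (next P) /\ ~ (sval (next P) `<=` sval P).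
  apply: (@choice_ex _ _ (fun P Q : good => sval P `<=` sval Q /\ ~ (sval Q `<=` sval P))).
  move=> [P [Ps FP]]; apply: contrapT => nQ; apply: nmax; exists P; split=> //.
  move=> Q Qs FQ PQ; apply: contrapT => nQP; apply: nQ.
  by exists (exist _ Q (conj Qs FQ)).
pose N k : set V := sval (iter k next (exist _ P0 (conj P0s FP0))).
have Ns k : submod_prop (N k) by case: (svalP (iter k next (exist _ P0 (conj P0s FP0)))).
have NS k : N k `<=` N k.+1 by have [] := nextP (iter k next (exist _ P0 (conj P0s FP0))).
have Nle k l : (k <= l)%N -> N k `<=` N l.
  by move=> /subnK <-; elim: (l - k)%N => // n IH v /IH /NS.
have [|s sN sS] := nV [set v | exists k, N k v].
  split; first by exists 0%N; case: (Ns 0%N).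
  move=> a u v [k ku] [l lv]; exists (maxn k l); have [_ L] := Ns (maxn k l).
  by apply: L; [exact: Nle (leq_maxl _ _) _ ku | exact: Nle (leq_maxr _ _) _ lv].
have [k kP] : exists k, forall v, v \in s -> N k v.
  elim: s sN {sS} => [|v s IH] sN; first by exists 0%N.
  have [|k kP] := IH; first by move=> u us; apply: sN; rewrite inE us orbT.
  have [l lv] := sN v (mem_head v s); exists (maxn k l) => u.
  rewrite inE => /orP[/eqP->|/kP]; first exact: Nle (leq_maxr _ _) _ lv.
  exact: Nle (leq_maxl _ _) _.
have [_] := nextP (iter k next (exist _ P0 (conj P0s FP0))); apply=> v vk.
have := sS v (ex_intro _ k.+1 vk).
by move: v {vk}; apply: lspan_seq_ind (Ns k) _ => v /kP.
Qed.

Lemma noeth_ring (hR : noetherian R) : noeth R^o.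
Proof.
apply: fg_noeth => //; exists [:: (1 : R^o)] => c.
by rewrite -[c]mulr1; apply: (rpredZ c); apply: lspan_gen; rewrite /= mem_head.
Qed.

Lemma ideal_pow_add_ind (I : submodClosed R^o) k l (P : set R^o) : submod_prop P ->
    (forall c d, c \in ideal_pow I k -> d \in ideal_pow I l -> P (c * d)) ->
  forall c, c \in ideal_pow I (k + l) -> P c.
Proof.
elim: k P => [|k IH] P Ps Pkl.
  by move=> c cl; rewrite -[c]mul1r; apply: Pkl => //; exact: ideal_pow0.
rewrite addSn; apply: ideal_powS_ind => // c d cI; move: d; apply: IH => [|d e dk el].
  exact: (submod_prop_preim (scaling c _) Ps).
by rewrite mulrA; apply: Pkl => //; apply: ideal_powE.
Qed.

(** If every element of the ideal [I] is nilpotent modulo [J] then so is [I]: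
    an ideal [P] maximal among those for which this fails does not contain some
    [c \in I], and both [P : c] and [P + (c)] are bigger than [P]. *)
Lemma nil_ideal_pow (hR : noetherian R) (I J : submodClosed R^o) :
    (forall c, c \in I -> exists n, c ^+ n \in J) ->
  exists l, {subset ideal_pow I l <= J}.
Proof.
move=> nilI; apply: contrapT => nl.
pose F (P : set R^o) := (forall c, c \in J -> P c) /\
                        ~ exists l, forall c, c \in ideal_pow I l -> P c.
have [|P [Ps [JP nP] Pmax]] := @noeth_maximal _ F (noeth_ring hR).
  by exists [set c | c \in J]; [exact: submod_prop_mem|split].
have [P0 PL] := Ps.
have PM (c d : R) : P d -> P (c * d).
  by move=> Pd; rewrite -[c * d]addr0; exact: PL.
have [c cI Pc] : exists2 c, c \in I & ~ P c.
  apply: contrapT => h; apply: nP; exists 1%N => c /ideal_pow1 cI.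
  by apply: contrapT => Pc; apply: h; exists c.
have big Q : submod_prop Q -> P `<=` Q -> ~ (Q `<=` P) ->
    exists l, forall c, c \in ideal_pow I l -> Q c.
  move=> Qs PQ QP; apply: contrapT => nQ; apply: QP; apply: Pmax => //.
  by split=> // d /JP /PQ.
have [||| l lP] := big [set d : R^o | P (c * d)].
- exact: (submod_prop_preim (scaling c _) Ps).
- by move=> d /= Pd; apply: PM.
- move=> sub; have [n nJ] := nilI c cI; apply: Pc; rewrite -[c]expr1.
  have : P (c ^+ n) by exact: JP.
  case: n {nJ} => [|n]; first by move=> P1; rewrite -[c ^+ 1]mulr1; apply: PM.
  elim: n => // n IH; rewrite exprS => cP; apply: IH; exact: sub.
have [||| m mP] := big [set d : R^o | forall e, e \in ideal_pow I l -> P (d * e)].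
- split=> [e _|a d e dP eP f fl]; first by rewrite mul0r.
  by rewrite mulrDl -mulrA; apply: PL; [exact: dP|exact: eP].
- by move=> d Pd e _; rewrite mulrC; apply: PM.
- by move=> /(_ c) h; apply: Pc; apply: h => e /lP.
by apply: nP; exists (m + l)%N; apply: ideal_pow_add_ind => // d e dm el; exact: mP.
Qed.

Definition killed_by_pow (I : submodClosed R^o) n V : Prop :=
  forall c (v : V), c \in ideal_pow I n -> c *: v = 0.

Lemma fg_torsion_killed (I : submodClosed R^o) V :
  finitely_generated V -> torsion I V -> exists n, killed_by_pow I n V.
Proof.
move=> [s sV] tV.
have [n nP] : exists n, forall v, v \in s -> forall c, c \in ideal_pow I n -> c *: v = 0.
  elim: s {sV} => [|v s [n nP]]; first by exists 0%N.
  have [m mP] := tV v; exists (maxn m n) => u.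
  rewrite inE => /orP[/eqP->|us] c cmn.
    by apply: mP; apply: ideal_powW cmn; rewrite leq_maxl.
  by apply: nP => //; apply: ideal_powW cmn; rewrite leq_maxr.
exists n => c v cn; move: v (sV v); apply: lspan_seq_ind => [|v vs]; last exact: nP.
exact: (submod_prop_ker (scaling c _)).
Qed.

(** * Regular elements *)

Definition maximal_ann V (v : V) : Prop := v <> 0 /\
  forall w : V, w <> 0 -> (forall c, c *: v = 0 -> c *: w = 0) ->
    forall c, c *: w = 0 -> c *: v = 0.

Definition prime_ann V (v : V) : Prop := v <> 0 /\
  forall c d, (c * d) *: v = 0 -> c *: v = 0 \/ d *: v = 0.

Lemma maximal_ann_prime V (v : V) : maximal_ann v -> prime_ann v.
Proof.
move=> [v0 vmax]; split=> // c d cdv.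
have [dv|/eqP dv] := eqVneq (d *: v) 0; [by right|left].
apply: vmax dv _ _ _ => [e ev|]; last by rewrite scalerA.
by rewrite scalerA mulrC -scalerA ev scaler0.
Qed.

Lemma maximal_ann_above (hR : noetherian R) V (v : V) : v <> 0 ->
  exists2 w : V, maximal_ann w & forall c, c *: v = 0 -> c *: w = 0.
Proof.
move=> v0; pose F (P : set R^o) := exists w : V,
  [/\ w <> 0, forall c, P c <-> c *: w = 0 & forall c, c *: v = 0 -> P c].
have ann_sub (w : V) : submod_prop [set c : R^o | c *: w = 0].
  by split=> [|a c d /= cw dw]; rewrite /= ?scale0r // scalerDl -scalerA cw dw scaler0 addr0.
have [|P [Ps [w [w0 Pw vP]] Pmax]] := @noeth_maximal _ F (noeth_ring hR).
  by exists [set c | c *: v = 0] => //; exists v.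
exists w => [|c /vP/Pw //]; split=> // u u0 wu c cu; apply/Pw.
apply: (Pmax [set c | c *: u = 0]) => //; last by move=> d /Pw/wu.
by exists u; split=> // d /vP/Pw/wu.
Qed.

(** Prime avoidance without associated primes: among the submodules spanned by
    elements [v_i] with maximal annihilators for which some [y] in [b] lies in no
    [ann v_i], take a maximal one. If [y] is a zero divisor, killing [w] say, then
    [y + c d], with [c] in [b] outside [ann w] and [d] killing the [v_i] but not
    [w], shows that [w] could be added to the [v_i]. *)
Lemma regular_or_annihilated (hR : noetherian R) V (b : submodClosed R^o) : noeth V ->
  (exists2 y, y \in b & forall v : V, y *: v = 0 -> v = 0) \/
  (exists2 v : V, prime_ann v & forall c, c \in b -> c *: v = 0).
Proof.
move=> nV; apply: contrapT => /not_orP[nreg nann].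
have nmax (w : V) : maximal_ann w -> exists2 c, c \in b & c *: w <> 0.
  move=> wmax; apply: contrapT => h; apply: nann; exists w.
    exact: maximal_ann_prime.
  by move=> c cb; apply: contrapT => cw; apply: h; exists c.
pose F (P : set V) := exists s : seq V, exists y : R,
  [/\ forall v, P v <-> v \in lspan [set` s], forall v, v \in s -> maximal_ann v,
      y \in b & forall v, v \in s -> y *: v <> 0].
have [|P [Ps [s [y [PE smax yb ys]]] Pmax]] := @noeth_maximal _ F nV.
  exists [set v | v \in lspan [set` ([::] : seq V)]]; first exact: submod_prop_mem.
  by exists [::], 0; split=> //; exact: ideal0.
have [v [yv v0]] : exists v : V, y *: v = 0 /\ v <> 0.
  apply: contrapT => h; apply: nreg; exists y => // v yv.
  by apply: contrapT => v0; apply: h; exists v.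
have [w wmax vw] := maximal_ann_above hR v0; have [w0 wprime] := maximal_ann_prime wmax.
have [d [ds dw]] : exists d, (forall u, u \in s -> d *: u = 0) /\ d *: w <> 0.
  elim: s smax ys {PE} => [|u s IH] smax ys; first by exists 1; rewrite scale1r.
  have [u' u's|u' u's|d [ds dw]] := IH; first by apply: smax; rewrite inE u's orbT.
    by apply: ys; rewrite inE u's orbT.
  have [e [eu ew]] : exists e, e *: u = 0 /\ e *: w <> 0.
    apply: contrapT => h; have [_ umax] := smax u (mem_head _ _).
    apply: (ys u (mem_head _ _)); apply: umax w0 _ _ (vw _ yv) => c cu.
    by apply: contrapT => cw; apply: h; exists c.
  exists (d * e); split; last by case/wprime.
  move=> u'; rewrite inE => /orP[/eqP->|/ds du]; first by rewrite -scalerA eu scaler0.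
  by rewrite mulrC -scalerA du scaler0.
(* Adding [w] to the [v_i], with [y + c d] for [y]. *)
have [c cb cw] := nmax w wmax.
have wP : P w.
  apply: (Pmax [set v | v \in lspan [set` w :: s]]).
  - exact: submod_prop_mem.
  - exists (w :: s), (y + c * d); split=> //.
    + by move=> u; rewrite inE => /orP[/eqP->|/smax].
    + by rewrite addrC mulrC; exact: ideal_lin.
    + move=> u; rewrite inE => /orP[/eqP->|us]; rewrite scalerDl.
        by rewrite (vw _ yv) add0r => /wprime[].
      by rewrite -scalerA ds // scaler0 addr0; apply: ys.
  - by move=> u /PE; apply: lspan_sub => z /= zs; rewrite inE zs orbT.
  - by apply: lspan_gen; rewrite /= mem_head.
apply: dw; move/PE: wP; move: w {wmax vw w0 wprime cw Pmax}.
by apply: lspan_seq_ind => //; exact: (submod_prop_ker (scaling d _)).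
Qed.

End Noetherian.

(** * Serre classes and cohomological functors *)

Section SerreClass.
Variables (R : comNzRingType) (MM : lmodType R -> Prop).
Hypothesis hMM : serre MM.
Implicit Types U V W X Y Z : lmodType R.

Lemma serre_inj U V (f : {linear U -> V}) : injective f -> MM V -> MM U.
Proof.
move=> finj MV; have [|//] := (hMM.2 U V (quomod (im f)) f (qproj _) _).1 MV.
split=> //; first exact: qproj_sur.
by move=> y; rewrite qproj0; split=> [/mksubmodP|h] //; apply/mksubmodP.
Qed.

Lemma serre_sur U V (f : {linear U -> V}) :
  (forall v, exists u, f u = v) -> MM U -> MM V.
Proof.
move=> fsur MU; have [|//] := (hMM.2 (submod (ker f)) U V (submod_incl _) f _).1 MU.
split; [exact: submod_incl_inj|by []|].
move=> y; split=> [fy|[x <-]]; last by have /mksubmodP := submod_inclP x.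
by apply: submod_incl_sur; apply/mksubmodP.
Qed.

Lemma serre0 V : (forall v : V, v = 0) -> MM V.
Proof.
move=> V0; have [[X0 MX0] _] := hMM; have zl : linear (fun _ : V => 0 : X0).
  by move=> a u v; rewrite scaler0 addr0.
by apply: (@serre_inj V X0 (mklinear zl)) => // u v _; rewrite [u]V0 [v]V0.
Qed.

(** The form in which the axioms of a Serre class are used: the kernel of [g] is,
    through [e], a submodule of a quotient of [U], and its image a submodule of a
    quotient of [U']. *)
Lemma serre_mid U V Z W U' (e : {linear V -> Z}) (f : {linear U -> Z})
    (g : {linear V -> W}) (h : {linear U' -> W}) :
    injective e -> (forall v, g v = 0 -> exists u, f u = e v) ->
    (forall v, exists u, h u = g v) -> MM U -> MM U' -> MM V.
Proof.
move=> einj gf gh MU MU'.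
have imMM (A B : lmodType R) (k : {linear A -> B}) : MM A -> MM (submod (im k)).
  move=> MA; have [|k' k'E] := @corestrict _ _ _ k (im k).
    by move=> u; apply/mksubmodP; exists u.
  apply: (serre_sur (f := k')) MA => v; have /mksubmodP[u uE] := submod_inclP v.
  exists u; apply: submod_incl_inj. by rewrite k'E.
have [|g1 g1E] := @corestrict _ _ _ g (im g).
  by move=> u; apply/mksubmodP; exists u.
have ses : short_exact (submod_incl (ker g)) g1.
  split.
- exact: submod_incl_inj.
- move=> z; have /mksubmodP[v vE] := submod_inclP z.
  by exists v; apply: submod_incl_inj; rewrite g1E.
- move=> y; have -> : g1 y = 0 <-> g y = 0.
    by rewrite -g1E; split=> [->|/(@submod_incl_inj _ _ (im g) _ 0)//]; rewrite linear0.
  split=> [gy|[x <-]]; last by have /mksubmodP := submod_inclP x.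
  by apply: submod_incl_sur; apply/mksubmodP.
apply/(hMM.2 _ _ _ _ _ ses); split.
- have [|e' e'E] := @corestrict _ (submod (ker g)) _ (e \o submod_incl _) (im f).
    move=> u; have /mksubmodP gu := submod_inclP u; have [w wE] := gf _ gu.
    by apply/mksubmodP; exists w.
  apply: (serre_inj (f := e')) (imMM _ _ f MU) => // u v uv; apply: submod_incl_inj; apply: einj.
  by rewrite -[LHS]/((e \o submod_incl _) u) -e'E uv e'E.
- have [|g' g'E] := @corestrict _ (submod (im g)) _ (submod_incl _) (im h).
    move=> u; have /mksubmodP[v <-] := submod_inclP u; have [w wE] := gh v.
    by apply/mksubmodP; exists w.
  apply: (serre_inj (f := g')) (imMM _ _ h MU') => // u v uv; apply: submod_incl_inj.
  by rewrite -g'E uv g'E.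
Qed.
End SerreClass.

Section Cohomological.
Variable R : comNzRingType.
Implicit Types X Y Z : lmodType R.

Definition exact_at X Y Z (f : {linear X -> Y}) (g : {linear Y -> Z}) :=
  forall y, g y = 0 <-> exists x, f x = y.

(** What the three families of functors have in common: they are delta-functors, on
    which the endomorphism [c] of [X] induces the endomorphism [c]. *)
Record cohomological (T : nat -> lmodType R -> lmodType R) := Cohomological {
  Tmap : forall i X Y, {linear X -> Y} -> {linear T i X -> T i Y};
  Tmap_comp : forall i X Y Z (f : {linear X -> Y}) (g : {linear Y -> Z})
    (h : {linear X -> Z}), (forall x, h x = g (f x)) ->
    forall t, Tmap i h t = Tmap i g (Tmap i f t);
  Tmap_scale : forall i X (f : {linear X -> X}) c, (forall x, f x = c *: x) ->
    forall t, Tmap i f t = c *: t;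
  Tmap_inj0 : forall X' X X'' (f : {linear X' -> X}) (g : {linear X -> X''}),
    short_exact f g -> injective (Tmap 0 f);
  Tmap_exact : forall i X' X X'' (f : {linear X' -> X}) (g : {linear X -> X''}),
    short_exact f g -> exact_at (Tmap i f) (Tmap i g);
  Tmap_connect : forall i X' X X'' (f : {linear X' -> X}) (g : {linear X -> X''}),
    short_exact f g -> exists d : {linear T i X'' -> T i.+1 X'},
      exact_at (Tmap i g) d /\ exact_at d (Tmap i.+1 f) }.

Lemma short_exact_sub X (N : submodClosed X) : short_exact (submod_incl N) (qproj N).
Proof.
split; [exact: submod_incl_inj|exact: qproj_sur|].
move=> y; rewrite qproj0; split; first exact: submod_incl_sur.
by move=> [x <-]; exact: submod_inclP.
Qed.

Lemma short_exact_quo X Y (f : {linear X -> Y}) : injective f ->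
  short_exact f (qproj (im f)).
Proof.
split=> //; first exact: qproj_sur.
by move=> y; rewrite qproj0; split=> [/mksubmodP|h] //; apply/mksubmodP.
Qed.
End Cohomological.

Arguments Tmap_inj0 {R T} _ [X' X X'' f g].
Arguments Tmap_exact {R T} _ i [X' X X'' f g].
Arguments Tmap_connect {R T} _ i [X' X X'' f g].

Section AbstractDepth.
Variables (R : comNzRingType) (hR : noetherian R) (b : submodClosed R^o).
Variables (MM : lmodType R -> Prop) (hMM : melkersson b MM).
Implicit Types X Y Z K : lmodType R.

Let sMM : serre MM := hMM.1.

Variables (T : nat -> lmodType R -> lmodType R) (hT : cohomological T).
Hypothesis T_torsion : forall i X, finitely_generated X -> torsion b (T i X).
Hypothesis T_killed : forall i n K,
  finitely_generated K -> MM K -> killed_by_pow b n K -> MM (T i K).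
Hypothesis T0_neq0 : forall X (v : X), finitely_generated X -> prime_ann v ->
  (forall c, c \in b -> c *: v = 0) ->
  exists h : {linear T 0 X -> X}, exists t, h t <> 0.

(** Melkersson's condition: [0 :_(T i X) b] is contained in the kernel of [y]. *)
Lemma MM_of_ker_scaling i X (y : R) : finitely_generated X -> y \in b ->
  MM (submod (ker (scaling y (T i X)))) -> MM (T i X).
Proof.
move=> fX yb MK; apply: hMM.2; first exact: T_torsion.
have [|j jE] := @corestrict _ (submod (colon b (T i X))) _ (submod_incl _)
  (ker (scaling y (T i X))).
  by move=> u; apply/mksubmodP; have /mksubmodP := submod_inclP u; exact.
apply: (serre_inj sMM (f := j)) MK => u v uv; apply: submod_incl_inj.
by rewrite -!jE uv.
Qed.

Fact torsion_part_prop X :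
  submod_prop [set v : X | exists n, forall c, c \in ideal_pow b n -> c *: v = 0].
Proof.
split=> [|a u v [n un] [m vm]]; first by exists 0%N => c _; rewrite scaler0.
exists (maxn n m) => c cnm; rewrite scalerDr scalerA mulrC -scalerA.
rewrite un ?scaler0 ?add0r ?vm //.
  by apply: ideal_powW cnm; rewrite leq_maxr.
by apply: ideal_powW cnm; rewrite leq_maxl.
Qed.
Definition torsion_part X : submodClosed X := mksubmod (@torsion_part_prop X).

Lemma torsion_part_killed X : finitely_generated X ->
  exists n, killed_by_pow b n (submod (torsion_part X)).
Proof.
move=> fX; apply: fg_torsion_killed; first by apply: noeth_sub; apply: fg_noeth.
move=> u; have /mksubmodP[m mP] := submod_inclP u; exists m => c cm; apply: submod_incl_inj.
by rewrite linearZ_LR mP // linear0.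
Qed.

(** The quotient of [X] by its [b]-torsion part [G] is [b]-torsion free: as [b^n G = 0]
    for some [n], if [b u] is contained in [G] then [b^(n+1) u = 0]. *)
Lemma regular_mod_torsion X : finitely_generated X ->
  exists2 y : R, y \in b & forall v : quomod (torsion_part X), y *: v = 0 -> v = 0.
Proof.
move=> fX; have fQ : finitely_generated (quomod (torsion_part X)) by exact: fg_quo.
have [//|[v [v0 _] bv]] := regular_or_annihilated hR b (fg_noeth hR fQ).
have [u uv] := qproj_sur v; case: v0; rewrite -uv; apply/qproj0/mksubmodP.
have [n nG] := torsion_part_killed fX; exists n.+1.
apply: ideal_powS_ind => [|c d cb dn].
  split=> [|e c d /= cu du]; first by rewrite /= scale0r.
  by rewrite /= scalerDl -scalerA cu du scaler0 addr0.
have [w wE] : exists w, submod_incl (torsion_part X) w = c *: u.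
  by apply: submod_incl_sur; apply/qproj0; rewrite linearZ_LR uv bv.
by rewrite /= mulrC -scalerA -wE -linearZ_LR nG // linear0.
Qed.

Lemma T_ses_mid i X' X X'' (f : {linear X' -> X}) (g : {linear X -> X''}) :
  short_exact f g -> MM (T i X') -> MM (T i X'') -> MM (T i X).
Proof.
move=> ses; have ex := Tmap_exact hT i ses.
apply: (serre_mid sMM (e := idfun) (f := Tmap hT i f) (g := Tmap hT i g) (h := idfun)).
- by [].
- by move=> t /ex.
- by move=> t; eexists.
Qed.

Lemma T_ses_right i X' X X'' (f : {linear X' -> X}) (g : {linear X -> X''}) :
  short_exact f g -> MM (T i X) -> MM (T i.+1 X') -> MM (T i X'').
Proof.
move=> ses; have [d [ex _]] := Tmap_connect hT i ses.
apply: (serre_mid sMM (e := idfun) (f := Tmap hT i g) (g := d) (h := idfun)).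
- by [].
- by move=> t /ex.
- by move=> t; eexists.
Qed.

Lemma MM_ker_comp X Y Z (f : {linear X -> Y}) (g : {linear Y -> Z}) :
  MM (submod (ker f)) -> MM (submod (ker g)) ->
  forall h : {linear X -> Z}, (forall x, h x = g (f x)) -> MM (submod (ker h)).
Proof.
move=> Mf Mg h hE.
apply: (serre_mid sMM (e := submod_incl (ker h)) (f := submod_incl (ker f))
          (g := f \o submod_incl (ker h)) (h := submod_incl (ker g))) Mf Mg.
- exact: submod_incl_inj.
- by move=> x fx; apply: submod_incl_sur; apply/mksubmodP.
- move=> x; apply: submod_incl_sur; apply/mksubmodP.
  by have /mksubmodP := submod_inclP x; rewrite /= hE.
Qed.

Lemma MM_ker_exact X Y Z (f : {linear X -> Y}) (g : {linear Y -> Z}) :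
  exact_at f g -> MM X -> MM (submod (ker g)).
Proof.
move=> ex MX.
have [|f' f'E] := @corestrict _ _ _ f (ker g).
  by move=> x; apply/mksubmodP/ex; exists x.
apply: (serre_sur sMM (f := f')) MX => u; have /mksubmodP/ex[x xE] := submod_inclP u.
by exists x; apply: submod_incl_inj; rewrite f'E.
Qed.

Lemma MM_ker_inj X Y (f : {linear X -> Y}) : injective f -> MM (submod (ker f)).
Proof.
move=> finj; apply: (serre0 sMM) => x; apply: submod_incl_inj; rewrite linear0.
by apply: finj; rewrite linear0; have /mksubmodP := submod_inclP x.
Qed.

Lemma MM_ker_ext X Y (f g : {linear X -> Y}) :
  f =1 g -> MM (submod (ker f)) -> MM (submod (ker g)).
Proof.
move=> fg Mf; apply: (@MM_ker_comp _ _ _ f idfun Mf) => [|x]; last by rewrite fg.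
exact: MM_ker_inj.
Qed.

(** [b] contains a nonzerodivisor [y] on [K] modulo its torsion part [G]. As
    [K/(G + yK)] is in the class, the kernel of [y] on [T i (K/G)] is in the
    class by induction on [i], and Melkersson's condition applies. *)
Lemma T_MM i K : finitely_generated K -> MM K -> MM (T i K).
Proof.
elim: i K => [|i IH] K fK MK; have [n nG] := torsion_part_killed fK;
  have [y yb yreg] := regular_mod_torsion fK; set G := torsion_part K in nG yreg;
  (have fG : finitely_generated (submod G) by apply: noeth_sub; apply: fg_noeth);
  (have MG : MM (submod G) by apply: (serre_inj sMM (@submod_incl_inj _ _ G)) MK);
  apply: (T_ses_mid (short_exact_sub G)) (T_killed _ fG MG nG) _;
  (have fQ : finitely_generated (quomod G) by apply: fg_quo);
  (have yinj : injective (scaling y (quomod G)) by apply: linear_inj);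
  have ses := short_exact_quo yinj; apply: (MM_of_ker_scaling fQ yb);
  apply: (@MM_ker_ext _ _ (Tmap hT _ (scaling y (quomod G))));
  try by move=> t; rewrite (Tmap_scale hT (c := y)).
- exact: MM_ker_inj (Tmap_inj0 hT ses).
- have [d [_ ex]] := Tmap_connect hT i ses; apply: (MM_ker_exact ex).
  apply: IH; first exact: fg_quo.
  apply: (serre_sur sMM (@qproj_sur _ _ _)).
  exact: (serre_sur sMM (@qproj_sur _ _ G)) MK.
Qed.

(** Modulo the largest submodule [N] of [X] in the class, [X] has no nonzero
    submodule in the class, so that any linear map from [T 0 (X/N)], which is in
    the class, to [X/N] vanishes. *)
Lemma regular_of_MM_T0 X : finitely_generated X -> MM (T 0 X) ->
  exists2 y : R, y \in b & MM (submod (colon (pred1 y) X)).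
Proof.
move=> fX MTX; have nX := fg_noeth hR fX.
pose F (P : set X) := exists2 N : submodClosed X, forall x, P x <-> x \in N & MM (submod N).
have [|P [Ps [N PN MN] Pmax]] := @noeth_maximal _ _ F nX.
  exists [set 0].
    by split=> // a u v -> ->; rewrite /= scaler0 addr0.
  exists (ker (idfun : {linear X -> X})) => [x|]; last by apply: MM_ker_inj.
  by split=> [->|/mksubmodP//]; apply/mksubmodP.
have fN : finitely_generated (submod N) by exact: noeth_sub.
have fQ : finitely_generated (quomod N) by exact: fg_quo.
have MTQ : MM (T 0 (quomod N)) by apply: T_ses_right (short_exact_sub N) MTX (T_MM _ fN MN).
have [[y yb yreg]|[v v0 bv]] := regular_or_annihilated hR b (fg_noeth hR fQ).
  have [|j jE] := @corestrict _ (submod (colon (pred1 y) X)) _ (submod_incl _) N.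
    move=> u; apply/qproj0/yreg; rewrite -linearZ_LR.
    by have /mksubmodP -> := submod_inclP u; rewrite ?linear0 // inE.
  exists y => //; apply: (serre_inj sMM (f := j)) MN => u v uv; apply: submod_incl_inj.
  by rewrite -!jE uv.
have [h [t ht]] := T0_neq0 fQ v0 bv; case: ht.
have [x xt] := qproj_sur (h t); rewrite -xt; apply/qproj0/PN.
(* The preimage of the image of [h], an extension of that image by [N]. *)
pose P2 : set X := [set x | exists t, h t = qproj N x].
have P2s : submod_prop P2.
  split=> [|a u w [s su] [r rw]]; first by exists 0; rewrite !linear0.
  by exists (a *: s + r); rewrite !linearP su rw.
apply: (Pmax P2) => //; last by exists t.
- exists (mksubmod P2s) => [z|]; first by split=> [Pz|/mksubmodP//]; apply/mksubmodP.
  apply: (serre_mid sMM (e := submod_incl _) (f := submod_incl N) (h := h)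
    (g := qproj N \o submod_incl (mksubmod P2s))) MN MTQ.
  + exact: submod_incl_inj.
  + by move=> u /= /qproj0; exact: submod_incl_sur.
  + by move=> u; have /mksubmodP := submod_inclP u.
- by move=> z /PN/qproj0 zN; exists 0; rewrite linear0 zN.
Qed.

Definition T_below n X : Prop := forall i, (i < n)%N -> MM (T i X).

(** Going from [Y] to [Y/yY] lowers by one the length of the initial range where
    [T] is in the class. Both [0 : y -> Y -> yY] and [yY -> Y -> Y/yY] are used; up
    to the class, the composite [T i Y -> T i (yY) -> T i Y], multiplication by
    [y], is injective as long as [T i.-1 (Y/yY)] is in the class. *)
Lemma T_below_step n Y Z (y : R) (p : {linear Y -> Z}) : finitely_generated Y ->
    y \in b -> MM (submod (colon (pred1 y) Y)) -> (forall z, exists x, p x = z) ->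
    (forall x, p x = 0 <-> exists w, x = y *: w) ->
  T_below n.+1 Y <-> T_below n Z.
Proof.
move=> fY yb MK psur pker.
pose K := submod (colon (pred1 y) Y); pose W := im (scaling y Y).
have fK : finitely_generated K by apply: noeth_sub; apply: fg_noeth.
have [|q qE] := @corestrict _ _ _ (scaling y Y) W.
  by move=> u; apply/mksubmodP; exists u.
have ses1 : short_exact (submod_incl (colon (pred1 y) Y)) q.
  split; first exact: submod_incl_inj.
    move=> z; have /mksubmodP[u uE] := submod_inclP z.
    by exists u; apply: submod_incl_inj; rewrite qE.
  move=> u; have -> : q u = 0 <-> y *: u = 0.
    split=> [qu|yu]; first by rewrite -[LHS]qE qu linear0.
    by apply: submod_incl_inj; rewrite qE linear0.
  split=> [yu|[x <-]]; last by have /mksubmodP := submod_inclP x; apply; rewrite inE.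
  by apply: submod_incl_sur; apply/mksubmodP => c; rewrite inE => /eqP ->.
have ses2 : short_exact (submod_incl W) p.
  split; [exact: submod_incl_inj|by []|].
  move=> u; rewrite pker; split=> [[w ->]|[x <-]].
    by apply: submod_incl_sur; apply/mksubmodP; exists w.
  by have /mksubmodP[w <-] := submod_inclP x; exists w.
have MTK i : MM (T i K) by exact: T_MM.
split=> [TY i ni|TZ i].
  apply: (T_ses_right ses2); first by apply: TY; rewrite ltnW.
  by apply: (T_ses_right ses1); [exact: TY|exact: MTK].
rewrite ltnS => ni; apply: (MM_of_ker_scaling fY yb).
apply: (@MM_ker_comp _ _ _ (Tmap hT i q) (Tmap hT i (submod_incl W))).
- exact: MM_ker_exact (Tmap_exact hT i ses1) (MTK i).
- case: i ni => [|i] ni; first exact: MM_ker_inj (Tmap_inj0 hT ses2).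
  have [d [_ ex]] := Tmap_connect hT i ses2.
  by apply: (MM_ker_exact ex); apply: TZ.
move=> t; rewrite -(Tmap_comp hT (h := scaling y Y)) => [|x]; last by rewrite qE.
by rewrite (Tmap_scale hT (c := y)).
Qed.

Lemma T_below_iso n X Y (f : {linear X -> Y}) : injective f ->
  (forall y, exists x, f x = y) -> T_below n X <-> T_below n Y.
Proof.
move=> finj fsur; have [g gE] := factor_inj (f := idfun) finj fsur.
have fK x : g (f x) = x by apply: finj; rewrite gE.
have iso i : MM (T i X) <-> MM (T i Y).
  split; [apply: (serre_inj sMM (f := Tmap hT i g))|apply: (serre_inj sMM (f := Tmap hT i f))].
    apply: (can_inj (g := Tmap hT i f)) => t.
    rewrite -(Tmap_comp hT (h := idfun)) => [|x]; last by rewrite gE.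
    by rewrite (Tmap_scale hT (c := 1)) ?scale1r // => x; rewrite scale1r.
  apply: (can_inj (g := Tmap hT i g)) => t.
  rewrite -(Tmap_comp hT (h := idfun)) => [|x]; last by rewrite fK.
  by rewrite (Tmap_scale hT (c := 1)) ?scale1r // => x; rewrite scale1r.
by split=> TX i /TX /iso.
Qed.

Definition seq_quo X (s : seq R) : lmodType R := quomod (smulmod (lspan [set` (s : seq R^o)]) X).

Lemma seq_quo_rcons X s (y : R) : exists2 p : {linear seq_quo X s -> seq_quo X (rcons s y)},
  forall z, exists x, p x = z & forall x, p x = 0 <-> exists w, x = y *: w.
Proof.
pose I := lspan [set` (s : seq R^o)]; pose J := lspan [set` (rcons s y : seq R^o)].
have IJ : {subset I <= J}.
  by apply: lspan_sub => c /= cs; rewrite mem_rcons inE cs orbT.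
have [|x|p pE] := @factor_sur _ _ _ _ (qproj (smulmod I X)) (qproj (smulmod J X)).
- exact: qproj_sur.
- by rewrite !qproj0; apply: smulmodS.
exists p => [z|].
  by have [x <-] := qproj_sur z; exists (qproj _ x); rewrite pE.
move=> x0; have [x <-] := qproj_sur x0; rewrite pE qproj0; split; last first.
  move=> [w0]; have [w <-] := qproj_sur w0; rewrite -linearZ_LR => /eqP.
  rewrite -subr_eq0 -linearB => /eqP/qproj0 xw.
  rewrite -(subrK (y *: w) x) rpredD //; first exact: smulmodS xw.
  by apply: smulmod_gen; apply: lspan_gen; rewrite /= mem_rcons mem_head.
suff H u : u \in smulmod J X -> exists w, u - y *: w \in smulmod I X.
  move=> /H[w xw]; exists (qproj _ w); apply/eqP.
  by rewrite -linearZ_LR -subr_eq0 -linearB; apply/eqP/qproj0.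
move: u; apply: smulmod_ind => [|c u cJ].
  split=> [|a u v [w uw] [z vz]]; first by exists 0; rewrite scaler0 subr0 mem0.
  exists (a *: w + z); rewrite scalerDr scalerA mulrC -scalerA opprD addrACA -scalerBr.
  exact: mem_lin.
have : c \in lspan [set` (y : R^o) :: (s : seq R^o)].
  by apply: lspan_sub cJ => d /=; rewrite mem_rcons.
case/lspan_cons => d [e [eI ->]]; exists (d *: u).
have -> : (d * y + e) *: u - y *: (d *: u) = e *: u.
  by rewrite scalerDl [y *: _]scalerA [y * d]mulrC addrAC subrr add0r.
exact: smulmod_gen.
Qed.

Lemma seq_quo0 X : injective (qproj (smulmod (lspan [set` ([::] : seq R^o)]) X)).
Proof.
apply: linear_inj => x /qproj0; move: x; apply: smulmod_ind => [|c v].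
  by split=> // a u v -> ->; rewrite scaler0 addr0.
move: c; apply: lspan_seq_ind => //.
split=> [|a c d /= cv dv]; first by rewrite /= scale0r.
by rewrite /= scalerDl -scalerA cv dv scaler0 addr0.
Qed.

Lemma T_below_regular X (ys : seq R) m j : finitely_generated X ->
    {subset ys <= b} -> regular_seq MM X ys -> (j <= size ys)%N ->
  T_below (j + m) X <-> T_below m (seq_quo X (take j ys)).
Proof.
move=> fX yb reg; elim: j m => [|j IH] m js.
  by rewrite take0; apply: T_below_iso (@seq_quo0 X) (@qproj_sur _ _ _).
rewrite addSnnS IH; last exact: ltnW.
have [p psur pker] := seq_quo_rcons X (take j ys) ys`_j.
rewrite (take_nth 0) //; apply: (T_below_step m _ _ _ psur pker).
- exact: fg_quo.
- exact/yb/mem_nth.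
- exact: reg.
Qed.

Lemma regular_seq_rcons X (ys : seq R) (y : R) : regular_seq MM X ys ->
  MM (submod (colon (pred1 y) (seq_quo X ys))) -> regular_seq MM X (rcons ys y).
Proof.
move=> reg My j; rewrite size_rcons ltnS leq_eqVlt => /orP[/eqP->|js].
  by rewrite nth_rcons ltnn eqxx -cats1 take_size_cat.
by rewrite nth_rcons js -cats1 takel_cat 1?ltnW //; apply: reg.
Qed.

Theorem T_regular_below X (ys : seq R) : finitely_generated X ->
  {subset ys <= b} -> regular_seq MM X ys -> T_below (size ys) X.
Proof.
move=> fX yb reg; rewrite -[size ys]addn0.
by apply/(T_below_regular _ fX yb reg).
Qed.

(** By [T_below_regular], if [T (size ys) X] were in the class then so would be [T 0]
    of the quotient of [X] by the sequence, which could then be extended. *)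
Theorem T_max_regular X (ys : seq R) : finitely_generated X ->
  max_regular_seq MM b X ys -> ~ MM (T (size ys) X).
Proof.
move=> fX [yb reg ymax] MT.
have : T_below (size ys + 1) X.
  move=> i; rewrite addn1 ltnS leq_eqVlt => /orP[/eqP->//|].
  exact: T_regular_below.
move/(T_below_regular _ fX yb reg (leqnn _)); rewrite take_size => /(_ 0 erefl) MT0.
have [|y yin My] := regular_of_MM_T0 _ MT0; first exact: fg_quo.
by apply: (ymax y yin); exact: regular_seq_rcons.
Qed.

End AbstractDepth.

(** * The long exact sequence of cohomology *)

Section LongExact.
Variable R : comNzRingType.
Implicit Types A B C : cochain_complex R.

Definition hcl C n : {linear submod (ker (cdiff C n)) -> cohomology C n} :=
  qproj (cobound C n).

Lemma hcl_sur C n (t : cohomology C n) : exists z, hcl C n z = t.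
Proof. exact: qproj_sur. Qed.

Lemma hcl0 C n z : hcl C n z = 0 <-> cobound_set (submod_incl _ z).
Proof. by rewrite qproj0; split=> [/mksubmodP|h] //; apply/mksubmodP. Qed.

Lemma cocycleP C n (z : submod (ker (cdiff C n))) : cdiff C n (submod_incl _ z) = 0.
Proof. by have /mksubmodP := submod_inclP z. Qed.

Lemma cocycle_sur C n (x : C n) :
  cdiff C n x = 0 -> exists z : submod (ker (cdiff C n)), submod_incl _ z = x.
Proof. by move=> dx; apply: submod_incl_sur; apply/mksubmodP. Qed.

Lemma cohomology_mapE A B (f : forall n, {linear A n -> B n}) (fP : cochain_map f) n z :
  exists2 z', cohomology_map fP n (hcl A n z) = hcl B n z' &
              submod_incl _ z' = f n (submod_incl _ z).
Proof.
exists (cocycle_map fP n z) => [|//].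
exact: (quomod_funE (@cobound_map_subproof _ _ _ f fP n) z).
Qed.

Lemma cobound_setD C n (x y : C n) :
  cobound_set x -> cobound_set y -> cobound_set (x - y).
Proof.
case: n x y => [|n] x y /=; first by move=> -> ->; rewrite subr0.
by move=> [u <-] [v <-]; exists (u - v); rewrite linearB.
Qed.

Lemma hcl_eq C n z z' :
  hcl C n z = hcl C n z' <-> cobound_set (submod_incl _ z - submod_incl _ z').
Proof.
rewrite -linearB -hcl0 linearB; split=> [->|/eqP]; first by rewrite subrr.
by rewrite subr_eq0 => /eqP.
Qed.

Lemma cobound_set0 C n : cobound_set (0 : C n).
Proof. by case: n => //= n; exists 0; rewrite linear0. Qed.

Lemma hcl_inclE C n z z' : submod_incl _ z = submod_incl _ z' -> hcl C n z = hcl C n z'.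
Proof. by move=> /submod_incl_inj ->. Qed.

Lemma cohomology_map_comp A B C (f : forall n, {linear A n -> B n})
    (g : forall n, {linear B n -> C n}) (h : forall n, {linear A n -> C n})
    (fP : cochain_map f) (gP : cochain_map g) (hP : cochain_map h) n :
    (forall x, h n x = g n (f n x)) ->
  forall t, cohomology_map hP n t = cohomology_map gP n (cohomology_map fP n t).
Proof.
move=> hE t; have [z <-] := hcl_sur t.
have [z1 -> z1E] := cohomology_mapE fP z; have [z2 -> z2E] := cohomology_mapE gP z1.
have [z3 -> z3E] := cohomology_mapE hP z.
by apply: hcl_inclE; rewrite z3E hE z2E z1E.
Qed.

Lemma cohomology_map_scale A (f : forall n, {linear A n -> A n}) (fP : cochain_map f) c n :
  (forall x, f n x = c *: x) -> forall t, cohomology_map fP n t = c *: t.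
Proof.
move=> fE t; have [z <-] := hcl_sur t; have [z1 -> z1E] := cohomology_mapE fP z.
by rewrite -linearZ_LR; apply: hcl_inclE; rewrite z1E fE linearZ_LR.
Qed.

Section ShortExact.
Variables (A B C : cochain_complex R).
Variables (f : forall n, {linear A n -> B n}) (g : forall n, {linear B n -> C n}).
Hypotheses (fP : cochain_map f) (gP : cochain_map g).
Hypothesis fg : forall n, short_exact (f n) (g n).

Let finj n : injective (f n). Proof. by case: (fg n). Qed.
Let gsur n z : exists y, g n y = z. Proof. by case: (fg n). Qed.
Let gf n y : g n y = 0 <-> exists x, f n x = y. Proof. by case: (fg n). Qed.
Let gf0 n x : g n (f n x) = 0. Proof. by apply/gf; exists x. Qed.

Lemma cohomology_inj0 : injective (cohomology_map fP 0).
Proof.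
apply: linear_inj => t; have [z <-] := hcl_sur t.
have [z' -> z'E] := cohomology_mapE fP z.
move=> /hcl0 fz; apply/hcl0; change (submod_incl _ z = 0); apply: finj.
by rewrite linear0 -z'E.
Qed.

Lemma cohomology_exact n : exact_at (cohomology_map fP n) (cohomology_map gP n).
Proof.
move=> t; split; last first.
  case=> s <-; have [z <-] := hcl_sur s; have [z1 -> z1E] := cohomology_mapE fP z.
  have [z2 -> z2E] := cohomology_mapE gP z1.
  by apply/hcl0; rewrite z2E z1E gf0; exact: cobound_set0.
have [y <-] := hcl_sur t; have [z -> zE] := cohomology_mapE gP y; rewrite hcl0 zE => cb.
have [b [bcob db gb]] : exists b,
    [/\ cobound_set b, cdiff B n b = 0 & g n (submod_incl _ y) = g n b].
  case: n y z zE cb {t} => [|n] y z zE /= cb; first by exists 0; rewrite !linear0.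
  have [c cE] := cb; have [u uE] := gsur c; exists (cdiff B n u).
  by split; [exists u|rewrite cdiffK|rewrite gP uE cE].
have [x xE] : exists x, f n x = submod_incl _ y - b by apply/gf; rewrite linearB gb subrr.
have [|x' x'E] := @cocycle_sur A n x.
  by apply: finj; rewrite fP xE linearB cocycleP db subrr linear0.
exists (hcl A n x'); have [z1 -> z1E] := cohomology_mapE fP x'.
apply/hcl_eq; rewrite z1E x'E xE; have -> : submod_incl _ y - b - submod_incl _ y = 0 - b.
  by rewrite addrAC subrr.
by apply: cobound_setD => //; apply: cobound_set0.
Qed.

(** The graph of the connecting homomorphism: a cocycle [z] of [C] is lifted to a
    cochain [y] of [B], the differential of which comes from a cocycle [x] of [A]. *)
Definition connect_rel n (t : cohomology C n) (s : cohomology A n.+1) : Prop :=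
  exists y z x, [/\ g n y = submod_incl _ z, f n.+1 (submod_incl _ x) = cdiff B n y,
                    t = hcl C n z & s = hcl A n.+1 x].

Lemma cohomology_connect n : exists d : {linear cohomology C n -> cohomology A n.+1},
  [/\ forall t s, connect_rel t s <-> d t = s, exact_at (cohomology_map gP n) d
    & exact_at d (cohomology_map fP n.+1)].
Proof.
have lift (y : B n) : cdiff C n (g n y) = 0 ->
    exists x : submod (ker (cdiff A n.+1)), f n.+1 (submod_incl _ x) = cdiff B n y.
  move=> dgy; have [x xE] : exists x, f n.+1 x = cdiff B n y by apply/gf; rewrite gP.
  have [|x' x'E] := @cocycle_sur A n.+1 x; last by exists x'; rewrite x'E.
  by apply: finj; rewrite fP xE cdiffK linear0.
have [| | |d dP] := @linear_of_graph _ _ _ (@connect_rel n).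
- move=> a _ _ _ _ [y [z [x [yz xy -> ->]]]] [y' [z' [x' [yz' xy' -> ->]]]].
  exists (a *: y + y'), (a *: z + z'), (a *: x + x').
  by rewrite !linearP yz yz' xy xy'.
- move=> t; have [z <-] := hcl_sur t; have [y yz] := gsur (submod_incl _ z).
  have [|x xy] := lift y; first by rewrite yz cocycleP.
  by exists (hcl _ _ x), y, z, x.
- move=> _ [y [z [x [yz xy /esym/hcl0 tz ->]]]]; apply/hcl0 => /=.
  have [b [db gb]] : exists b, cdiff B n b = 0 /\ g n b = submod_incl _ z.
    case: n y z x yz xy tz {lift} => [|n] y z x yz xy /= tz.
      by exists 0; rewrite !linear0 tz.
    have [c cE] := tz; have [u uE] := gsur c; exists (cdiff B n u).
    by rewrite cdiffK gP uE cE.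
  have [w wE] : exists w, f n w = y - b by apply/gf; rewrite linearB yz gb subrr.
  by exists w; apply: finj; rewrite fP wE linearB db subr0 xy.
exists d; split=> //.
- move=> t; split.
    move/dP=> [y [z [x [yz xy -> /esym/hcl0[a aE]]]]].
    have [|y' y'E] := @cocycle_sur B n (y - f n a).
      by rewrite linearB -fP aE xy subrr.
    exists (hcl B n y'); have [z1 -> z1E] := cohomology_mapE gP y'.
    by apply: hcl_inclE; rewrite z1E y'E linearB gf0 subr0.
  case=> s <-; have [y <-] := hcl_sur s; have [z -> zE] := cohomology_mapE gP y.
  apply/dP; exists (submod_incl _ y), z, 0; rewrite zE cocycleP !linear0; split=> //.
- move=> t; split; last first.
    case=> s /dP[y [z [x [yz xy _ ->]]]]; have [x' -> x'E] := cohomology_mapE fP x.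
    by apply/hcl0; rewrite x'E xy; exists y.
  have [x <-] := hcl_sur t; have [x' -> x'E] := cohomology_mapE fP x.
  rewrite hcl0 x'E => -[y yE]; have [|z zE] := @cocycle_sur C n (g n y).
    by rewrite -gP yE gf0.
  by exists (hcl C n z); apply/dP; exists y, z, x.
Qed.

End ShortExact.
End LongExact.

(** * Direct limits of sequences *)

Definition eventually_eq (E : nat -> Type) (f g : forall k, E k) : Prop :=
  exists n, forall m, (n <= m)%N -> f m = g m.

Section DirectLimits.
Variable R : comNzRingType.

Section System.
Variables (E : nat -> lmodType R) (phi : forall k, {linear E k -> E k.+1}).
Implicit Types (f : dprod E) (t : dlim phi).

(** [dlim_rel_fun phi] is bijective on the module of all sequences, and the sequences
    that it maps to finitely supported ones are those that are threads from some
    index on. So elements of [dlim phi] can be thought of as eventual threads, two of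
    them being identified when they eventually coincide; this avoids transporting
    elements of [E k] to [E (n + k)]. *)
Definition dlim_rep f t : Prop := exists z : submod (dsum E),
  submod_incl _ z = dlim_rel_fun phi f /\ qproj (im (submod_map (dlim_rel_dsum phi))) z = t.

Definition thread_from n f : Prop := forall m, (n <= m)%N -> f m.+1 = phi m (f m).

Fixpoint dlim_acc f k : E k :=
  match k with 0 => f 0%N | m.+1 => f m.+1 + phi m (dlim_acc f m) end.

Lemma dlim_accK f : dlim_rel_fun phi (dlim_acc f) = f.
Proof. by apply: functional_extensionality_dep => -[|k] //=; rewrite addrK. Qed.

Lemma dlim_relK f : dlim_acc (dlim_rel_fun phi f) = f.
Proof.
apply: functional_extensionality_dep; elim=> //= k ->.
by rewrite subrK.
Qed.

Lemma dlim_rep_thread f t : dlim_rep f t -> exists n, thread_from n f.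
Proof.
case=> z [zE _]; have /mksubmodP[n nz] := submod_inclP z; exists n => m nm.
have := nz m.+1 (leqW nm); rewrite zE /= => /eqP.
by rewrite subr_eq0 => /eqP.
Qed.

Lemma dlim_rep_sur t : exists f, dlim_rep f t.
Proof.
have [z zt] := qproj_sur t; exists (dlim_acc (submod_incl _ z)), z; split=> //.
by rewrite dlim_accK.
Qed.

Lemma dlim_rep_ex n f : thread_from n f -> exists t, dlim_rep f t.
Proof.
move=> nf; have [|z zE] := @submod_incl_sur _ _ (dsum E) (dlim_rel_fun phi f).
  apply/mksubmodP; exists n.+1 => -[|m] // nm /=.
  by rewrite nf // subrr.
by exists (qproj _ z), z.
Qed.

Lemma dlim_rep_lin a f t f' t' : dlim_rep f t -> dlim_rep f' t' ->
  dlim_rep (a *: f + f') (a *: t + t').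
Proof.
move=> [z [zE zt]] [z' [zE' zt']]; exists (a *: z + z').
rewrite !linearP zE zE' zt zt'; split=> //; symmetry; exact: dlim_rel_linear.
Qed.

Lemma dlim_rep_scale a f t : dlim_rep f t -> dlim_rep (a *: f) (a *: t).
Proof.
case=> z [zE zt]; exists (a *: z); rewrite !linearZ_LR zE zt; split=> //.
by symmetry; exact: (linearZ_LR (mklinear (dlim_rel_linear phi))).
Qed.

Lemma dlim_rep0 f t : dlim_rep f t -> t = 0 <-> exists n, forall m, (n <= m)%N -> f m = 0.
Proof.
case=> z [zE <-]; rewrite qproj0; split.
  case/mksubmodP=> u uz; have /mksubmodP[n nu] := submod_inclP u; exists n => m nm.
  suff -> : f = submod_incl _ u by exact: nu.
  rewrite -[LHS]dlim_relK -zE -uz -[RHS]dlim_relK; congr dlim_acc.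
case=> n nf; have [|u uf] := @submod_incl_sur _ _ (dsum E) f.
  by apply/mksubmodP; exists n.
apply/mksubmodP; exists u; apply: submod_incl_inj; rewrite zE -uf; reflexivity.
Qed.

Lemma dlim_rep_eq f t f' t' : dlim_rep f t -> dlim_rep f' t' ->
  t = t' <-> eventually_eq f f'.
Proof.
move=> ft ft'; have := dlim_rep0 (dlim_rep_lin (-1) ft' ft).
rewrite scaleN1r addrC; split=> [tt'|[n ff']].
  have /H[n nP] : t - t' = 0 by rewrite tt' subrr.
  exists n => m /nP /eqP; rewrite -[X in X == 0 -> _]/(-1 *: f' m + f m).
  by rewrite scaleN1r addrC subr_eq0 => /eqP.
apply/eqP; rewrite -subr_eq0; apply/eqP/H; exists n => m nm.
by rewrite -[LHS]/(-1 *: f' m + f m) ff' // scaleN1r addNr.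
Qed.
End System.

Lemma thread_through (E : nat -> lmodType R) (phi : forall k, {linear E k -> E k.+1})
    k (e : E k) : exists f : dprod E, f k = e /\ thread_from phi k f.
Proof.
elim: k E phi e => [|k IH] E phi e.
  pose f := fix f k : E k := match k with 0 => e | m.+1 => phi m (f m) end.
  by exists f.
have [g [gk gt]] := IH (fun k => E k.+1) (fun k => phi k.+1) e.
exists (fun k => match k with 0 => 0 | m.+1 => g m end); split=> // -[|m] //.
exact: gt.
Qed.

Lemma dlim_at (E : nat -> lmodType R) (phi : forall k, {linear E k -> E k.+1})
    k (e : E k) : exists f (t : dlim phi), [/\ f k = e, thread_from phi k f & dlim_rep f t].
Proof.
have [f [fk ft]] := thread_through phi e; have [t tP] := dlim_rep_ex ft.
by exists f, t.
Qed.

Lemma dlim_out (E : nat -> lmodType R) (phi : forall k, {linear E k -> E k.+1})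
    (X : lmodType R) (g : forall k, {linear E k -> X}) :
    (forall k e, g k.+1 (phi k e) = g k e) ->
  exists h : {linear dlim phi -> X}, forall f t, dlim_rep f t ->
    exists n, forall m, (n <= m)%N -> h t = g m (f m).
Proof.
move=> gphi; have [| | |h hP] := @linear_of_graph _ (dlim phi) X
  (fun t x => exists2 f, dlim_rep f t & exists n, forall m, (n <= m)%N -> x = g m (f m)).
- move=> a t x t' x' [f ft [n nx]] [f' ft' [n' nx']].
  exists (a *: f + f'); first exact: dlim_rep_lin.
  exists (maxn n n') => m; rewrite geq_max => /andP[nm nm'].
  by rewrite (nx m) // (nx' m) // -linearP.
- move=> t; have [f ft] := dlim_rep_sur t; have [n fn] := dlim_rep_thread ft.
  exists (g n (f n)), f => //; exists n => m /subnK <-.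
  by elim: (m - n)%N => // k IH; rewrite addSn fn ?leq_addl // gphi -IH.
- move=> x [f /dlim_rep0[/(_ erefl)[n fn] _] [n' nx]].
  by rewrite (nx (maxn n n')) ?leq_maxr // fn ?leq_maxl // linear0.
exists h => f t ft; have [f' ft' [n nx]] := (hP t (h t)).2 erefl.
have [k kf] := (dlim_rep_eq ft ft').1 erefl.
exists (maxn n k) => m; rewrite geq_max => /andP[nm km].
by rewrite kf //; exact: nx.
Qed.

Section Maps.
Variables (E F : nat -> lmodType R) (phi : forall k, {linear E k -> E k.+1})
  (psi : forall k, {linear F k -> F k.+1}).

Definition dlim_maps (a : forall k, {linear E k -> F k}) (h : {linear dlim phi -> dlim psi}) :=
  forall f t, dlim_rep f t -> dlim_rep (fun k => a k (f k)) (h t).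

Lemma dlim_map_ex (a : forall k, {linear E k -> F k}) :
  (forall k e, a k.+1 (phi k e) = psi k (a k e)) -> exists h, dlim_maps a h.
Proof.
move=> aphi; have [| | |h hP] := @linear_of_graph _ (dlim phi) (dlim psi)
  (fun t s => exists2 f, dlim_rep f t & dlim_rep (fun k => a k (f k)) s).
- move=> c t s t' s' [f ft fs] [f' ft' fs'].
  exists (c *: f + f'); first exact: dlim_rep_lin.
  have -> : (fun k => a k ((c *: f + f') k)) =
    c *: ((fun k => a k (f k)) : dprod F) + (fun k => a k (f' k)).
    by apply: functional_extensionality_dep => k; exact: linearP.
  exact: dlim_rep_lin.
- move=> t; have [f ft] := dlim_rep_sur t; have [n fn] := dlim_rep_thread ft.
  have [|s fs] := @dlim_rep_ex _ psi n (fun k => a k (f k)).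
    by move=> m nm; rewrite fn // aphi.
  by exists s, f.
- move=> s [f /dlim_rep0[/(_ erefl)[n fn] _] fs].
  by apply/(dlim_rep0 fs); exists n => m /fn ->; rewrite linear0.
exists h => f t ft; have [f' ft' fs'] := (hP t (h t)).2 erefl.
suff [s fs] : exists s, dlim_rep (phi := psi) (fun k => a k (f k)) s.
  have -> // : h t = s; apply/hP; exists f => //.
have [n fn] := dlim_rep_thread ft.
by apply: (@dlim_rep_ex _ psi n) => m nm; rewrite fn // aphi.
Qed.
End Maps.

Lemma dlim_inj (E F : nat -> lmodType R) (phi : forall k, {linear E k -> E k.+1})
    (psi : forall k, {linear F k -> F k.+1})
    (a : forall k, {linear E k -> F k}) (h : {linear dlim phi -> dlim psi}) :
  dlim_maps a h -> (forall k, injective (a k)) -> injective h.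
Proof.
move=> hP ainj; apply: linear_inj => t ht; have [f ft] := dlim_rep_sur t.
apply/(dlim_rep0 ft); have := hP f t ft; rewrite ht.
move=> /dlim_rep0[/(_ erefl)[n nf] _]; exists n => m /nf af.
by apply: ainj; rewrite af linear0.
Qed.

Lemma dlim_exact (E F G : nat -> lmodType R) (phi : forall k, {linear E k -> E k.+1})
    (psi : forall k, {linear F k -> F k.+1}) (chi : forall k, {linear G k -> G k.+1})
    (a : forall k, {linear E k -> F k}) (b : forall k, {linear F k -> G k})
    (A : {linear dlim phi -> dlim psi}) (B : {linear dlim psi -> dlim chi}) :
  (forall k e, a k.+1 (phi k e) = psi k (a k e)) ->
  dlim_maps a A -> dlim_maps b B -> (forall k, exact_at (a k) (b k)) -> exact_at A B.
Proof.
move=> aphi AP BP ex t; have [f ft] := dlim_rep_sur t; have fB := BP f t ft; split.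
  move/(dlim_rep0 fB)=> [n bf]; have [m fm] := dlim_rep_thread ft.
  have [x xf] : exists x, a (maxn n m) x = f (maxn n m) by apply/ex/bf; rewrite leq_maxl.
  have [g [s [gx gt gs]]] := dlim_at phi x; exists s.
  apply/(dlim_rep_eq (AP _ _ gs) ft); exists (maxn n m) => k /subnK <-.
  elim: (k - _)%N => [|l IH]; first by rewrite gx.
  by rewrite addSn gt ?leq_addl // aphi IH fm // (leq_trans (leq_maxr n m)) ?leq_addl.
case=> s <-; have [g gs] := dlim_rep_sur s.
apply/(dlim_rep0 (BP _ _ (AP _ _ gs))); exists 0%N => m _.
by apply/ex; exists (g m).
Qed.

End DirectLimits.

(** * Ext *)

Section ExtClasses.
Variable R : comNzRingType.
Implicit Types N K U V : lmodType R.

Lemma hom_of_subproof U V (f : {linear U -> V}) :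
  (f : U -> V) \in mksubmod (@hom_prop R U V).
Proof. by apply: (introT (mksubmodP (hom_prop U V) (f : U -> V))) => a u v; exact: linearP. Qed.
Definition hom_of U V (f : {linear U -> V}) : hom U V :=
  exist _ (f : U -> V) (hom_of_subproof f).

Lemma hom_ofP U V (g : hom U V) : exists f, g = hom_of f.
Proof. by exists (mklinear (hom_linear g)); apply: val_inj. Qed.

Lemma hom_ext U V (f g : hom U V) : (forall u, val f u = val g u) -> f = g.
Proof. by move=> fg; apply: val_inj; apply/funext. Qed.

Lemma aug_gen N v : aug N << v >> = v.
Proof. exact: (free_liftE id). Qed.

Lemma aug_sur N v : exists u, aug N u = v.
Proof. by exists << v >>; exact: aug_gen. Qed.

Lemma aug_res_diff N i u : aug (syz N i) (res_diff N i u) = 0.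
Proof. by apply/res_exact; exists u. Qed.

Lemma ecl_subproof N K i (f : {linear syz N i -> K}) :
  hom_of (f \o aug (syz N i)) \in ker (cdiff (ext_complex N K) i).
Proof.
apply/mksubmodP; apply: hom_ext => u; rewrite precompE.
by rewrite -[LHS]/(f (aug (syz N i) (res_diff N i u))) aug_res_diff linear0.
Qed.

Definition ecocycle N K i (f : {linear syz N i -> K}) :
    submod (ker (cdiff (ext_complex N K) i)) :=
  exist (fun g : ext_complex N K i => g \in ker (cdiff (ext_complex N K) i))
    (hom_of (f \o aug (syz N i))) (ecl_subproof f).

(** By exactness of the resolution, a cocycle of degree [i] is a linear map on the
    [i]-th syzygy; it is a coboundary, for [i > 0], if it extends to the free module
    containing the syzygy. *)
Definition ecl N K i (f : {linear syz N i -> K}) : Ext i N K :=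
  hcl _ _ (ecocycle f).

Definition ext_null N K i : {linear syz N i -> K} -> Prop :=
  match i return {linear syz N i -> K} -> Prop with
  | 0 => fun f => forall z, f z = 0
  | j.+1 => fun f => exists h : {linear free (syz N j) -> K}, forall z, f z = h (val z)
  end.

Lemma ecl0 N K i (f : {linear syz N i -> K}) : ecl f = 0 <-> ext_null f.
Proof.
rewrite hcl0; case: i f => [|i] f; split.
- move=> f0 z; have [u <-] := aug_sur z.
  exact: (congr1 (fun g : hom _ _ => val g u) f0).
- by move=> f0; apply: hom_ext => u; exact: f0.
- case=> y yE; have [h hE] := hom_ofP y; exists h => z; have [u <-] := aug_sur z.
  have := congr1 (fun g : hom (res N i.+1) K => val g u) yE.
  by rewrite hE.
- by case=> h hE; exists (hom_of h); apply: hom_ext => u; rewrite precompE /= hE.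
Qed.

Lemma ecl_sur N K i (t : Ext i N K) : exists f, ecl f = t.
Proof.
have [z <-] := hcl_sur t; have [g gE] := hom_ofP (submod_incl _ z).
have [||f fE] := @factor_sur _ _ _ _ (aug (syz N i)) g.
- exact: aug_sur.
- move=> u /res_exact[w <-].
  have := congr1 (fun g : hom (res N i.+1) K => val g w) (cocycleP z).
  by rewrite gE.
exists f; apply: hcl_inclE; rewrite gE; apply: hom_ext => u; exact: fE.
Qed.

Lemma ecl_lin N K i a (f g h : {linear syz N i -> K}) :
  (forall z, h z = a *: f z + g z) -> ecl h = a *: ecl f + ecl g.
Proof.
move=> hE; rewrite -linearP; apply: hcl_inclE; rewrite linearP.
by apply: hom_ext => u; exact: hE.
Qed.

Lemma ecl_ext N K i (f g : {linear syz N i -> K}) : f =1 g -> ecl f = ecl g.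
Proof. by move=> fg; apply: hcl_inclE; apply: hom_ext => u; exact: fg. Qed.

Lemma Ext_map_ecl N N' K i (u : {linear N -> N'}) (f : {linear syz N' i -> K}) :
  Ext_map i u K (ecl f) = ecl (f \o syz_map u i).
Proof.
have [z -> zE] := cohomology_mapE (@Ext_map_subproof R N N' u K) (ecocycle f).
apply: hcl_inclE; rewrite zE; apply: hom_ext => w; rewrite precompE.
by rewrite -[LHS]/(f (aug (syz N' i) (free_map (syz_map u i) w))) aug_free_map.
Qed.

Fact post_fun_linear U V V' (k : {linear V -> V'}) :
  linear (fun f : U -> V => k \o f : U -> V').
Proof. by move=> a f g; apply/funext => u; exact: linearP. Qed.
Fact post_hom U V V' (k : {linear V -> V'}) (f : U -> V) :
  f \in mksubmod (@hom_prop R U V) ->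
  mklinear (@post_fun_linear U V V' k) f \in mksubmod (@hom_prop R U V').
Proof. by move=> /mksubmodP hf; apply/mksubmodP => a u v /=; rewrite hf linearP. Qed.
Definition post U V V' (k : {linear V -> V'}) : {linear hom U V -> hom U V'} :=
  submod_map (@post_hom U V V' k).

Arguments post {U V V'} k.

Lemma postE U V V' (k : {linear V -> V'}) (f : hom U V) u :
  val (post k f) u = k (val f u).
Proof. by []. Qed.

Lemma post_cochain N K K' (k : {linear K -> K'}) :
  @cochain_map R (ext_complex N K) (ext_complex N K') (fun n => post k).
Proof. by move=> n f; apply: hom_ext. Qed.

Arguments post_cochain N {K K'} k.

Definition Ext_post i N K K' (k : {linear K -> K'}) : {linear Ext i N K -> Ext i N K'} :=
  cohomology_map (post_cochain N k) i.

Arguments Ext_post i N {K K'} k.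

Lemma Ext_post_ecl N K K' i (k : {linear K -> K'}) (f : {linear syz N i -> K}) :
  Ext_post i N k (ecl f) = ecl (k \o f).
Proof.
have [z -> zE] := cohomology_mapE (post_cochain N k)
  (ecocycle f).
by apply: hcl_inclE; rewrite zE; apply: hom_ext => w; rewrite postE.
Qed.

Lemma Ext_map_post N N' K K' i (u : {linear N -> N'}) (k : {linear K -> K'}) t :
  Ext_map i u K' (Ext_post i N' k t) = Ext_post i N k (Ext_map i u K t).
Proof.
have [f <-] := ecl_sur t; rewrite Ext_post_ecl !Ext_map_ecl Ext_post_ecl.
exact: ecl_ext.
Qed.

(** A map on a free module is determined by its values on the basis, which can be
    lifted one by one along a surjection. *)
Lemma post_free_exact N K K' K'' (f : {linear K -> K'}) (g : {linear K' -> K''}) :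
  short_exact f g -> short_exact (post (U := free N) f) (post (U := free N) g).
Proof.
move=> [finj gsur gf]; split.
- move=> h h' hh'; apply: hom_ext => u; apply: finj.
  exact: (congr1 (fun h : hom (free N) K' => val h u) hh').
- move=> h; have [l lE] := choice_ex (fun v : N => gsur (val h << v >>)).
  exists (hom_of (free_lift l)); apply: hom_ext => u; rewrite postE.
  have [h' hE] := hom_ofP h; rewrite hE; apply: (@free_ext _ _ _ (g \o free_lift l) h') => v.
  rewrite -[LHS]/(g (free_lift l << v >>)) free_liftE.
  by rewrite lE hE.
- move=> h; split=> [gh|[h' <-]]; last first.
    by apply: hom_ext => u; rewrite !postE; apply/gf; exists (val h' u).
  have [h' hE] := hom_ofP h; have [|k kE] := factor_inj (f := h') finj.
    move=> u; apply/gf; have := congr1 (fun h : hom (free N) K'' => val h u) gh.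
    by rewrite postE hE.
  by exists (hom_of k); rewrite hE; apply: hom_ext => u; exact: kE.
Qed.

Section LongExactExt.
Variables (K' K K'' : lmodType R) (f : {linear K' -> K}) (g : {linear K -> K''}).
Hypothesis fg : short_exact f g.

Let ses N n := @post_free_exact (syz N n) _ _ _ _ _ fg.

Lemma Ext_post_inj0 N : injective (Ext_post 0 N f).
Proof. exact: (@cohomology_inj0 _ (ext_complex N K') (ext_complex N K) (ext_complex N K'')
  _ (fun n => post g) (post_cochain N f) (ses N)). Qed.

Lemma Ext_post_exact i N : exact_at (Ext_post i N f) (Ext_post i N g).
Proof. exact: (cohomology_exact (post_cochain N f) (post_cochain N g) (ses N)). Qed.

Definition Ext_connect_rel i N : Ext i N K'' -> Ext i.+1 N K' -> Prop :=
  @connect_rel _ (ext_complex N K') (ext_complex N K) (ext_complex N K'')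
    (fun n => post f) (fun n => post g) i.

Lemma Ext_connect_ex i N : exists d : {linear Ext i N K'' -> Ext i.+1 N K'},
  [/\ forall t s, Ext_connect_rel t s
        <-> d t = s, exact_at (Ext_post i N g) d & exact_at d (Ext_post i.+1 N f)].
Proof.
exact: (cohomology_connect (post_cochain N f) (post_cochain N g) (ses N) i).
Qed.

Definition Ext_connect i N : {linear Ext i N K'' -> Ext i.+1 N K'} :=
  sval (cid (Ext_connect_ex i N)).

Lemma Ext_connect_exact1 i N : exact_at (Ext_post i N g) (Ext_connect i N).
Proof. by rewrite /Ext_connect; case: cid => d []. Qed.

Lemma Ext_connect_exact2 i N : exact_at (Ext_connect i N) (Ext_post i.+1 N f).
Proof. by rewrite /Ext_connect; case: cid => d []. Qed.

Lemma Ext_connectP i N t s :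
  Ext_connect_rel t s
    <-> Ext_connect i N t = s.
Proof. by rewrite /Ext_connect; case: cid => d []. Qed.

Lemma Ext_map_connect i N N' (u : {linear N -> N'}) t :
  Ext_map i.+1 u K' (Ext_connect i N' t) = Ext_connect i N (Ext_map i u K'' t).
Proof.
apply/esym/Ext_connectP; have := (Ext_connectP t (Ext_connect i N' t)).2 erefl.
case=> y [z [x [yz xy tz sx]]]; rewrite sx {1}tz.
have [z' zz' zE'] := cohomology_mapE (@Ext_map_subproof R N N' u K'') z.
have [x' xx' xE'] := cohomology_mapE (@Ext_map_subproof R N N' u K') x.
exists (precomp (res_map u i) K y), z', x'; split=> //.
- by rewrite zE'; apply: hom_ext => w; rewrite postE !precompE -yz.
- rewrite xE'; apply: hom_ext => w; rewrite postE !precompE.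
  have := congr1 (fun h : hom (res N' i.+1) K => val h (res_map u i.+1 w)) xy.
  by rewrite postE precompE => ->; rewrite res_map_diff.
Qed.
End LongExactExt.

Lemma Ext_post_comp i N K K' K'' (f : {linear K -> K'}) (g : {linear K' -> K''})
    (h : {linear K -> K''}) : (forall x, h x = g (f x)) ->
  forall t, Ext_post i N h t = Ext_post i N g (Ext_post i N f t).
Proof.
move=> hE; apply: cohomology_map_comp => k; apply: hom_ext => u.
by rewrite !postE hE.
Qed.

Lemma Ext_post_scale i N K (f : {linear K -> K}) c : (forall x, f x = c *: x) ->
  forall t, Ext_post i N f t = c *: t.
Proof.
move=> fE; apply: cohomology_map_scale => k; apply: hom_ext => u.
by rewrite postE fE.
Qed.

Definition Ext_cohomological N : cohomological (fun i X => Ext i N X).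
Proof.
exists (fun i X Y f => Ext_post i N f).
- by move=> i X Y Z f g h; exact: Ext_post_comp.
- by move=> i X f c; exact: Ext_post_scale.
- by move=> X' X X'' f g fg; apply: (Ext_post_inj0 fg).
- by move=> i X' X X'' f g fg; apply: (Ext_post_exact fg).
- move=> i X' X X'' f g fg; exists (Ext_connect fg i N).
  by split; [exact: Ext_connect_exact1|exact: Ext_connect_exact2].
Qed.

Section Limit.
Variables (N : nat -> lmodType R) (p : forall k, {linear N k.+1 -> N k}).

Definition Ext_lim i X : lmodType R := dlim (fun k => Ext_map i (p k) X).

Lemma Ext_lim_post_ex i (X Y : lmodType R) (f : {linear X -> Y}) :
  exists h : {linear Ext_lim i X -> Ext_lim i Y}, dlim_maps (fun k => Ext_post i (N k) f) h.
Proof. by apply: dlim_map_ex => k e; rewrite Ext_map_post. Qed.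

Definition Ext_lim_post i (X Y : lmodType R) (f : {linear X -> Y}) :
    {linear Ext_lim i X -> Ext_lim i Y} :=
  sval (cid (Ext_lim_post_ex i f)).

Lemma Ext_lim_postP i (X Y : lmodType R) (f : {linear X -> Y}) :
  dlim_maps (fun k => Ext_post i (N k) f) (Ext_lim_post i f).
Proof. exact: svalP. Qed.

Definition Ext_lim_cohomological : cohomological Ext_lim.
Proof.
exists Ext_lim_post.
- move=> i X Y Z f g h hE t; have [e et] := dlim_rep_sur t.
  have et1 := Ext_lim_postP h et.
  have et2 := Ext_lim_postP g (Ext_lim_postP f et).
  apply/(dlim_rep_eq et1 et2); exists 0%N => m _; exact: Ext_post_comp.
- move=> i X f c fE t; have [e et] := dlim_rep_sur t.
  have et1 := Ext_lim_postP f et; have et2 := dlim_rep_scale c et.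
  apply/(dlim_rep_eq et1 et2); exists 0%N => m _.
  exact: (Ext_post_scale fE).
- move=> X' X X'' f g fg; apply: dlim_inj (Ext_lim_postP f) _ => k.
  exact: (Ext_post_inj0 fg).
- move=> i X' X X'' f g fg; apply: dlim_exact (Ext_lim_postP f) (Ext_lim_postP g) _ => k.
    by move=> e; rewrite Ext_map_post.
  exact: (Ext_post_exact fg).
- move=> i X' X X'' f g fg.
  have [|d dP] := @dlim_map_ex _ _ _ (fun k => Ext_map i (p k) X'')
    (fun k => Ext_map i.+1 (p k) X') (fun k => Ext_connect fg i (N k)).
    by move=> k e; rewrite Ext_map_connect.
  exists d; split.
    apply: dlim_exact (Ext_lim_postP g) dP _ => k.
      by move=> e; rewrite Ext_map_post.
    exact: Ext_connect_exact1.
  apply: dlim_exact dP (Ext_lim_postP f) _ => k.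
    by move=> e; rewrite Ext_map_connect.
  exact: Ext_connect_exact2.
Qed.
End Limit.

End ExtClasses.

(** * Ext in its first variable *)

Section FirstVariable.
Variable R : comNzRingType.
Implicit Types N K A B C P : lmodType R.

Lemma free_map_gen N N' (f : N -> N') v : free_map f << v >> = << f v >>.
Proof. exact: free_liftE. Qed.

Lemma free_map_ext N N' (f g : N -> N') : f =1 g -> free_map f =1 free_map g.
Proof. by move=> fg; apply: free_ext => v; rewrite !free_map_gen fg. Qed.

Lemma free_map_comp N N' N'' (f : N -> N') (g : N' -> N'') u :
  free_map g (free_map f u) = free_map (g \o f) u.
Proof.
apply: (@free_ext _ _ _ (free_map g \o free_map f)) => v.
by rewrite -[LHS]/(free_map g (free_map f << v >>)) !free_map_gen.
Qed.

Lemma free_map_id N (f : N -> N) : f =1 id -> free_map f =1 id.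
Proof.
move=> fE; apply: (@free_ext _ _ _ (free_map f) idfun) => v.
by rewrite free_map_gen fE.
Qed.

Lemma syz_mapS N N' (u : {linear N -> N'}) i z :
  val (syz_map u i.+1 z) = free_map (syz_map u i) (val z).
Proof. by []. Qed.

Lemma syz_map_ext N N' (u v : {linear N -> N'}) i : u =1 v -> syz_map u i =1 syz_map v i.
Proof.
move=> uv; elim: i => //= i IH z; apply: val_inj; rewrite !syz_mapS.
exact: free_map_ext.
Qed.

Lemma syz_map_comp N N' N'' (u : {linear N -> N'}) (v : {linear N' -> N''}) i z :
  syz_map (v \o u) i z = syz_map v i (syz_map u i z).
Proof.
elim: i z => //= i IH z; apply: val_inj; rewrite !syz_mapS free_map_comp.
exact: free_map_ext.
Qed.

Lemma syz_map_id N (u : {linear N -> N}) i : u =1 id -> syz_map u i =1 id.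
Proof.
move=> uE; elim: i => //= i IH z; apply: val_inj; rewrite syz_mapS.
exact: free_map_id.
Qed.

Lemma Ext_map_ext N N' K i (u v : {linear N -> N'}) (t : Ext i N' K) : u =1 v ->
  Ext_map i u K t = Ext_map i v K t.
Proof.
move=> uv; have [f <-] := ecl_sur t; rewrite !Ext_map_ecl; apply: ecl_ext => z /=.
by rewrite (syz_map_ext uv).
Qed.

Lemma Ext_map_comp N N' N'' K i (u : {linear N -> N'}) (v : {linear N' -> N''})
    (w : {linear N -> N''}) (t : Ext i N'' K) : (forall x, w x = v (u x)) ->
  Ext_map i w K t = Ext_map i u K (Ext_map i v K t).
Proof.
move=> wE; have [f <-] := ecl_sur t; rewrite !Ext_map_ecl; apply: ecl_ext => z /=.
by rewrite -syz_map_comp (@syz_map_ext _ _ w (v \o u)).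
Qed.

Lemma Ext_map_id N K i (u : {linear N -> N}) (t : Ext i N K) : u =1 id ->
  Ext_map i u K t = t.
Proof.
move=> uE; have [f <-] := ecl_sur t; rewrite !Ext_map_ecl; apply: ecl_ext => z /=.
by rewrite (syz_map_id uE).
Qed.

(** The recursion defining [syz] adds a syzygy at the far end of the resolution,
    whereas dimension shifting removes one at the near end: [tau] identifies
    [syz N i.+1] with the [i]-th syzygy of [syz N 1]. *)
Fixpoint tau N i : {linear syz N i.+1 -> syz (syz N 1) i} :=
  match i with
  | 0 => idfun
  | j.+1 => submod_map (@syz_map_subproof _ _ _ (tau N j))
  end.
Fixpoint tau_inv N i : {linear syz (syz N 1) i -> syz N i.+1} :=
  match i with
  | 0 => idfun
  | j.+1 => submod_map (@syz_map_subproof _ _ _ (tau_inv N j))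
  end.

Lemma tauS N i z : val (tau N i.+1 z) = free_map (tau N i) (val z).
Proof. by []. Qed.

Lemma tau_invS N i z : val (tau_inv N i.+1 z) = free_map (tau_inv N i) (val z).
Proof. by []. Qed.

Lemma tauK N i z : tau_inv N i (tau N i z) = z.
Proof.
elim: i z => // i IH z; apply: val_inj; rewrite tau_invS tauS free_map_comp.
exact: free_map_id.
Qed.

Lemma tau_invK N i z : tau N i (tau_inv N i z) = z.
Proof.
elim: i z => // i IH z; apply: val_inj; rewrite tauS tau_invS free_map_comp.
exact: free_map_id.
Qed.

Lemma tau_nat N N' (u : {linear N -> N'}) i z :
  syz_map (syz_map u 1) i (tau N i z) = tau N' i (syz_map u i.+1 z).
Proof.
elim: i z => // i IH z; apply: val_inj; 
rewrite -[LHS]/(free_map (syz_map (syz_map u 1) i) (free_map (tau N i) (val z))).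
rewrite -[RHS]/(free_map (tau N' i) (free_map (syz_map u i.+1) (val z))).
by rewrite !free_map_comp; apply: free_map_ext => w; exact: IH.
Qed.

End FirstVariable.

Section FirstVariable2.
Variable R : comNzRingType.
Implicit Types N K A B C P : lmodType R.

Definition projective P : Prop := exists s : {linear P -> free P}, forall p, aug P (s p) = p.

Lemma projective_free N : projective (free N).
Proof.
exists (free_lift (fun v => << << v >> >>)).
apply: (@free_ext _ _ _ (aug _ \o free_lift (fun v => << << v >> >>)) idfun) => v.
by rewrite -[LHS]/(aug _ (free_lift _ << v >>)) free_liftE aug_gen.
Qed.

Lemma projective_retraction P : projective P ->
  exists rho : {linear free P -> syz P 1}, forall z, rho (val z) = z.
Proof.
move=> [s sE]; have [|rho rhoE] := @corestrict _ _ _ (idfun \- (s \o aug P)) (ker (aug P)).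
  by move=> u; apply/mksubmodP; change (aug P (u - s (aug P u)) = 0); rewrite linearB sE subrr.
exists rho => z; apply: val_inj; rewrite -[LHS]/(submod_incl _ (rho (val z))) rhoE.
have /mksubmodP zK : val z \in ker (aug P) := submod_inclP z.
by change (val z - s (aug P (val z)) = val z); rewrite zK linear0 subr0.
Qed.

Lemma projective_syz P i : projective P -> projective (syz P i).
Proof.
move=> pP; elim: i => //= i [s sE].
have [rho rhoE] : exists rho : {linear free (syz P i) -> syz P i.+1}, forall z, rho (val z) = z.
  by apply: (@projective_retraction (syz P i)); exists s.
have [r rE] := projective_free (syz P i).
exists (free_map rho \o r \o submod_incl (ker (aug (syz P i)))) => z.
change (aug (syz P i.+1) (free_map rho (r (val z))) = z).
by rewrite aug_free_map rE rhoE.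
Qed.

Lemma Ext_projective0 P K i (t : Ext i.+1 P K) : projective P -> t = 0.
Proof.
move=> pP; have [f <-] := ecl_sur t; apply/ecl0.
have [rho rhoE] := projective_retraction (projective_syz i pP).
by exists (f \o rho) => z; rewrite /= rhoE.
Qed.

Lemma projective_lift P B C (p : {linear B -> C}) (f : {linear P -> C}) :
    projective P -> (forall c, exists b, p b = c) ->
  exists l : {linear P -> B}, forall x, p (l x) = f x.
Proof.
move=> [s sE] psur; have [g gE] := choice_ex (fun v : P => psur (f v)).
exists (free_lift g \o s) => x /=; rewrite -[in RHS](sE x).
apply: (@free_ext _ _ _ (p \o free_lift g) (f \o aug P)) => v.
rewrite -[LHS]/(p (free_lift g << v >>)) -[RHS]/(f (aug P << v >>)).
by rewrite free_liftE aug_gen gE.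
Qed.

Lemma shift_ex N K i : exists d : {linear Ext i (syz N 1) K -> Ext i.+1 N K},
  forall f, d (ecl f) = ecl (f \o tau N i).
Proof.
have [| | |d dP] := @linear_of_graph _ (Ext i (syz N 1) K) (Ext i.+1 N K)
  (fun t s => exists f, t = ecl f /\ s = ecl (f \o tau N i)).
- move=> a _ _ _ _ [f [-> ->]] [g [-> ->]]; exists (a \*: f \+ g).
  by split; symmetry; apply: ecl_lin.
- by move=> t; have [f <-] := ecl_sur t; exists (ecl (f \o tau N i)), f.
- move=> _ [f [/esym/ecl0 f0 ->]]; apply/ecl0; case: i f f0 => [|i] f /=.
    by move=> f0; exists (scaling 0 K \o free_lift (fun _ => 0)) => z;
       rewrite [LHS]f0 /= scale0r.
  by case=> h hE; exists (h \o free_map (tau N i)) => z; rewrite /= hE.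
by exists d => f; apply/dP; exists f.
Qed.

(** The connecting homomorphism, in the first variable, of the exact sequence
    [0 -> syz N 1 -> free N -> N -> 0]. *)
Definition shift N K i : {linear Ext i (syz N 1) K -> Ext i.+1 N K} :=
  sval (cid (shift_ex N K i)).

Lemma shift_ecl N K i f : shift N K i (ecl f) = ecl (f \o tau N i).
Proof. exact: (svalP (cid (shift_ex N K i))). Qed.

Lemma shift_sur N K i s : exists t, shift N K i t = s.
Proof.
have [f <-] := ecl_sur s; exists (ecl (f \o tau_inv N i)); rewrite shift_ecl.
by apply: ecl_ext => z /=; rewrite tauK.
Qed.

Lemma shift_nat N N' K i (u : {linear N -> N'}) t :
  Ext_map i.+1 u K (shift N' K i t) = shift N K i (Ext_map i (syz_map u 1) K t).
Proof.
have [f <-] := ecl_sur t; rewrite shift_ecl !Ext_map_ecl shift_ecl.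
by apply: ecl_ext => z; rewrite -[LHS]/(f _) -tau_nat.
Qed.

Definition syz_incl N : {linear syz N 1 -> free N} := submod_incl (ker (aug N)).

Lemma shift_incl N K i t : shift N K i (Ext_map i (syz_incl N) K t) = 0.
Proof.
case: i t => [|i] t; last first.
  by rewrite (Ext_projective0 t (projective_free N)) !linear0.
have [f <-] := ecl_sur t; rewrite Ext_map_ecl shift_ecl; apply/ecl0.
by exists f.
Qed.

Lemma shift_ker N K i t : shift N K i t = 0 -> exists s, t = Ext_map i (syz_incl N) K s.
Proof.
have [f <-] := ecl_sur t; rewrite shift_ecl => /ecl0; case: i f {t} => [|i] f [h hE].
  exists (@ecl _ (free N) K 0 h); rewrite Ext_map_ecl; apply: ecl_ext => z.
  exact: hE.
exists 0; rewrite linear0; apply/ecl0; exists (h \o free_map (tau_inv N i)) => z.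
rewrite -[RHS]/(h (val (tau_inv N i.+1 z))) -hE.
by rewrite -[RHS]/(f (tau N i.+1 (tau_inv N i.+1 z))) tau_invK.
Qed.

(** Although the resolution is not an additive functor of [N], [Ext] is: the defect
    of additivity on syzygies extends to the free module that contains them. *)
Lemma Ext_map_lin N N' K i a (f g h : {linear N -> N'}) (t : Ext i N' K) :
  (forall x, h x = a *: f x + g x) ->
  Ext_map i h K t = a *: Ext_map i f K t + Ext_map i g K t.
Proof.
elim: i N N' a f g h t => [|i IH] N N' a f g h t hE.
  have [k <-] := ecl_sur t; rewrite !Ext_map_ecl; apply: ecl_lin => z /=.
  by rewrite hE linearP.
have [w <-] := shift_sur t; rewrite !shift_nat.
have [|k kE] := @corestrict _ _ _
    (free_map h \- ((a \*: free_map f) \+ free_map g)) (ker (aug N')).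
  move=> u; apply/mksubmodP; 
  change (aug N' (free_map h u - (a *: free_map f u + free_map g u)) = 0).
  rewrite linearB linearD linearZ_LR !aug_free_map.
  by rewrite hE subrr.
pose m := syz_map g 1 \+ (k \o syz_incl N).
rewrite (IH _ _ a (syz_map f 1) m) => [|z]; last first.
  apply: submod_incl_inj; rewrite linearP [submod_incl _ (m z)]linearD kE /=.
  by rewrite [RHS]addrA [RHS]addrC subrK.
rewrite (IH _ _ 1 (k \o syz_incl N) (syz_map g 1) m) => [|z]; last first.
  by rewrite scale1r addrC.
rewrite !linearD !linearZ_LR (Ext_map_comp _ (u := syz_incl N) (v := k)) //.
by rewrite shift_incl scaler0 add0r.
Qed.

End FirstVariable2.

Section Connecting.
Variable R : comNzRingType.
Implicit Types N K A B C P Q L : lmodType R.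

(** [theta] is the map on kernels in a morphism to [A -> B -> C] from
    [syz C 1 -> free C -> C] which is the identity on [C]. *)
Definition connecting A B C (i : {linear A -> B}) (p : {linear B -> C})
    (theta : {linear syz C 1 -> A}) : Prop :=
  exists s : {linear free C -> B},
    (forall u, p (s u) = aug C u) /\ forall z, i (theta z) = s (syz_incl C z).

(** The connecting homomorphism of a short exact sequence [A -> B -> C] in the first
    variable, obtained from that of [syz C 1 -> free C -> C] by naturality. *)
Definition Ext_del A C n K (theta : {linear syz C 1 -> A}) (t : Ext n A K) : Ext n.+1 C K :=
  shift C K n (Ext_map n theta K t).

Lemma aug_syz_incl N z : aug N (syz_incl N z) = 0.
Proof. by have /mksubmodP := submod_inclP z. Qed.

Lemma Ext_map_compE N (N' N'' : lmodType R) K n (u : {linear N -> N'}) (v : {linear N' -> N''})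
    (t : Ext n N'' K) : Ext_map n u K (Ext_map n v K t) = Ext_map n (v \o u) K t.
Proof. by symmetry; exact: Ext_map_comp. Qed.

Lemma connecting_ex A B C (i : {linear A -> B}) (p : {linear B -> C}) :
  short_exact i p -> exists theta, connecting i p theta.
Proof.
move=> [iinj psur ip]; have [s sE] := projective_lift (aug C) (projective_free C) psur.
have [|theta thE] := factor_inj (f := s \o syz_incl C) iinj.
  by move=> z; apply/ip; rewrite /= sE aug_syz_incl.
by exists theta, s.
Qed.

(** Maps on [syz C 1] that extend to [free C] are killed by [shift], so that
    [Ext_del theta] only depends on the short exact sequence that [theta] comes from. *)
Lemma shift_congr C Q n K (f g : {linear syz C 1 -> Q}) (k : {linear free C -> Q}) t :
  (forall z, f z = g z + k (syz_incl C z)) ->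
  shift C K n (Ext_map n f K t) = shift C K n (Ext_map n g K t).
Proof.
move=> fE; rewrite (@Ext_map_lin _ _ _ _ _ 1 g (k \o syz_incl C) f) => [|z]; last first.
  by rewrite scale1r fE.
rewrite scale1r linearD (Ext_map_comp _ (u := syz_incl C) (v := k) (w := k \o syz_incl C)) //.
by rewrite shift_incl addr0.
Qed.

Lemma Ext_del_nat A B C (A' B' C' : lmodType R) (i : {linear A -> B}) (p : {linear B -> C})
    (i' : {linear A' -> B'}) (p' : {linear B' -> C'})
    (u : {linear A -> A'}) (v : {linear B -> B'}) (w : {linear C -> C'})
    theta theta' n K (t : Ext n A' K) :
    short_exact i' p' -> connecting i p theta -> connecting i' p' theta' ->
    (forall a, i' (u a) = v (i a)) -> (forall b, p' (v b) = w (p b)) ->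
  Ext_map n.+1 w K (Ext_del theta' t) = Ext_del theta (Ext_map n u K t).
Proof.
move=> [iinj' _ ip'] [s [sE thE]] [s' [sE' thE']] iu pv.
rewrite /Ext_del shift_nat -(Ext_map_comp _ (w := theta' \o syz_map w 1)) //.
rewrite -(Ext_map_comp _ (w := u \o theta)) //.
have [|k kE] := factor_inj (f := (s' \o free_map w) \- (v \o s)) iinj'.
  by move=> c; apply/ip'; rewrite linearB /= sE' aug_free_map pv sE subrr.
apply: (shift_congr (k := k)) => z; apply: iinj'.
rewrite linearD kE /= thE' iu thE.
by rewrite addrC subrK.
Qed.

Lemma Ext_del_comp0 A B C (i : {linear A -> B}) (p : {linear B -> C}) theta n K t :
  connecting i p theta -> Ext_del theta (Ext_map n i K t) = 0.
Proof.
move=> [s [sE thE]]; rewrite /Ext_del -(Ext_map_comp _ (w := s \o syz_incl C)).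
  by rewrite (Ext_map_comp _ (u := syz_incl C) (v := s) (w := s \o syz_incl C)) // shift_incl.
by move=> z; rewrite thE.
Qed.

Section ProjectiveMiddle.
Variables (A B C : lmodType R) (i : {linear A -> B}) (p : {linear B -> C}).
Variable theta : {linear syz C 1 -> A}.
Hypotheses (ses : short_exact i p) (pB : projective B) (conn : connecting i p theta).

(** As [B] is projective there is also a morphism from [A -> B -> C] back to
    [syz C 1 -> free C -> C]; on the kernels, both composites with [theta] differ
    from the identity by a map that extends to the middle term. *)
Lemma connecting_back : exists l : {linear B -> free C}, exists lA : {linear A -> syz C 1},
  exists k : {linear B -> A}, exists k' : {linear free C -> syz C 1},
  [/\ forall a, syz_incl C (lA a) = l (i a), forall a, theta (lA a) = a + k (i a)
    & forall z, lA (theta z) = z + k' (syz_incl C z)].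
Proof.
have [iinj psur ip] := ses; have [s [sE thE]] := conn.
have [l lE] := projective_lift p pB (@aug_sur R C); exists l.
have [|lA lAE] := @corestrict _ _ _ (l \o i) (ker (aug C)).
  by move=> a; apply/mksubmodP; change (aug C (l (i a)) = 0); rewrite lE; apply/ip; exists a.
exists lA; have [|k kE] := factor_inj (f := (s \o l) \- idfun) iinj.
  by move=> b; apply/ip; rewrite linearB /= sE lE subrr.
have [|k' kE'] := @corestrict _ _ _ ((l \o s) \- idfun) (ker (aug C)).
  move=> u; apply/mksubmodP; change (aug C (l (s u) - u) = 0).
  by rewrite linearB lE sE subrr.
exists k, k'; split=> [a|a|z]; first exact: lAE.
  apply: iinj; rewrite linearD kE thE.
  by rewrite -[syz_incl C (lA a)]/(submod_incl _ (lA a)) lAE /= addrC subrK.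
apply: submod_incl_inj; rewrite linearD lAE kE' /= thE.
by rewrite addrC subrK.
Qed.

Lemma Ext_del_sur n K (t : Ext n.+1 C K) : exists s, Ext_del theta s = t.
Proof.
have [l [lA [k [k' [lAE thlA lAth]]]]] := connecting_back.
have [w <-] := shift_sur t; exists (Ext_map n lA K w).
rewrite /Ext_del -(Ext_map_comp _ (w := lA \o theta)) //.
rewrite (shift_congr (g := idfun) (k := k')) => [|z]; last exact: lAth.
by rewrite Ext_map_id.
Qed.

Lemma Ext_del_ker n K (t : Ext n A K) : Ext_del theta t = 0 ->
  exists s, t = Ext_map n i K s.
Proof.
have [l [lA [k [k' [lAE thlA lAth]]]]] := connecting_back.
move=> /shift_ker[s sE].
exists (Ext_map n l K s - Ext_map n k K t).
rewrite linearB !Ext_map_compE.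
rewrite (Ext_map_comp _ (w := l \o i) (u := lA) (v := syz_incl C)) => [|a]; last first.
  by rewrite lAE.
rewrite -sE -(Ext_map_comp _ (w := theta \o lA)) //.
rewrite (@Ext_map_lin _ _ _ _ _ 1 idfun (k \o i) (theta \o lA)) => [|a]; last first.
  by rewrite scale1r /= thlA.
by rewrite scale1r addrK Ext_map_id.
Qed.
End ProjectiveMiddle.

Lemma short_exact_ker A B (p : {linear A -> B}) : (forall y, exists x, p x = y) ->
  short_exact (submod_incl (ker p)) p.
Proof.
move=> psur; split; [exact: (@submod_incl_inj R A (ker p))|by []|].
move=> y; split=> [py|[x <-]]; last by have /mksubmodP := submod_inclP x.
by apply: submod_incl_sur; apply/mksubmodP.
Qed.

Lemma projective_rV n : projective ('rV[R]_n : lmodType R).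
Proof.
have slin : linear (fun v : 'rV[R]_n =>
    \sum_j v 0 j *: (<< delta_mx 0 j >> : free ('rV[R]_n : lmodType R))).
  move=> a u v; rewrite scaler_sumr -big_split; apply: eq_bigr => j _.
  by rewrite !mxE scalerDl scalerA.
exists (mklinear slin) => v; rewrite [RHS]row_sum_delta.
  rewrite -[LHS]/(aug _ (\sum_j v 0 j *: << delta_mx 0 j >>)) linear_sum.
by apply: eq_bigr => j _; rewrite linearZ_LR aug_gen.
Qed.

Lemma fg_rV n : finitely_generated ('rV[R]_n : lmodType R).
Proof.
exists [seq delta_mx 0 j | j <- enum 'I_n] => v; rewrite [v]row_sum_delta.
apply: rpred_sum => j _; apply: rpredZ; apply: lspan_gen; apply: map_f; exact: mem_enum.
Qed.

Fact pair_inl_linear P (P' : lmodType R) : linear (fun x : P => (x, 0) : P * P')%type.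
Proof. by move=> a x y; rewrite -[RHS]/(a *: x + y, a *: 0 + 0) scaler0 addr0. Qed.
Fact pair_inr_linear P (P' : lmodType R) : linear (fun x : P' => (0, x) : P * P')%type.
Proof. by move=> a x y; rewrite -[RHS]/(a *: 0 + 0, a *: x + y) scaler0 addr0. Qed.

Definition pair_inl P (P' : lmodType R) : {linear P -> (P * P')%type} :=
  mklinear (@pair_inl_linear P P').
Definition pair_inr P (P' : lmodType R) : {linear P' -> (P * P')%type} :=
  mklinear (@pair_inr_linear P P').
Fact pair_fst_linear P (P' : lmodType R) : linear (fun x : P * P' => x.1)%type.
Proof. by []. Qed.
Fact pair_snd_linear P (P' : lmodType R) : linear (fun x : P * P' => x.2)%type.
Proof. by []. Qed.
Definition pair_fst P (P' : lmodType R) : {linear (P * P')%type -> P} :=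
  mklinear (@pair_fst_linear P P').
Definition pair_snd P (P' : lmodType R) : {linear (P * P')%type -> P'} :=
  mklinear (@pair_snd_linear P P').

Lemma projective_prod P (P' : lmodType R) : projective P -> projective P' ->
  projective (P * P' : lmodType R)%type.
Proof.
move=> [s sE] [s' sE'].
exists ((free_map (pair_inl P P') \o s \o pair_fst P P') \+
        (free_map (pair_inr P P') \o s' \o pair_snd P P')) => -[x y].
change (aug _ (free_map (pair_inl P P') (s x) + free_map (pair_inr P P') (s' y)) = (x, y)).
rewrite linearD !aug_free_map sE sE'; congr pair; [exact: addr0|exact: add0r].
Qed.

Lemma fg_prod P (P' : lmodType R) : finitely_generated P -> finitely_generated P' ->
  finitely_generated (P * P' : lmodType R)%type.
Proof.
move=> [s sP] [s' sP'].
exists (map (pair_inl P P') s ++ map (pair_inr P P') s') => -[x y].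
have -> : (x, y) = pair_inl P P' x + pair_inr P P' y :> (P * P')%type.
  by congr pair; rewrite ?addr0 ?add0r.
apply: rpredD.
  move: x (sP x); apply: lspan_seq_ind => [|x xs].
    exact: (submod_prop_preim (pair_inl P P') (submod_prop_mem _)).
  by apply: lspan_gen; rewrite /mkset mem_cat; apply/orP; left; exact: map_f.
move: y (sP' y); apply: lspan_seq_ind => [|y ys].
  exact: (submod_prop_preim (pair_inr P P') (submod_prop_mem _)).
by apply: lspan_gen; rewrite /mkset mem_cat; apply/orP; right; exact: map_f.
Qed.

Lemma fg_cover N : finitely_generated N ->
  exists n (p : {linear ('rV[R]_n : lmodType R) -> N}), forall x, exists u, p u = x.
Proof.
move=> [s sN]; have plin : linear (fun v : 'rV[R]_(size s) => \sum_j v 0 j *: s`_j).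
  move=> a u v; rewrite scaler_sumr -big_split; apply: eq_bigr => j _.
  by rewrite !mxE scalerDl scalerA.
exists (size s), (mklinear plin) => x; move: x (sN x); apply: lspan_seq_ind.
  split=> [|a u v [x <-] [y <-]]; first by exists 0; rewrite linear0.
  by exists (a *: x + y); rewrite linearP.
move=> x xs; have xi : (index x s < size s)%N by rewrite index_mem.
exists (delta_mx 0 (Ordinal xi)).
change (\sum_j (delta_mx 0 (Ordinal xi) : 'rV[R]_(size s)) 0 j *: s`_j = x).
rewrite (bigD1 (Ordinal xi)) //= mxE !eqxx scale1r nth_index // big1 ?addr0 // => j ji.
by rewrite mxE (negbTE ji) andbF scale0r.
Qed.

Lemma Ext0_eval N K (x : N) : exists e : {linear Ext 0 N K -> K},
  forall f, e (ecl f) = f x.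
Proof.
have [| | |e eP] := @linear_of_graph _ (Ext 0 N K) K
  (fun t y => exists f, t = ecl f /\ y = (f : N -> K) x).
- move=> a _ _ _ _ [f [-> ->]] [g [-> ->]].
  exists ((a \*: (f : {linear N -> K})) \+ (g : {linear N -> K})).
  by split=> //; symmetry; apply: ecl_lin.
- by move=> t; have [f <-] := ecl_sur t; exists ((f : N -> K) x), f.
- by move=> _ [f [/esym/ecl0 f0 ->]]; exact: f0.
by exists e => f; apply/eP; exists f.
Qed.

End Connecting.

(** * Ext of finitely generated modules *)

Section ExtFinite.
Variables (R : comNzRingType) (hR : noetherian R).
Implicit Types N K L F Z : lmodType R.

(** Induction on the support, by evaluation at one more point. *)
Lemma serre_ffun (MM : lmodType R -> Prop) (hMM : serre MM) (I : finType) K :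
  MM K -> MM ({ffun I -> K} : lmodType R).
Proof.
move=> MK; pose Fs (s : seq I) : set {ffun I -> K} := [set f | forall i, i \notin s -> f i = 0].
have Fsub s : submod_prop (Fs s).
  split=> [i _|a f g hf hg i si]; first by rewrite ffunE.
  by rewrite !ffunE hf // hg // scaler0 addr0.
have MF s : MM (submod (mksubmod (Fsub s))).
  elim: s => [|i s IH].
    apply: (serre0 hMM) => f; apply: submod_incl_inj; rewrite linear0.
    have /mksubmodP f0 := submod_inclP f; apply/ffunP => i.
    by rewrite [RHS]ffunE; apply: f0.
  have ev : linear (fun f : {ffun I -> K} => f i) by move=> a f g; rewrite !ffunE.
  apply: (serre_mid hMM (e := submod_incl (mksubmod (Fsub (i :: s))))
    (f := submod_incl (mksubmod (Fsub s)))
    (g := mklinear ev \o submod_incl (mksubmod (Fsub (i :: s)))) (h := idfun)) IH MK.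
  - exact: submod_incl_inj.
  - move=> f fi; apply: submod_incl_sur; apply/mksubmodP => j js.
    have /mksubmodP f0 := submod_inclP f.
    by have [->|ji] := eqVneq j i; [exact: fi | apply: f0; rewrite inE negb_or ji].
  - by move=> f; eexists.
apply: (serre_sur hMM (f := submod_incl (mksubmod (Fsub (enum I))))) (MF _) => f.
by apply: submod_incl_sur; apply/mksubmodP => i; rewrite mem_enum.
Qed.

(** [Ext 0 N K] embeds in a power of [K] by evaluation at generators of [N]; a free
    cover of [N] exhibits [Ext i.+1 N K] as a quotient of [Ext i] of its kernel. *)
Lemma Ext_MM (MM : lmodType R -> Prop) (hMM : serre MM) i N K :
  finitely_generated N -> MM K -> MM (Ext i N K).
Proof.
move=> fN MK; elim: i N fN => [|i IH] N fN; have [n [p psur]] := fg_cover fN.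
  have [ev evE] := choice_ex (fun j : 'I_n => Ext0_eval K (p (delta_mx 0 j))).
  have elin : linear (fun t => [ffun j => ev j t] : {ffun 'I_n -> K}).
    by move=> a t s; apply/ffunP => j; rewrite !ffunE linearP.
  apply: (serre_inj hMM (f := mklinear elin)) (serre_ffun hMM _ MK).
  apply: linear_inj => t; have [f <-] := ecl_sur t => /ffunP f0; apply/ecl0 => x.
  have [u <-] := psur x; rewrite [u]row_sum_delta !linear_sum big1 // => j _.
  by rewrite !linearZ_LR; have := f0 j; rewrite !ffunE evE => ->; rewrite scaler0.
have nF := fg_noeth hR (fg_rV R n).
have ses := short_exact_ker psur.
have [theta conn] := connecting_ex ses.
apply: (serre_sur hMM (f := shift N K i \o Ext_map i theta K)); last first.
  apply: IH; exact: noeth_sub.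
move=> t; have [s <-] := Ext_del_sur ses (projective_rV R n) conn t; by exists s.
Qed.

(** A weak form of the Artin-Rees lemma. Let [Q] be maximal among the submodules of
    [F] containing [p (I^m Z)] and meeting [p Z] in it. For [c] in [I], if [(Q : c^n)]
    is stationary at [n] then [Q + c^n F] has the same property as [Q], hence
    [c^n F] is contained in [Q]; so some [I^l F] is contained in [Q]. *)
Lemma weak_artin_rees (I : submodClosed R^o) Z F (p : {linear Z -> F}) m : noeth F ->
  exists l, forall z, p z \in smulmod (ideal_pow I l) F ->
    exists2 z1 : Z, z1 \in smulmod (ideal_pow I m) Z & p z = p z1.
Proof.
move=> nF; pose Fam (Q : set F) :=
  (forall z, z \in smulmod (ideal_pow I m) Z -> Q (p z)) /\
  (forall z, Q (p z) -> exists2 z1 : Z, z1 \in smulmod (ideal_pow I m) Z & p z = p z1).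
have [|Q [Qs [Qm Qp] Qmax]] := @noeth_maximal _ _ Fam nF.
  exists [set v | exists2 z : Z, z \in smulmod (ideal_pow I m) Z & p z = v].
    exact: submod_prop_im (submod_prop_mem _).
  by split=> [z zm|z [z1 z1m <-]]; [exists z|exists z1].
have [Q0 QL] := Qs.
have QZ c v : Q v -> Q (c *: v) by move=> Qv; rewrite -[c *: v]addr0; exact: QL.
have Jsub : submod_prop [set c : R^o | forall v, Q ((c : R) *: v)].
  split=> [v|a c d Qc Qd v]; first by rewrite scale0r.
  by rewrite scalerDl -scalerA; apply: QL.
have [c cI|l lP] := @nil_ideal_pow _ hR I (mksubmod Jsub).
  suff [n nQ] : exists n, forall v, Q (c ^+ n *: v) by exists n; apply/mksubmodP.
  pose col n : set F := [set v | Q (c ^+ n *: v)].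
  have colS n : submod_prop (col n) by exact: (submod_prop_preim (scaling (c ^+ n) F) Qs).
  have [|P [_ [n Pn] Pmax]] := @noeth_maximal _ _ (fun P => exists n, P = col n) nF.
    by exists (col 0%N) => //; exists 0%N.
  have stat v : Q (c ^+ (m + n) *: v) -> Q (c ^+ n *: v).
    move=> Qv; have := Pmax (col (m + n)%N) (colS _) (ex_intro _ _ erefl).
    rewrite Pn; apply => // w wn; rewrite /col /mkset exprD -scalerA; exact: QZ.
  exists n; pose Q' : set F := [set v | exists u q, Q q /\ v = c ^+ n *: u + q].
  suff : Q' `<=` Q.
    by move=> QQ v; apply: QQ; exists v, 0; rewrite addr0.
  have QQ' : Q `<=` Q' by move=> q Qq; exists 0, q; rewrite scaler0 add0r.
  apply: Qmax => //.
    split=> [|a _ _ [u [q [Qq ->]]] [u' [q' [Qq' ->]]]]; first exact: QQ'.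
    exists (a *: u + u'), (a *: q + q'); split; first exact: QL.
    by rewrite !scalerDr !scalerA addrACA mulrC.
  split=> [z zm|z [u [q [Qq pz]]]]; first exact/QQ'/Qm.
  apply: Qp; rewrite pz -[c ^+ n *: u]scale1r; apply: (QL) => //; apply: stat.
  have -> : c ^+ (m + n) *: u = c ^+ m *: p z + (- c ^+ m) *: q.
    by rewrite pz scalerDr scalerA exprD scaleNr addrK.
  rewrite addrC; apply: QL => //; rewrite -linearZ_LR; apply: Qm.
  by apply: smulmod_gen; exact: ideal_powX.
exists l => z zl; apply: Qp; move: (p z) zl; apply: smulmod_ind => // d v /lP.
by move/mksubmodP.
Qed.

Lemma free_in N F (g : {linear Defs.free N -> F}) (P : submodClosed F) :
  (forall v, g << v >> \in P) -> forall u, g u \in P.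
Proof.
move=> gP u; apply/qproj0.
have z0 : linear (fun _ : Defs.free N => 0 : quomod P) by move=> a x y; rewrite scaler0 addr0.
apply: (@free_ext _ _ _ (qproj P \o g) (mklinear z0)) => v.
exact/qproj0.
Qed.

End ExtFinite.

Section Vanishing.
Variables (R : comNzRingType) (hR : noetherian R) (a : submodClosed R^o).
Implicit Types N L F Z W Q : lmodType R.
Variables (K : lmodType R) (e : nat).
Hypothesis aK : killed_by_pow a e K.

Lemma killed_smulmod L (h : {linear L -> K}) u :
  u \in smulmod (ideal_pow a e) L -> h u = 0.
Proof.
move: u; apply: smulmod_ind => [|c u ce]; first exact: submod_prop_ker.
by rewrite linearZ_LR aK.
Qed.

Lemma connecting_aug N : connecting (syz_incl N) (aug N) idfun.
Proof. by exists idfun. Qed.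

(** A class on [L] vanishing on the submodule [W] vanishes on the submodules
    [W + a^l L] for large [l]. In degree [0] take [l = e]. A class of degree [j.+1]
    comes from one of degree [j] on [Z], the kernel of a surjection [F' x F'' -> L]
    that restricts to a surjection [F' -> W] with kernel [Z'], and that class can be
    chosen to vanish on [Z']. By Artin-Rees for the projection [Z -> F''], the
    elements of [Z] in [F' x a^l F''] lie in [Z' + a^m Z]. *)
Lemma Ext_vanish j L W (i : {linear W -> L}) (t : Ext j L K) :
    finitely_generated L -> finitely_generated W -> injective i ->
    Ext_map j i K t = 0 ->
  exists l, forall Q (k : {linear Q -> L}),
    (forall q, exists w u, u \in smulmod (ideal_pow a l) L /\ k q = i w + u) ->
    Ext_map j k K t = 0.
Proof.
elim: j L W i t => [|j IH] L W i t fL fW iinj it.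
  have [h hE] := ecl_sur t; exists e => Q k kE.
  rewrite -hE !Ext_map_ecl in it *; apply/ecl0 => q.
  have [w [u [ua qE]]] := kE q; rewrite -[LHS]/(h (k q)) qE linearD.
  by rewrite (killed_smulmod h ua) addr0; move/ecl0: it => /(_ w).
have [n' [p' p'sur]] := fg_cover fW; have [n'' [p'' p''sur]] := fg_cover fL.
pose F' : lmodType R := 'rV[R]_n'; pose F'' : lmodType R := 'rV[R]_n''.
pose F : lmodType R := (F' * F'')%type.
pose p : {linear F -> L} := (i \o p' \o pair_fst F' F'') \+ (p'' \o pair_snd F' F'').
have pE x y : p (x, y) = i (p' x) + p'' y by [].
have psur y : exists x, p x = y.
  by have [x <-] := p''sur y; exists (0, x); rewrite pE !linear0 add0r.
have fF : finitely_generated F by apply: fg_prod; exact: fg_rV.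
have nF := fg_noeth hR fF.
have pF : projective F by apply: projective_prod; exact: projective_rV.
have ses := short_exact_ker psur; have ses' := short_exact_ker p'sur.
have [theta conn] := connecting_ex ses; have [theta' conn'] := connecting_ex ses'.
have [|u uE] := @corestrict _ _ _ (pair_inl F' F'' \o submod_incl (ker p')) (ker p).
  move=> z; apply/mksubmodP; change (p (submod_incl (ker p') z, 0) = 0).
  by have /mksubmodP p'z := submod_inclP z; rewrite pE linear0 p'z linear0 addr0.
have [t1 t1E] := Ext_del_sur ses pF conn t.
have nat1 : Ext_map j.+1 i K (Ext_del theta t1) = Ext_del theta' (Ext_map j u K t1).
  apply: (Ext_del_nat (v := pair_inl F' F'') _ ses conn' conn) => // x.
  by rewrite -[LHS]/(p (x, 0)) pE linear0 addr0.
rewrite t1E it in nat1.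
have [s sE] := Ext_del_ker ses' (projective_rV R n') conn' (esym nat1).
(* [t1] restricts to [Z'] as a class [s] of [F'], extended to [F] by the projection. *)
pose t2 := t1 - Ext_map j (pair_fst F' F'' \o submod_incl (ker p)) K s.
have t2E : Ext_del theta t2 = t.
  rewrite /Ext_del !linearB -/(Ext_del theta t1) t1E -Ext_map_compE.
  by rewrite -/(Ext_del theta _) (Ext_del_comp0 _ conn) subr0.
have ut2 : Ext_map j u K t2 = 0.
  rewrite linearB sE Ext_map_compE; apply/eqP; rewrite subr_eq0; apply/eqP.
  apply: Ext_map_ext => z.
  by change (submod_incl (ker p') z = (submod_incl (ker p) (u z)).1); rewrite uE.
have fZ : finitely_generated (submod (ker p)) by exact: noeth_sub.
have fZ' : finitely_generated (submod (ker p')).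
  by apply: noeth_sub; apply: fg_noeth => //; exact: fg_rV.
have uinj : injective u.
  move=> x y xy; apply: submod_incl_inj.
  have : (submod_incl (ker p) (u x)).1 = (submod_incl (ker p) (u y)).1 by rewrite xy.
  by rewrite !uE.
have [m mP] := IH _ _ u t2 fZ fZ' uinj ut2.
have [l lP] := @weak_artin_rees _ hR a _ _ (pair_snd F' F'' \o submod_incl (ker p)) m
   (fg_noeth hR (fg_rV R n'')).
exists l => Q k kE.
(* The free cover of [Q] is mapped into [F' x a^l F'']. *)
have [v vE] : exists v : Q -> F, forall q,
    p (v q) = k q /\ (v q).2 \in smulmod (ideal_pow a l) F''.
  apply: (@choice_ex Q F (fun q v => p v = k q /\ v.2 \in smulmod (ideal_pow a l) F'')) => q.
  have [w [u' [u'l ->]]] := kE q; have [x <-] := p'sur w.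
  by have [y yl <-] := smulmod_map_sur p''sur u'l; exists (x, y).
pose V := free_lift v.
have VE x : p (V x) = k (aug Q x).
  apply: (@free_ext _ _ _ (p \o V) (k \o aug Q)) => q.
  rewrite -[LHS]/(p (free_lift v << q >>)) free_liftE (vE q).1.
  by rewrite -[RHS]/(k (aug Q << q >>)) aug_gen.
have Vl x : (V x).2 \in smulmod (ideal_pow a l) F''.
  apply: (@free_in _ _ _ (pair_snd F' F'' \o V)) => q.
  by rewrite -[X in X \in _]/((free_lift v << q >>).2) free_liftE; exact: (vE q).2.
have [|vz vzE] := @corestrict _ _ _ (V \o syz_incl Q) (ker p).
  move=> z; apply/mksubmodP; change (p (V (syz_incl Q z)) = 0).
  by rewrite VE aug_syz_incl linear0.
rewrite -t2E (Ext_del_nat (u := vz) (v := V) _ ses (connecting_aug Q) conn) //.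
rewrite mP; first by rewrite /Ext_del !linear0.
move=> z; have [|z1 z1m z1E] := lP (vz z).
  by rewrite -[X in X \in _]/((submod_incl (ker p) (vz z)).2) vzE; exact: Vl.
have z2 : (submod_incl (ker p) (vz z - z1)).2 = 0.
  rewrite -[LHS]/((pair_snd F' F'' \o submod_incl (ker p)) (vz z - z1)).
  by rewrite linearB z1E subrr.
have zK : p (submod_incl (ker p) (vz z - z1)) = 0.
  by have /mksubmodP := submod_inclP (vz z - z1).
case zxy: (submod_incl (ker p) (vz z - z1)) z2 zK => [x y] y0.
rewrite -[y]/((x, y).2) y0 pE linear0 addr0 => ix.
have [|w wE] := @submod_incl_sur _ _ (ker p') x.
  by apply/mksubmodP; apply: iinj; rewrite ix linear0.
exists w, z1; split=> //; apply: submod_incl_inj.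
have -> : vz z = (vz z - z1) + z1 by rewrite subrK.
rewrite linearD [RHS]linearD uE zxy -[y]/((x, y).2) y0; congr (_ + _).
by rewrite -[RHS]/(submod_incl (ker p') w, 0) wE.
Qed.

Variable M : lmodType R.
Hypothesis fM : finitely_generated M.

Let Mq k : {linear M -> pow_quo a M k} := qproj (smulmod (ideal_pow a k) M).

(** A class on [M/a^k M] vanishing on [M] vanishes on [M/a^m M] for large [m]. In
    positive degree, for a free cover [p] of [M], it comes from a class on the
    preimage of [a^k M] under [p], which can be chosen to vanish on the kernel of [p];
    [Ext_vanish] applies to it, as the preimage of [a^(k+l) M] is contained in the sum
    of [ker p] and [a^l] times the preimage of [a^k M]. *)
Lemma Ext_pow_quo_vanish i k (t : Ext i (pow_quo a M k) K) :
    Ext_map i (Mq k) K t = 0 ->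
  exists l, forall m (f : {linear pow_quo a M m -> pow_quo a M k}), (l <= m)%N ->
    (forall x, f (Mq m x) = Mq k x) -> Ext_map i f K t = 0.
Proof.
case: i t => [|j] t qt.
  have [h hE] := ecl_sur t; exists 0%N => m f _ fE.
  rewrite -hE !Ext_map_ecl in qt *; apply/ecl0 => y; move/ecl0: qt => qt.
  by have [x <-] := qproj_sur y; rewrite -[LHS]/(h (f (Mq m x))) fE; exact: qt.
have [n [p psur]] := fg_cover fM.
pose F : lmodType R := 'rV[R]_n.
have pF : projective F by exact: projective_rV.
have nF : noeth F by apply: fg_noeth => //; exact: fg_rV.
have qsur m y : exists x, (Mq m \o p) x = y.
  by have [z <-] := qproj_sur y; have [x <-] := psur z; exists x.
have ses m := short_exact_ker (qsur m); have sesM := short_exact_ker psur.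
have [theta conn] := connecting_ex (ses k); have [theta' conn'] := connecting_ex sesM.
have [|u uE] := @corestrict _ _ _ (submod_incl (ker p)) (ker (Mq k \o p)).
  move=> z; apply/mksubmodP; change (Mq k (p (submod_incl (ker p) z)) = 0).
  by have /mksubmodP pz := submod_inclP z; rewrite pz linear0.
have [t1 t1E] := Ext_del_sur (ses k) pF conn t.
have nat1 : Ext_map j.+1 (Mq k) K (Ext_del theta t1) = Ext_del theta' (Ext_map j u K t1).
  by apply: (Ext_del_nat (v := idfun) _ (ses k) conn' conn).
rewrite t1E qt in nat1.
have [s sE] := Ext_del_ker sesM pF conn' (esym nat1).
pose t2 := t1 - Ext_map j (submod_incl (ker (Mq k \o p))) K s.
have t2E : Ext_del theta t2 = t.
  rewrite /Ext_del !linearB -/(Ext_del theta t1) t1E.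
  by rewrite -/(Ext_del theta _) (Ext_del_comp0 _ conn) subr0.
have ut2 : Ext_map j u K t2 = 0.
  rewrite linearB sE Ext_map_compE; apply/eqP; rewrite subr_eq0; apply/eqP.
  apply: Ext_map_ext => z.
  by change (submod_incl (ker p) z = submod_incl (ker (Mq k \o p)) (u z)); rewrite uE.
have fZ (N : submodClosed F) : finitely_generated (submod N) by exact: noeth_sub.
have uinj : injective u.
  move=> x y xy; apply: submod_incl_inj; rewrite -!uE xy; reflexivity.
have [l lP] := Ext_vanish (fZ _) (fZ _) uinj ut2.
exists (k + l)%N => m f klm fE.
have [theta'' conn''] := connecting_ex (ses m).
have [|w wE] := @corestrict _ _ _ (submod_incl (ker (Mq m \o p))) (ker (Mq k \o p)).
  move=> z; apply/mksubmodP; change (Mq k (p (submod_incl (ker (Mq m \o p)) z)) = 0).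
  have /mksubmodP pz := submod_inclP z; rewrite -fE.
  by rewrite -[X in f X]/((Mq m \o p) (submod_incl (ker (Mq m \o p)) z)) pz linear0.
rewrite -t2E (Ext_del_nat (u := w) (v := idfun) _ (ses k) conn'' conn) //;
  last by move=> x; exact: (esym (fE (p x))).
rewrite lP; first by rewrite /Ext_del !linear0.
move=> z.
have pz : p (submod_incl _ z) \in smulmod (ideal_pow a (k + l)) M.
  have /mksubmodP/qproj0 := submod_inclP z; apply: smulmodS => c; exact: ideal_powW.
have [y yl yE] := smulmod_pow_add pz.
pose N := smulmod (ideal_pow a k) M.
have [|r rE] := @corestrict _ _ _ (p \o submod_incl (ker (Mq k \o p))) N.
  by move=> v; have /mksubmodP/qproj0 := submod_inclP v.
have [|x xl xE] := @smulmod_map_sur _ _ _ r (ideal_pow a l) _ y yl.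
  move=> v; have [b bE] := psur (submod_incl N v).
  have [|b' b'E] := @submod_incl_sur _ _ (ker (Mq k \o p)) b.
    by apply/mksubmodP; change (Mq k (p b) = 0); rewrite bE; apply/qproj0/submod_inclP.
  by exists b'; apply: submod_incl_inj; rewrite rE -[LHS]/(p (submod_incl _ b')) b'E.
have [|v vE] := @submod_incl_sur _ _ (ker p) (submod_incl _ (w z - x)).
  apply/mksubmodP; change (p (submod_incl (ker (Mq k \o p)) (w z - x)) = 0).
  rewrite [submod_incl _ _]linearB [LHS]linearB wE -yE -xE rE; exact: subrr.
exists v, x; split=> //; apply: submod_incl_inj.
by rewrite linearD uE vE -linearD subrK.
Qed.

End Vanishing.

(** * Ext and local cohomology over an ideal *)

Section HomToPrime.
Variable R : comNzRingType.
Implicit Types M X : lmodType R.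

(** Induction on the number of generators: if no multiple [c m0] with [c v <> 0] of
    the last generator [m0] lies in the submodule spanned by the others, map [m0] to
    [v] and the others to [0]; else compose multiplication by such a [c] with a
    map defined on that submodule. *)
Lemma hom_to_prime M X (v : X) : finitely_generated M -> prime_ann v ->
    (forall c, (forall m : M, c *: m = 0) -> c *: v = 0) ->
  exists h : {linear M -> X}, (exists m, h m <> 0) /\ forall m, exists c, h m = c *: v.
Proof.
move=> [s]; move: {2}(size s) (erefl (size s)) => n.
elim: n M s => [|n IH] M [|m0 s] // sn sM [v0 vprime] Mv; last case: sn => sn.
  case: v0; rewrite -[v]scale1r; apply: Mv => m; rewrite scale1r.
  move: m (sM m); apply: lspan_seq_ind => //.
  by split=> // a u w -> ->; rewrite scaler0 addr0.
pose M' := lspan [set` s].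
have [[c [cM' cv]]|ncv] := pselect (exists c, c *: m0 \in M' /\ c *: v <> 0); last first.
  have [| | |h hP] := @linear_of_graph _ M X
    (fun x y => exists c w, [/\ w \in M', x = c *: m0 + w & y = c *: v]).
  - move=> a _ _ _ _ [c [w [wM' -> ->]]] [c' [w' [wM'' -> ->]]].
    exists (a * c + c'), (a *: w + w'); split; first exact: mem_lin.
      by rewrite scalerDr scalerDl !scalerA addrACA.
    by rewrite scalerDl scalerA.
  - by move=> x; have [c [w [wM' ->]]] := lspan_cons (sM x); exists (c *: v), c, w.
  - move=> _ [c [w [wM' cw ->]]]; apply: contrapT => cv; apply: ncv; exists c.
    split=> //; have -> : c *: m0 = 0 - w by rewrite cw addrK.
    by apply: submod_rpredB => //; exact: mem0.
  exists h; split; last first.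
    by move=> m; have [c [w [_ _ hm]]] := (hP m (h m)).2 erefl; exists c.
  exists m0; have -> : h m0 = v; last exact: v0.
  by apply/hP; exists 1, 0; split; rewrite ?mem0 // !scale1r ?addr0.
have [|h' h'E] := @corestrict _ _ _ (scaling c M) M'.
  move=> x; have [d [w [wM' ->]]] := lspan_cons (sM x).
  change (c *: (d *: m0 + w) \in M').
  rewrite scalerDr scalerA mulrC -scalerA; apply: mem_lin => //.
  exact: rpredZ.
have [t tE tM'] := lspan_lift (N := M') (s := s) (@lspan_gen _ _ _) (fun _ => id).
have [|d dM'|h [[m hm] hv]] := IH _ t _ tM' (conj v0 vprime).
- by rewrite -sn -tE size_map.
- have [|//|//] := vprime d c; apply: Mv => m.
  by rewrite -scalerA; have := congr1 (submod_incl M') (dM' (h' m));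
     rewrite linearZ_LR linear0 h'E.
exists (h \o h'); split=> [|x]; last exact: hv.
exists (submod_incl M' m) => hm0.
have h'm : h' (submod_incl M' m) = c *: m.
  by apply: submod_incl_inj; rewrite h'E linearZ_LR.
have [e eE] := hv m; apply: hm; move: hm0.
rewrite /= h'm linearZ_LR eE scalerA => /vprime[//|->//].
Qed.
End HomToPrime.

Section Pairs.
Variables (R : comNzRingType) (hR : noetherian R) (a : submodClosed R^o).
Variables (M : lmodType R) (fM : finitely_generated M).
Implicit Types K N X : lmodType R.

Let b : submodClosed R^o := ideal_add a (annihilator M).

Lemma ideal_addl (c : R) : c \in a -> c \in b.
Proof.
move=> ca; apply/(mksubmodP (ideal_add_prop a (annihilator M))); exists c, 0.
split=> //; last by rewrite addr0.
by apply/mksubmodP => v; rewrite scale0r.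
Qed.

Lemma ideal_addr (c : R) : (forall m : M, c *: m = 0) -> c \in b.
Proof.
move=> cM; apply/(mksubmodP (ideal_add_prop a (annihilator M))); exists 0, c.
split; last by rewrite add0r.
  exact: mem0.
exact/mksubmodP.
Qed.

Lemma ideal_addP (c : R) : c \in b ->
  exists u w : R, [/\ u \in a, forall m : M, w *: m = 0 & c = u + w].
Proof.
move=> /(mksubmodP (ideal_add_prop a (annihilator M)))[u [w [ua /mksubmodP wM ->]]].
by exists u, w.
Qed.

(** Multiplication by [c] on [N] is the zero map, and [Ext_map] is linear in the map. *)
Lemma Ext_killed i N K (c : R) : (forall n : N, c *: n = 0) ->
  forall t : Ext i N K, c *: t = 0.
Proof.
move=> cN t.
have : Ext_map i (scaling 0 N) K t = c *: Ext_map i idfun K t + Ext_map i (scaling 0 N) K t.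
  by apply: Ext_map_lin => x; rewrite [c *: _]cN add0r.
rewrite (@Ext_map_id _ _ _ _ idfun t (fun=> erefl)) => /eqP.
by rewrite -[X in X == _]add0r (inj_eq (addIr _)) => /eqP.
Qed.

Lemma ideal_add_pow_killed k (c : R) (m : M) :
  c \in ideal_pow b k -> c *: m \in smulmod (ideal_pow a k) M.
Proof.
elim: k c => [|k IH] c.
  by move=> _; apply: smulmod_gen; exact: ideal_pow0.
move: c; apply: ideal_powS_ind => [|c d /ideal_addP[u [w [ua wM ->]]] dk].
  split=> [|e c d cm dm]; first by rewrite /mkset scale0r mem0.
  by rewrite /mkset scalerDl -scalerA; exact: mem_lin.
rewrite /mkset -scalerA scalerDl wM addr0.
move: (d *: m) (IH d dk); apply: smulmod_ind => [|f x fk].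
  exact: (submod_prop_preim (scaling u _) (submod_prop_mem _)).
by rewrite scalerA; apply: smulmod_gen; exact: ideal_powE.
Qed.

Lemma pow_quo_killed k (c : R) : c \in ideal_pow b k -> forall n : pow_quo a M k, c *: n = 0.
Proof.
move=> ck n; have [m <-] := qproj_sur n; rewrite -linearZ_LR; apply/qproj0.
exact: ideal_add_pow_killed.
Qed.

Lemma quo_killed (c : R) : c \in b ->
  forall n : (quomod (smulmod a M) : lmodType R), c *: n = 0.
Proof.
move=> /ideal_addP[u [w [ua wM ->]]] n; have [m <-] := qproj_sur n.
rewrite -linearZ_LR; apply/qproj0; rewrite scalerDl wM addr0.
exact: smulmod_gen.
Qed.

Lemma Ext_torsion i X : torsion b (Ext i (quomod (smulmod a M)) X).
Proof.
move=> t; exists 1%N => c /ideal_pow1 cb; apply: Ext_killed; exact: quo_killed.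
Qed.

Let T i X := Ext_lim (pow_quo_map a M) i X.

Lemma pow_quo_mapE k m :
  pow_quo_map a M k (qproj (smulmod (ideal_pow a k.+1) M) m)
    = qproj (smulmod (ideal_pow a k) M) m.
Proof. exact: (quomod_funE (@pow_quo_subproof _ a M k)). Qed.

Lemma Ext_lim_torsion i X : torsion b (T i X).
Proof.
move=> t; have [f ft] := dlim_rep_sur t; have [n fn] := dlim_rep_thread ft.
exists n => c cn; apply: (dlim_rep0 (dlim_rep_scale (c : R) ft)).2; exists n => m nm.
change (c *: f m = 0); rewrite -(subnK nm); elim: (m - n)%N => [|k IH].
  by apply: Ext_killed; exact: pow_quo_killed.
by rewrite addSn fn ?leq_addl // -linearZ_LR IH linear0.
Qed.

(** The limit embeds in [Ext i M K], by [Ext_pow_quo_vanish]. *)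
Lemma Ext_lim_killed (MM : lmodType R -> Prop) (hMM : serre MM) i n K :
  MM K -> killed_by_pow b n K -> MM (T i K).
Proof.
move=> MK bK; have aK : killed_by_pow a n K.
  by move=> c v cn; apply: bK; apply: ideal_pow_subset cn; exact: ideal_addl.
pose q k : {linear M -> pow_quo a M k} := qproj (smulmod (ideal_pow a k) M).
have [|h hE] := @dlim_out _ _ (fun k => Ext_map i (pow_quo_map a M k) K) _
    (fun k => Ext_map i (q k) K).
  by move=> k t; rewrite Ext_map_compE; apply: Ext_map_ext => x; exact: pow_quo_mapE.
apply: (serre_inj hMM (f := h)) (Ext_MM hR hMM i fM MK).
apply: linear_inj => t ht; have [f ft] := dlim_rep_sur t.
have [n0 fn0] := dlim_rep_thread ft; have [n1 hn1] := hE f t ft.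
apply/(dlim_rep0 ft); pose k := maxn n0 n1.
have [|l lP] := Ext_pow_quo_vanish hR aK fM (t := f k).
  by rewrite -hn1 ?leq_maxr.
have trans m : (k <= m)%N -> exists g : {linear pow_quo a M m -> pow_quo a M k},
    (forall x, g (q m x) = q k x) /\ f m = Ext_map i g K (f k).
  move=> /subnK <-; elim: (m - k)%N => {m} [|m [g [gE fE]]].
    by exists idfun; rewrite Ext_map_id.
  exists (g \o pow_quo_map a M (m + k)); split.
    by move=> x; rewrite -(gE x); congr (g _); exact: pow_quo_mapE.
  rewrite -Ext_map_compE -fE; apply: (fn0 (m + k)%N).
  by rewrite (leq_trans (leq_maxl n0 n1)) ?leq_addl.
exists (l + k)%N => m lkm; have km : (k <= m)%N by apply: leq_trans lkm; rewrite leq_addl.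
have [g [gE ->]] := trans m km.
by apply: lP gE; apply: leq_trans lkm; rewrite leq_addr.
Qed.

Section NonZero.
Variables (X : lmodType R) (v : X).
Hypotheses (vprime : prime_ann v) (bv : forall c, c \in b -> c *: v = 0).

Lemma hom_quo_neq0 (I : submodClosed R^o) : {subset I <= a} ->
  exists h : {linear quomod (smulmod I M) -> X}, exists m, h (qproj _ m) <> 0.
Proof.
move=> Ia; have [|h [[m hm] hv]] := hom_to_prime fM vprime.
  by move=> c cM; apply: bv; exact: ideal_addr.
have [||g gE] := @factor_sur _ _ _ _ (qproj (smulmod I M)) h; first exact: qproj_sur.
  move=> x /qproj0; move: x; apply: smulmod_ind => [|c x cI]; first exact: submod_prop_ker.
  rewrite linearZ_LR; have [d ->] := hv x; rewrite scalerA mulrC -scalerA bv ?scaler0 //.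
  by apply: ideal_addl; apply: Ia.
by exists g, m; rewrite gE.
Qed.

Lemma Ext0_neq0 : exists h : {linear Ext 0 (quomod (smulmod a M)) X -> X}, exists t, h t <> 0.
Proof.
have [|g [m gm]] := @hom_quo_neq0 a; first by [].
have [e eE] := Ext0_eval X (qproj (smulmod a M) m).
by exists e, (ecl (g : {linear syz (quomod (smulmod a M)) 0 -> X})); rewrite eE.
Qed.

Lemma Ext_lim0_neq0 : exists h : {linear T 0 X -> X}, exists t, h t <> 0.
Proof.
have [|g [m gm]] := @hom_quo_neq0 (ideal_pow a 1); first by move=> c /ideal_pow1.
pose ev k := cid (@Ext0_eval _ (pow_quo a M k) X (qproj (smulmod (ideal_pow a k) M) m)).
pose e k := sval (ev k); have eE k f : e k (ecl f) = f (qproj _ m) := svalP (ev k) f.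
have epow k t : e k.+1 (Ext_map 0 (pow_quo_map a M k) X t) = e k t.
  have [f <-] := ecl_sur t; rewrite Ext_map_ecl !eE.
  by rewrite -[LHS]/((f : pow_quo a M k -> X) (pow_quo_map a M k (qproj _ m))) pow_quo_mapE.
have [h hE] := dlim_out epow.
have [f [t [f1 ft trep]]] := dlim_at (fun k => Ext_map 0 (pow_quo_map a M k) X)
   (k := 1) (ecl (g : {linear syz (pow_quo a M 1) 0 -> X})).
exists h, t; have [n nP] := hE f t trep; rewrite (nP (n + 1)%N) ?leq_addr //.
have -> : e (n + 1)%N (f (n + 1)%N) = e 1%N (f 1%N).
  elim: n {nP} => [|n IH]; first exact: erefl.
  rewrite -IH -(epow (n + 1)%N); exact: (congr1 (e (n + 1).+1) (ft _ (leq_addl n 1))).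
by rewrite f1 eE.
Qed.
End NonZero.
End Pairs.

(** * Koszul cohomology *)

Section KoszulFunctor.
Variables (R : comNzRingType) (r : nat) (x : r.-tuple R).
Implicit Types (X Y Z : lmodType R) (S : {set 'I_r}).

Local Notation kcochain X := {ffun {set 'I_r} -> X}.
Local Notation kcx X := (koszul_complex x X).

Lemma kcochainP X n (f : kcx X n) (S : {set 'I_r}) :
  #|S| != n -> (submod_incl _ f : kcochain X) S = 0.
Proof. by have /mksubmodP := submod_inclP f; apply. Qed.

Lemma kcochain_sur X n (f : kcochain X) : (forall S : {set 'I_r}, #|S| != n -> f S = 0) ->
  exists g : kcx X n, submod_incl _ g = f.
Proof. by move=> fn; apply: submod_incl_sur; exact/mksubmodP. Qed.

Lemma kdiffE X n (f : kcx X n) S :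
  (submod_incl _ (cdiff (kcx X) n f) : kcochain X) S =
  \sum_(j in S) koszul_coef x S j *: (submod_incl _ f : kcochain X) (S :\ j).
Proof. by rewrite -[LHS]/(koszul_diff_fun x (val f) S) ffunE. Qed.

Fact kmap_fun_linear X Y (h : {linear X -> Y}) :
  linear (fun f : kcochain X => [ffun S => h (f S)] : kcochain Y).
Proof. by move=> a f g; apply/ffunP => S; rewrite !ffunE linearP. Qed.

Fact kmap_subproof X Y (h : {linear X -> Y}) n f :
  f \in mksubmod (@koszul_prop R r X n) ->
  mklinear (kmap_fun_linear h) f \in mksubmod (@koszul_prop R r Y n).
Proof.
by move=> /mksubmodP fn; apply/mksubmodP => S Sn; rewrite ffunE fn // linear0.
Qed.
Definition kmap X Y (h : {linear X -> Y}) n : {linear kcx X n -> kcx Y n} :=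
  submod_map (@kmap_subproof X Y h n).

Lemma kmapE X Y (h : {linear X -> Y}) n (f : kcx X n) S :
  (submod_incl _ (kmap h n f) : kcochain Y) S = h ((submod_incl _ f : kcochain X) S).
Proof. exact: ffunE. Qed.

Lemma kcochain_ext X n (f g : kcx X n) :
  (forall S, (submod_incl _ f : kcochain X) S = (submod_incl _ g : kcochain X) S) -> f = g.
Proof. by move=> fg; apply: submod_incl_inj; apply/ffunP. Qed.

Lemma kmap_cochain X Y (h : {linear X -> Y}) : cochain_map (kmap h).
Proof.
move=> n f; apply: kcochain_ext => S; rewrite kmapE !kdiffE linear_sum.
by apply: eq_bigr => j _; rewrite linearZ_LR kmapE.
Qed.

Lemma kmap_short_exact X Y Z (f : {linear X -> Y}) (g : {linear Y -> Z}) :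
  short_exact f g -> forall n, short_exact (kmap f n) (kmap g n).
Proof.
move=> [finj gsur gf] n; split.
- move=> u v uv; apply: kcochain_ext => S; apply: finj.
  by rewrite -!kmapE uv.
- have [s sE] := choice_ex gsur; move=> w.
  pose c : kcochain Y := [ffun S : {set 'I_r} =>
    if #|S| == n then s ((submod_incl _ w : kcochain Z) S) else 0].
  have [|c' c'E] := @kcochain_sur Y n c.
    by move=> S Sn; rewrite ffunE (negbTE Sn).
  exists c'; apply: kcochain_ext => S; rewrite kmapE c'E ffunE.
  by case: ifP => [_|/negbT Sn]; rewrite ?sE // linear0 kcochainP.
- move=> u; split=> [gu|[w <-]].
    have ex S : exists z, f z = (submod_incl _ u : kcochain Y) S.
      by apply/gf; rewrite -kmapE gu linear0 ffunE.
    have [s sE] := choice_ex ex; have [|c cE] := @kcochain_sur X n [ffun S => s S].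
      by move=> S Sn; apply: finj; rewrite ffunE sE linear0 kcochainP.
    by exists c; apply: kcochain_ext => S; rewrite kmapE cE ffunE sE.
  apply: kcochain_ext => S; rewrite !kmapE linear0 ffunE.
  by apply/gf; eexists.
Qed.

Definition koszul_cohomological : cohomological (fun i X => koszul_cohomology x X i).
Proof.
exists (fun i X Y h => cohomology_map (kmap_cochain h) i).
- move=> i X Y Z f g h hE; apply: cohomology_map_comp => u.
  by apply: kcochain_ext => S; rewrite !kmapE hE.
- move=> i X f c fE; apply: cohomology_map_scale => u.
  by apply: kcochain_ext => S; rewrite kmapE fE linearZ_LR ffunE.
- move=> X' X X'' f g fg.
  exact: (@cohomology_inj0 _ (kcx X') (kcx X) (kcx X'') (kmap f) (kmap g)
    (kmap_cochain f) (kmap_short_exact fg)).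
- move=> i X' X X'' f g fg.
  exact: (cohomology_exact (kmap_cochain f) (kmap_cochain g) (kmap_short_exact fg)).
- move=> i X' X X'' f g fg.
  have [d [_ ex1 ex2]] :=
    cohomology_connect (kmap_cochain f) (kmap_cochain g) (kmap_short_exact fg) i.
  by exists d.
Qed.

Definition ksign (S : {set 'I_r}) (j : 'I_r) : R := (-1) ^+ #|[set k in S | (k < j)%N]|.

Lemma ksignU (S : {set 'I_r}) i j : i \notin S ->
  ksign (i |: S) j = (if (i < j)%N then -1 else 1) * ksign S j.
Proof.
move=> iS; rewrite /ksign; case: ifP => ij.
  have -> : [set k in i |: S | (k < j)%N] = i |: [set k in S | (k < j)%N].
    by apply/setP => k; rewrite !inE; case: eqP => [->|//]; rewrite ij.
  by rewrite cardsU1 inE (negbTE iS) exprD expr1.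
have -> : [set k in i |: S | (k < j)%N] = [set k in S | (k < j)%N].
  by apply/setP => k; rewrite !inE; case: eqP => [->|//]; rewrite ij !andbF.
by rewrite mul1r.
Qed.

Lemma ksignK S j : ksign S j * ksign S j = 1.
Proof. by rewrite -exprD addnn -mul2n exprM sqrrN expr1n expr1n. Qed.

Section Homotopy.
Variables (X : lmodType R) (j : 'I_r).

(** The homotopy from multiplication by [x_j] to zero: the dual of exterior
    multiplication by the basis vector [e_j]. *)
Definition khomotopy (f : kcochain X) : kcochain X :=
  [ffun S : {set 'I_r} => if j \in S then 0 else ksign S j *: f (j |: S)].

Lemma khomotopyE (f : kcochain X) S :
  koszul_diff_fun x (khomotopy f) S + khomotopy (koszul_diff_fun x f) S = tnth x j *: f S.
Proof.
rewrite !ffunE; case: (boolP (j \in S)) => jS.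
  rewrite addr0 (bigD1 j) //= big1 => [|i /andP[iS ij]]; last first.
    by rewrite ffunE !inE jS eq_sym ij scaler0.
  rewrite addr0 ffunE setD11 finset.setD1K // scalerA; congr (_ *: _).
  have -> : ksign (S :\ j) j = ksign S j.
    by rewrite -[in RHS](finset.setD1K jS) ksignU ?setD11 // ltnn mul1r.
  by rewrite mulrAC ksignK mul1r.
have -> : \sum_(i in j |: S) koszul_coef x (j |: S) i *: f ((j |: S) :\ i) =
    (ksign S j * tnth x j) *: f S
      + \sum_(i in S) koszul_coef x (j |: S) i *: f (j |: (S :\ i)).
  rewrite (bigD1 j) ?setU11 //= finset.setU1K //; congr (_ *: _ + _).
    by rewrite /koszul_coef -/(ksign _ _) ksignU // ltnn mul1r.
  apply: eq_big => [i|i /andP[_ ij]].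
    by rewrite !inE; case: eqP => [->|]; rewrite ?andbT // (negbTE jS).
  congr (_ *: f _); apply/setP => k; rewrite !inE.
  by case: eqP => [->|] //=; rewrite (negbTE ij).
rewrite scalerDr scalerA mulrA ksignK mul1r addrCA -[RHS]addr0; congr (_ + _).
rewrite scaler_sumr -big_split big1 // => i iS /=.
have ij : i != j by apply: contraNneq jS => <-.
rewrite ffunE !inE (negbTE jS) andbF !scalerA.
have -> : koszul_coef x S i * ksign (S :\ i) j = - (ksign S j * koszul_coef x (j |: S) i).
  rewrite /koszul_coef -!/(ksign _ _) ksignU // -[in RHS](finset.setD1K iS).
  have -> : ksign (i |: S :\ i) j = (if (i < j)%N then -1 else 1) * ksign (S :\ i) j.
    by rewrite ksignU ?setD11.
  rewrite finset.setD1K //; move: (ksign S i) (ksign (S :\ i) j) (tnth x i) => p q y.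
  case: (ltngtP i j) => [_|_|/val_inj/eqP]; last by rewrite (negbTE ij).
    by rewrite !mul1r !mulN1r mulNr opprK mulrC.
  by rewrite mul1r !mulN1r mulNr mulrN opprK mulrC.
by rewrite -scalerDl addNr scale0r.
Qed.

Lemma khomotopy_degree n (f : kcx X n.+1) : exists g : kcx X n,
  submod_incl _ g = khomotopy (submod_incl _ f).
Proof.
apply: kcochain_sur => S Sn; rewrite ffunE; case: ifP => // /negbT jS.
by rewrite kcochainP ?scaler0 // cardsU1 jS.
Qed.

Lemma koszul_cohomology_killed1 n (t : koszul_cohomology x X n) : tnth x j *: t = 0.
Proof.
have [z <-] := hcl_sur t; rewrite -linearZ_LR; apply/hcl0.
have zE S : (submod_incl _ (submod_incl _ (tnth x j *: z)) : kcochain X) S =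
   koszul_diff_fun x (khomotopy (submod_incl _ (submod_incl _ z))) S.
  have := khomotopyE (submod_incl _ (submod_incl _ z)) S.
  have -> : koszul_diff_fun x (submod_incl _ (submod_incl _ z)) = 0.
    exact: (congr1 (submod_incl _) (cocycleP z)).
  have -> : khomotopy 0 S = 0.
    by rewrite ffunE; case: ifP => // _; rewrite ffunE scaler0.
  by rewrite addr0 => ->; rewrite !linearZ_LR; exact: ffunE.
case: n z zE {t} => [|n] z zE.
  change (submod_incl _ (tnth x j *: z) = 0); apply: kcochain_ext => S; rewrite zE linear0.
  rewrite [RHS]ffunE ffunE big1 // => i iS; rewrite ffunE; case: ifP => [_|/negbT ji].
    by rewrite scaler0.
  by rewrite kcochainP ?scaler0 // cardsU1 ji.
have [g gE] := khomotopy_degree (submod_incl _ z).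
exists g; apply: kcochain_ext => S; rewrite zE -gE; reflexivity.
Qed.
End Homotopy.

Lemma koszul_cohomology_killed X n c : c \in lspan [set` (x : seq R^o)] ->
  forall t : koszul_cohomology x X n, c *: t = 0.
Proof.
move=> cx t; move: c cx; apply: lspan_seq_ind => [|c /tnthP[j ->]].
  split=> [|a c d ct dt]; first exact: scale0r.
  by rewrite /mkset scalerDl -scalerA ct dt scaler0 addr0.
exact: koszul_cohomology_killed1.
Qed.

Lemma koszul_cohomology_MM (MM : lmodType R -> Prop) (hMM : serre MM) i K :
  MM K -> MM (koszul_cohomology x K i).
Proof.
move=> MK; apply: (serre_sur hMM (f := hcl (kcx K) i)); first exact: hcl_sur.
apply: (serre_inj hMM (f := submod_incl _)); first exact: submod_incl_inj.
apply: (serre_inj hMM (f := submod_incl _)); first exact: submod_incl_inj.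
exact: serre_ffun.
Qed.

Lemma koszul0_neq0 X (v : X) : v <> 0 -> (forall c, c \in x -> c *: v = 0) ->
  exists h : {linear koszul_cohomology x X 0 -> X}, exists t, h t <> 0.
Proof.
move=> v0 xv.
have ev : linear (fun f : kcochain X => f finset.set0) by move=> a f g; rewrite !ffunE.
have [||h hE] := @factor_sur _ _ _ _ (hcl (kcx X) 0)
    (mklinear ev \o submod_incl _ \o submod_incl _); first exact: hcl_sur.
  move=> z /hcl0 z0.
  change ((submod_incl _ (submod_incl _ z) : kcochain X) finset.set0 = 0).
  by rewrite (z0 : submod_incl _ z = 0) linear0 ffunE.
have [|f fE] := @kcochain_sur X 0 [ffun S : {set 'I_r} => if S == finset.set0 then v else 0].
  by move=> S; rewrite cards_eq0 ffunE => /negbTE ->.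
have [|z zE] := @cocycle_sur _ (kcx X) 0 f.
  apply: kcochain_ext => S; rewrite kdiffE linear0 [RHS]ffunE big1 // => j jS.
  rewrite fE ffunE; case: ifP; rewrite ?scaler0 // /koszul_coef -scalerA xv ?scaler0 //.
  exact: mem_tnth.
exists h, (hcl _ _ z); rewrite hE.
by change ((submod_incl _ (submod_incl _ z) : kcochain X) finset.set0 <> 0);
   rewrite zE fE ffunE eqxx.
Qed.

Lemma koszul_cobound_mem X n (y : kcx X n) : cobound_set y ->
  forall S, (submod_incl _ y : kcochain X) S \in smulmod (lspan [set` (x : seq R^o)]) X.
Proof.
case: n y => [|n] y; first by move=> -> S; rewrite linear0 ffunE mem0.
case=> z <- S; rewrite kdiffE; apply: rpred_sum => j _; apply: smulmod_gen.
by apply: ideal_mull; apply: lspan_gen; exact: mem_tnth.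
Qed.

(** Evaluation at the full set; this bounds the length of regular sequences. *)
Lemma koszul_top_sur X : exists h : {linear koszul_cohomology x X r ->
    quomod (smulmod (lspan [set` (x : seq R^o)]) X)}, forall y, exists t, h t = y.
Proof.
pose N := smulmod (lspan [set` (x : seq R^o)]) X.
have ev : linear (fun f : kcochain X => f [set: 'I_r]%SET) by move=> a f g; rewrite !ffunE.
have [||h hE] := @factor_sur _ _ _ _ (hcl (kcx X) r)
    (qproj N \o mklinear ev \o submod_incl _ \o submod_incl _); first exact: hcl_sur.
  by move=> z /hcl0/koszul_cobound_mem zN; apply/qproj0; exact: zN.
exists h => y; have [v <-] := qproj_sur y.
have [|f fE] := @kcochain_sur X r
    [ffun S : {set 'I_r} => if S == [set: 'I_r]%SET then v else 0].
  move=> S Sr; rewrite ffunE; case: (S =P [set: 'I_r]%SET) Sr => [->|//].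
  by rewrite cardsT card_ord eqxx.
have [|z zE] := @cocycle_sur _ (kcx X) r f.
  apply: kcochain_ext => S; rewrite kcochainP ?linear0 ?ffunE //.
  by rewrite neq_ltn ltnS (leq_trans (max_card _)) ?card_ord.
exists (hcl _ _ z); rewrite hE; congr (qproj N _).
by change ((submod_incl _ (submod_incl _ z) : kcochain X) [set: 'I_r]%SET = v);
   rewrite zE fE ffunE eqxx.
Qed.

End KoszulFunctor.

(** * The depth *)

Lemma nat_inf_eq (A : set nat) n : A n -> (forall m, (m < n)%N -> ~ A m) -> nat_inf A = Some n.
Proof.
move=> An Amin; rewrite /nat_inf; case: asboolP => [_|[]]; last by exists n.
congr Some; apply: xget_unique.
  by split=> // m Am; rewrite leqNgt; apply/negP => /Amin.
move=> m [Am mmin]; apply/eqP; rewrite eqn_leq mmin // leqNgt.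
by apply/negP => /Amin.
Qed.

Section DepthInfimum.
Variables (R : comNzRingType) (hR : noetherian R) (b : submodClosed R^o).
Variables (MM : lmodType R -> Prop) (hMM : melkersson b MM).
Variables (X : lmodType R) (fX : finitely_generated X).

Lemma depth_in_eq n (ys : seq R) : max_regular_seq MM b X ys -> size ys = n ->
  (forall zs, max_regular_seq MM b X zs -> size zs = n) -> depth_in MM b X = n.
Proof.
move=> ymax yn nmax; apply: xget_unique; first by split=> //; exists ys.
by move=> m [[zs /nmax <- <-]].
Qed.

Variables (T : nat -> lmodType R -> lmodType R) (hT : cohomological T).
Hypothesis T_torsion : forall i Y, finitely_generated Y -> torsion b (T i Y).
Hypothesis T_killed : forall i n K,
  finitely_generated K -> MM K -> killed_by_pow b n K -> MM (T i K).
Hypothesis T0_neq0 : forall (Y : lmodType R) (v : Y), finitely_generated Y -> prime_ann v ->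
  (forall c, c \in b -> c *: v = 0) ->
  exists h : {linear T 0 Y -> Y}, exists t, h t <> 0.

Lemma nat_inf_max_regular (ys : seq R) : max_regular_seq MM b X ys ->
  nat_inf [set i | ~ MM (T i X)] = Some (size ys).
Proof.
move=> ymax; have [yb reg _] := ymax; apply: nat_inf_eq.
  exact: (T_max_regular hR hMM hT T_torsion T_killed T0_neq0 fX ymax).
move=> m my; apply.
exact: (T_regular_below hR hMM hT T_torsion T_killed fX yb reg).
Qed.

(** Otherwise regular sequences in [b] could be extended indefinitely, and a regular
    sequence of length [r.+1] forces [T r X] into the class. *)
Lemma max_regular_ex r : ~ MM (T r X) -> exists ys, max_regular_seq MM b X ys.
Proof.
move=> nT; apply: contrapT => nmax; apply: nT.
have [ys [yb reg ysz]] : exists ys : seq R,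
    [/\ {subset ys <= b}, regular_seq MM X ys & size ys = r.+1].
  elim: r.+1 => [|n [ys [yb reg ysz]]]; first by exists [::]; split=> // j.
  have [y [yin yreg]] : exists y, y \in b /\ regular_seq MM X (rcons ys y).
    apply: contrapT => ny; apply: nmax; exists ys; split=> // y yin yreg.
    by apply: ny; exists y.
  exists (rcons ys y); split=> //; last by rewrite size_rcons ysz.
  by move=> z; rewrite mem_rcons inE => /orP[/eqP->|/yb].
by apply: (T_regular_below hR hMM hT T_torsion T_killed fX yb reg); rewrite ysz.
Qed.

Lemma depth_in_nat_inf : (exists ys, max_regular_seq MM b X ys) ->
  Some (depth_in MM b X) = nat_inf [set i | ~ MM (T i X)].
Proof.
move=> [ys ymax]; rewrite (nat_inf_max_regular ymax); congr Some.
apply: depth_in_eq (ymax) erefl _ => zs zmax.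
by apply: Some_inj; rewrite -!nat_inf_max_regular.
Qed.
End DepthInfimum.

Theorem corollary2p18 (R : comNzRingType) (hR : noetherian R)
    (a : submodClosed R^o) (M : lmodType R) (hM : finitely_generated M)
    (r : nat) (x : r.-tuple R)
    (hx : ideal_add a (annihilator M) =i lspan [set` (x : seq R^o)])
    (MM : lmodType R -> Prop)
    (hMM : melkersson (ideal_add a (annihilator M)) MM)
    (X : lmodType R) (hX : finitely_generated X)
    (hXb : ~ MM (quomod (smulmod (ideal_add a (annihilator M)) X))) :
  let b := ideal_add a (annihilator M) in
  [/\ Some (depth_in MM b X)
        = nat_inf [set i | ~ MM (gen_local_cohomology a i M X)],
      Some (depth_in MM b X)
        = nat_inf [set i | ~ MM (Ext i (quomod (smulmod a M)) X)]
    & Some (depth_in MM b X)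
        = nat_inf [set i | ~ MM (koszul_cohomology x X i)]].
Proof.
move=> b; have sMM : serre MM := hMM.1.
have ktors i Y : finitely_generated Y -> torsion b (koszul_cohomology x Y i).
  move=> _ t; exists 1%N => c /ideal_pow1 cb; apply: koszul_cohomology_killed.
  by rewrite -hx.
have kkill i n K : finitely_generated K -> MM K -> killed_by_pow b n K ->
    MM (koszul_cohomology x K i).
  by move=> _ MK _; exact: koszul_cohomology_MM.
have kneq0 (Y : lmodType R) (v : Y) : finitely_generated Y -> prime_ann v ->
    (forall c, c \in b -> c *: v = 0) ->
    exists h : {linear koszul_cohomology x Y 0 -> Y}, exists t, h t <> 0.
  move=> _ [v0 _] bv; apply: koszul0_neq0 v0 _ => c cx; apply: bv.
  by rewrite hx; exact: lspan_gen.
have [ys ymax] : exists ys, max_regular_seq MM b X ys.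
  apply: (max_regular_ex hR hMM hX (koszul_cohomological x) ktors kkill (r := r)) => MT.
  apply: hXb; have [h hsur] := koszul_top_sur x X.
  have MQ := serre_sur sMM hsur MT.
  have [||g gE] := @factor_sur _ _ _ _ (qproj (smulmod (lspan [set` (x : seq R^o)]) X))
     (qproj (smulmod b X)).
  - exact: qproj_sur.
  - by move=> v /qproj0 vx; apply/qproj0; apply: smulmodS vx => c; rewrite hx.
  apply: (serre_sur sMM (f := g)) MQ => y; have [v <-] := qproj_sur y.
  by exists (qproj _ v).
split.
- apply: (depth_in_nat_inf hR hMM hX (Ext_lim_cohomological (pow_quo_map a M))); last by exists ys.
  + by move=> i Y _; exact: Ext_lim_torsion.
  + by move=> i n K _; exact: Ext_lim_killed.
  + by move=> Y v _; exact: Ext_lim0_neq0.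
- apply: (depth_in_nat_inf hR hMM hX (Ext_cohomological (quomod (smulmod a M)))); last by exists ys.
  + by move=> i Y _; exact: Ext_torsion.
  + by move=> i n K _ MK _; apply: Ext_MM => //; exact: fg_quo.
  + by move=> Y v _; exact: Ext0_neq0.
- by apply: (depth_in_nat_inf hR hMM hX (koszul_cohomological x)); last by exists ys.
Qed.
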